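(* For all integers $m,n\geq 2$ there is an isomorphism \[\check{\pi}_n(\mathbb{E}_m)\cong \bigoplus_{1\leq j\leq \frac{n-1}{m-1}}\left(\pi_{n}(S^{mj-j+1})\right)^{\mathbb{N}}.\]
   Context: For $m\geq 2$, $\mathbb{E}_m$ (the $m$-dimensional earring space) is the shrinking wedge of countably many $m$-spheres $S^m_1,S^m_2,\dots$: its underlying set is the one-point union $\bigvee_{j\in\mathbb{N}}S^m_j$ with wedgepoint $b_0$, and a set $U$ is open iff $U\cap S^m_j$ is open in $S^m_j$ for every $j$ and, whenever $b_0\in U$, $S^m_j\subseteq U$ for all but finitely many $j$. For $k\in\mathbb{N}$ let $X_{\leq k}=\bigvee_{j=1}^{k}S^m_j$, let $b_{k+1,k}:X_{\leq k+1}\to X_{\leq k}$ collapse the $(k+1)$-st sphere to the wedgepoint. The $n$-th Čech homotopy group is $\check{\pi}_n(\mathbb{E}_m)=\varprojlim_k\big(\pi_n(X_{\leq k}),(b_{k+1,k})_\#\big)$. For an abelian group $G$, $G^{\mathbb{N}}$ denotes the direct product of countably infinitely many copies of $G$. *)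

(* Defs.v *)
From HB Require Import structures.
From mathcomp Require Import all_boot all_order all_algebra.
From mathcomp Require Import all_classical all_reals all_analysis.
From mathcomp Require Import generic_quotient.
From mathcomp Require Import homotopy.
From mathcomp Require Import Rstruct Rstruct_topology.
From Stdlib Require Rdefinitions.

Unset Printing Implicit Defensive.
Import Order.TTheory GRing.Theory Num.Theory.
Local Open Scope classical_set_scope.
Local Open Scope ring_scope.

Notation RR := Rdefinitions.R.

(* The Euclidean unit sphere S^d in R^(d+1) (row vectors), with the subspace
   topology (set_type = sigma type with the initial topology). *)
Definition sphere_set (d : nat) : set 'rV[RR]_(d.+1) :=
  [set x | \sum_(i < d.+1) (x ord0 i) ^+ 2 = 1].

Definition Sph (d : nat) : topologicalType := @set_type _ (sphere_set d).

Definition e0 (d : nat) : 'rV[RR]_(d.+1) := \row_(i < d.+1) ((i == ord0)%:R).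

Lemma e0_in_sphere d : e0 d \in sphere_set d.
Proof.
apply/mem_set; rewrite /sphere_set /= big_ord_recl /e0 !mxE eqxx expr1n.
rewrite big1 ?addr0 // => i _; rewrite mxE.
by rewrite (_ : (lift ord0 i == ord0) = false) ?expr0n //; apply/negbTE/neq_lift.
Qed.

Definition sph_pt (d : nat) : Sph d := exist _ (e0 d) (e0_in_sphere d).

Definition cube (n : nat) : set 'rV[RR]_n :=
  [set x | forall i, 0 <= x ord0 i <= 1].

Definition cube_bdry (n : nat) : set 'rV[RR]_n :=
  [set x | exists i, x ord0 i = 0 \/ x ord0 i = 1].

Section HomotopyGroup.
Context (n : nat) (X : topologicalType) (x0 : X).

(* a continuous map (I^n, dI^n) -> (X, x0); only its values on I^n matter *)
Definition sphmap (f : 'rV[RR]_n -> X) : Prop :=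
  {within cube n, continuous f} /\
  (forall t, cube n t -> cube_bdry n t -> f t = x0).

Definition homot (f g : 'rV[RR]_n -> X) : Prop :=
  exists H : RR * 'rV[RR]_n -> X,
    {within [set p | 0 <= p.1 <= 1 /\ cube n p.2], continuous H} /\
    (forall t, cube n t -> H (0, t) = f t) /\
    (forall t, cube n t -> H (1, t) = g t) /\
    (forall s t, 0 <= s <= 1 -> cube n t -> cube_bdry n t -> H (s, t) = x0).

Definition hclass (f : 'rV[RR]_n -> X) : set ('rV[RR]_n -> X) :=
  [set g | sphmap g /\ homot f g].

Definition pin : Type :=
  {A : set ('rV[RR]_n -> X) | exists f, sphmap f /\ A = hclass f}.

Lemma sphmap_cst : sphmap (fun _ => x0).
Proof. split => //; apply: continuous_subspaceT; exact: cst_continuous. Qed.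

(* the class of f (totalized: the trivial class if f is not a sphere map) *)
Definition pin_of (f : 'rV[RR]_n -> X) : pin :=
  match pselect (sphmap f) with
  | left h => exist _ (hclass f) (ex_intro _ f (conj h erefl))
  | right _ => exist _ (hclass (fun _ => x0))
                 (ex_intro _ (fun _ => x0) (conj sphmap_cst erefl))
  end.

Definition pin_rep (A : pin) : 'rV[RR]_n -> X := projT1 (cid (projT2 A)).

Definition stretch (a b : RR) (t : 'rV[RR]_n) : 'rV[RR]_n :=
  \row_(i < n) (if (i : nat) == 0%N then a * t ord0 i + b else t ord0 i).

Definition concat (f g : 'rV[RR]_n -> X) (t : 'rV[RR]_n) : X :=
  if [exists i : 'I_n, ((i : nat) == 0%N) && (t ord0 i <= 2^-1)] then
    f (stretch 2 0 t) else g (stretch 2 (-1) t).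

Definition pin_mul (A B : pin) : pin := pin_of (concat (pin_rep A) (pin_rep B)).

End HomotopyGroup.

Arguments sphmap n {X} x0 f.
Arguments homot n {X} x0 f g.
Arguments hclass n {X} x0 f.
Arguments pin n {X} x0.
Arguments pin_of n {X} x0 f.
Arguments pin_rep n {X} x0 A.
Arguments concat n {X} f g t.
Arguments pin_mul n {X} x0 A B.

Definition pin_map (n : nat) {X Y : topologicalType} {x0 : X} {y0 : Y}
  (h : X -> Y) (A : pin n x0) : pin n y0 := pin_of n y0 (h \o pin_rep n x0 A).

(* X_{<= k+1} := wedge of k+1 copies of S^m (indexed by 'I_(k.+1)), as the
   quotient of the disjoint union identifying the base points. *)
Definition Wedge (m k : nat) : topologicalType :=
  @wedge 'I_k.+1 (fun _ => Sph m) (fun _ => sph_pt m).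

Definition wedge_pt (m k : nat) : Wedge m k := @wedge_lift _ _ _ ord0 (sph_pt m).

Definition bond (m k : nat) : Wedge m k.+1 -> Wedge m k :=
  wedge_fun (fun (i : 'I_k.+2) (x : Sph m) =>
    match unlift ord_max i with
    | Some j => @wedge_lift 'I_k.+1 (fun _ => Sph m) (fun _ => sph_pt m) j x
    | None => wedge_pt m k
    end).

Definition cech_thread (m n : nat) (c : forall k, pin n (wedge_pt m k)) : Prop :=
  forall k, pin_map n (bond m k) (c k.+1) = c k.

Definition cech_mul (m n : nat) (a b : forall k, pin n (wedge_pt m k)) :
  forall k, pin n (wedge_pt m k) := fun k => pin_mul n _ (a k) (b k).

(* index j : 'I_J stands for j+1, J = floor((n-1)/(m-1)); sphere S^{m j - j + 1} *)
Definition rdim (m : nat) (j : nat) : nat := (m * j.+1 - j.+1 + 1)%N.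

Definition rhs (m n : nat) : Type :=
  forall j : 'I_((n.-1) %/ (m.-1)), nat -> pin n (sph_pt (rdim m j)).

Definition rhs_mul (m n : nat) (a b : rhs m n) : rhs m n :=
  fun j l => pin_mul n _ (a j l) (b j l).

(* Main.v *)
(* The kernel of pi_n(X v Y) -> pi_n(X) is pi_n of the homotopy fibre of the
   projection, and this fibre deforms onto the half-smash product of Y with the
   loop space of X.  When X and Y are wedges of spheres, the half-smash product
   is a wedge of suspensions of the loop space LX; splitting SLX as the wedge
   of S^1 and the half-smash of X with LX, again and again, exchanges it for
   spheres together with suspensions of LX of dimension so high that pi_n does
   not see them.  Hence every such kernel is pi_n of a finite wedge of spheres,
   and peeling off the spheres in order of dimension shows that it is a finite
   product of groups pi_n(S^x).  Starting from copies of S^m, the x that occur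
   are of the form j(m-1)+1; and all these numbers up to n do occur in the
   kernel of each bonding map.  The threads are the product of these kernels,
   so each pi_n(S^(j(m-1)+1)) appears countably often.

   The homotopy theory is done for sets with a convergence relation for
   sequences instead of topological spaces: mapping spaces are then immediate,
   and homotopy groups of the spaces at hand are unchanged, cubes being
   metrizable. *)
Require Import Defs.
From HB Require Import structures.
From mathcomp Require Import all_boot all_order all_algebra.
From mathcomp Require Import all_classical all_reals all_analysis.
From mathcomp Require Import homotopy Rstruct Rstruct_topology.
From mathcomp Require Import ring lra zify.
Set Implicit Arguments.
Unset Strict Implicit.
Unset Printing Implicit Defensive.
Import Order.TTheory GRing.Theory Num.Theory.
Local Open Scope classical_set_scope.
Local Open Scope ring_scope.

(** Half-smash products and suspensions of loop spaces collapse non-compact subspaces, and the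
    quotient topology at the base point would in general not be governed by sequences. So a real
    function, the gauge, defines the topology there. The price: near the base point a map may rely
    on the gauge alone, while the loop coordinate may do anything. Hence the margins in the
    formulas: constructions that use the loop become trivial already at a positive gauge. The
    splitting of SLX comes from the path space PX: it is contractible, so PX/LX is a suspension of
    LX. If every point of X other than the base point has a path to the base point, chosen
    continuously, these paths trivialise PX off the base point, and PX/LX becomes the half-smash
    product of X with LX. In a suspension such paths run along the suspension coordinate. High
    suspensions of any space Q are invisible to low-dimensional cubes because a map into the open
    d-cube times Q, with the boundary of the cube collapsed, can be pushed away in its cube
    coordinates alone, Q being carried along. *)

Ltac minmax := repeat match goal with
  | |- context [Num.min ?a ?b] => case: (leP a b)
  | |- context [Num.max ?a ?b] => case: (leP a b)
  end; intros.

(** * Eventual properties and limits of real sequences *)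

Definition ev (P : nat -> Prop) : Prop := exists N, forall n, (N <= n)%N -> P n.

Lemma evT (P : nat -> Prop) : (forall n, P n) -> ev P.
Proof. by move=> h; exists 0%N => n _. Qed.

Lemma ev_mp2 (P Q S : nat -> Prop) :
  (forall n, P n -> Q n -> S n) -> ev P -> ev Q -> ev S.
Proof.
move=> h [a ha] [b hb]; exists (maxn a b) => n; rewrite geq_max => /andP[an bn].
by apply: h; [exact: ha|exact: hb].
Qed.

Lemma ev_mp (P Q : nat -> Prop) : (forall n, P n -> Q n) -> ev P -> ev Q.
Proof. by move=> h [a ha]; exists a => n an; apply/h/ha. Qed.

Lemma ev_and (P Q : nat -> Prop) : ev P -> ev Q -> ev (fun n => P n /\ Q n).
Proof. exact: ev_mp2. Qed.

Definition rcv (u : nat -> RR) (l : RR) : Prop :=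
  forall e, 0 < e -> ev (fun n => `|u n - l| < e).

Section RealLimits.
Import numFieldNormedType.Exports.

Lemma dist_cvgP (R : realType) (u : nat -> R) (l : R) :
  (forall e, 0 < e -> ev (fun n => `|u n - l| < e)) <-> u @ \oo --> l.
Proof.
split=> [h|/cvgrPdist_lt h e e0].
  apply/cvgrPdist_lt => e e0; have [N hN] := h e e0.
  by exists N => // n /= Nn; rewrite distrC; exact: hN.
by have [N _ hN] := h e e0; exists N => n Nn; rewrite distrC; exact: hN.
Qed.

Lemma rcvP (u : nat -> RR) (l : RR) : rcv u l <-> u @ \oo --> l.
Proof. exact: dist_cvgP. Qed.

End RealLimits.

Lemma rcv_cst c : rcv (fun _ => c) c.
Proof. by move=> e e0; apply: evT => n; rewrite subrr normr0. Qed.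

Lemma rcvD u v a b : rcv u a -> rcv v b -> rcv (fun n => u n + v n) (a + b).
Proof.
move=> h k e e0; have e2 : 0 < e / 2 by lra.
apply: ev_mp2 (h _ e2) (k _ e2) => n.
by rewrite !ltr_norml => /andP[h1 h2] /andP[k1 k2]; lra.
Qed.

Lemma rcvN u a : rcv u a -> rcv (fun n => - u n) (- a).
Proof.
by move=> h e e0; apply: ev_mp (h _ e0) => n; rewrite !ltr_norml; lra.
Qed.

Lemma rcvM u v a b : rcv u a -> rcv v b -> rcv (fun n => u n * v n) (a * b).
Proof. by move=> /rcvP h /rcvP k; apply/rcvP; apply: cvgM. Qed.

Lemma rcv_norm u a : rcv u a -> rcv (fun n => `|u n|) `|a|.
Proof.
move=> h e e0; apply: ev_mp (h _ e0) => n; apply: le_lt_trans.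
exact: ler_dist_dist.
Qed.

Lemma rcvV u a : a != 0 -> rcv u a -> rcv (fun n => (u n)^-1) a^-1.
Proof. by move=> a0 /rcvP h; apply/rcvP; apply: cvgV. Qed.

Lemma rcv_min u v a b : rcv u a -> rcv v b ->
  rcv (fun n => Num.min (u n) (v n)) (Num.min a b).
Proof.
move=> h k e e0; apply: ev_mp2 (h _ e0) (k _ e0) => n.
by rewrite !ltr_norml => /andP[h1 h2] /andP[k1 k2]; minmax; lra.
Qed.

Lemma rcv_max u v a b : rcv u a -> rcv v b ->
  rcv (fun n => Num.max (u n) (v n)) (Num.max a b).
Proof.
move=> h k e e0; apply: ev_mp2 (h _ e0) (k _ e0) => n.
by rewrite !ltr_norml => /andP[h1 h2] /andP[k1 k2]; minmax; lra.
Qed.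

Lemma rcv_tail u v a : ev (fun n => u n = v n) -> rcv u a -> rcv v a.
Proof. by move=> h k e e0; apply: ev_mp2 h (k _ e0) => n <-. Qed.

Lemma rcv_mix (P : nat -> bool) u v a : rcv u a -> rcv v a ->
  rcv (fun n => if P n then u n else v n) a.
Proof. by move=> h k e e0; apply: ev_mp2 (h _ e0) (k _ e0) => n; case: (P n). Qed.

Lemma ev_lt u a c : rcv u a -> a < c -> ev (fun n => u n < c).
Proof.
move=> h ac; have e0 : 0 < c - a by lra.
by apply: ev_mp (h _ e0) => n; rewrite ltr_norml => /andP[]; lra.
Qed.

Lemma ev_gt u a c : rcv u a -> c < a -> ev (fun n => c < u n).
Proof.
move=> h ac; have e0 : 0 < a - c by lra.
by apply: ev_mp (h _ e0) => n; rewrite ltr_norml => /andP[]; lra.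
Qed.

Lemma rcv_le0 u v : ev (fun n => 0 <= u n <= v n) -> rcv v 0 -> rcv u 0.
Proof.
move=> h k e e0; apply: ev_mp2 h (k _ e0) => n /andP[h1 h2].
by rewrite !subr0 !ltr_norml => /andP[_ ?]; lra.
Qed.

Lemma rcv_eqcst u c : ev (fun n => u n = c) -> rcv u c.
Proof. by move=> h; apply: rcv_tail (rcv_cst c); apply: ev_mp h => n ->. Qed.

Definition cl (x : RR) : RR := Num.max 0 (Num.min 1 x).

Lemma cl01 x : 0 <= cl x <= 1.
Proof. by rewrite /cl; minmax; lra. Qed.

Lemma cl_id x : 0 <= x <= 1 -> cl x = x.
Proof. by rewrite /cl => ?; minmax; lra. Qed.

Lemma cl_le0 x : x <= 0 -> cl x = 0.
Proof. by rewrite /cl => ?; minmax; lra. Qed.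

Lemma cl_ge1 x : 1 <= x -> cl x = 1.
Proof. by rewrite /cl => ?; minmax; lra. Qed.

Lemma rcv_cl u a : rcv u a -> rcv (fun n => cl (u n)) (cl a).
Proof.
by move=> h; apply: rcv_max; [exact: rcv_cst|apply: rcv_min => //; exact: rcv_cst].
Qed.

Ltac rcvt := repeat match goal with
  | H : rcv ?u ?a |- rcv ?u ?a => exact: H
  | |- rcv (fun n => (_ + _)%R) _ => apply: rcvD
  | |- rcv (fun n => (- _)%R) _ => apply: rcvN
  | |- rcv (fun n => (_ * _)%R) _ => apply: rcvM
  | |- rcv (fun n => cl _) _ => apply: rcv_cl
  | |- rcv (fun n => Num.min _ _) _ => apply: rcv_min
  | |- rcv (fun n => Num.max _ _) _ => apply: rcv_max
  | |- _ => first [assumption | exact: rcv_cst | apply: rcvD | apply: rcvN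
      | apply: rcvM | apply: rcv_cl | apply: rcv_min | apply: rcv_max]
  end.

(** * Convergence spaces *)

(* A space is a set with a relation "the sequence u converges to x".  Constant
   sequences need not converge: the points at which they do are the valid
   ones, and only these are meaningful.  This gives mapping spaces (with
   continuous convergence) whose carrier is the plain function type. *)
Record cs := Cs {
  car :> Type;
  cv : (nat -> car) -> car -> Prop;
  cv_mix : forall (P : nat -> bool) u v x, cv u x -> cv v x ->
    cv (fun n => if P n then u n else v n) x;
  cv_tail : forall u v x, ev (fun n => u n = v n) -> cv u x -> cv v x;
  cv_lim : forall u x, cv u x -> cv (fun _ => x) x;
  cv_mem : forall u x, cv u x -> ev (fun n => cv (fun _ => u n) (u n)) }.

Arguments cv : simpl never.

Definition val (E : cs) (x : E) : Prop := cv (fun _ : nat => x) x.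

Lemma cv_val (E : cs) u (x : E) : cv u x -> val x.
Proof. exact: cv_lim. Qed.

Lemma cv_eqcst (E : cs) u (x : E) : val x -> ev (fun n => u n = x) -> cv u x.
Proof. by move=> h k; apply: cv_tail h; apply: ev_mp k => n ->. Qed.

(** The pasting lemma. When [t0 = c], both branches may be taken infinitely often; [cv_mix] is the
    axiom made for this case. *)
Lemma cv_if (E : cs) (t : nat -> RR) t0 c (a b : nat -> E) a0 b0 :
  rcv t t0 -> (t0 <= c -> cv a a0) -> (c <= t0 -> cv b b0) ->
  (t0 = c -> a0 = b0) ->
  cv (fun n => if t n <= c then a n else b n) (if t0 <= c then a0 else b0).
Proof.
move=> ht ha hb hab; case: (ltgtP t0 c) => h.
- apply: cv_tail (ha (ltW h)); apply: ev_mp (ev_lt ht h) => n /ltW -> //.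
- apply: cv_tail (hb (ltW h)); apply: ev_mp (ev_gt ht h) => n k.
  by rewrite leNgt k.
- by apply: cv_mix; [apply: ha|rewrite hab//; apply: hb]; rewrite h.
Qed.

Definition cts (E F : cs) (f : E -> F) : Prop :=
  forall u x, cv u x -> cv (fun n => f (u n)) (f x).

Lemma cts_val (E F : cs) (f : E -> F) x : cts f -> val x -> val (f x).
Proof. by move=> h /h. Qed.

Lemma cts_comp (E F G : cs) (f : E -> F) (g : F -> G) :
  cts f -> cts g -> cts (fun x => g (f x)).
Proof. by move=> hf hg u x /hf/hg. Qed.

Definition Rl : cs.
Proof.
refine (@Cs RR rcv rcv_mix rcv_tail _ _) => *; first exact: rcv_cst.
by apply: evT => n; exact: rcv_cst.
Defined.

Definition prod_cs (E F : cs) : cs.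
Proof.
refine (@Cs (E * F)%type (fun u x => cv (fun n => (u n).1) x.1 /\
   cv (fun n => (u n).2) x.2) _ _ _ _).
- move=> P u v x [a b] [c d]; split.
    by apply: cv_tail (cv_mix P a c); apply: evT => n; case: ifP.
  by apply: cv_tail (cv_mix P b d); apply: evT => n; case: ifP.
- by move=> u v x h [a b]; split; [apply: cv_tail a|apply: cv_tail b];
    apply: ev_mp h => n ->.
- by move=> u x [/cv_lim a /cv_lim b].
- by move=> u x [/cv_mem a /cv_mem b]; apply: ev_mp2 a b.
Defined.

(** The carrier remains [E] and the predicate enters only the convergence, so maps into a subspace
    are ordinary functions, to be checked at valid points. *)
Definition sub_cs (E : cs) (P : E -> Prop) : cs.
Proof.
refine (@Cs E (fun u x => [/\ cv u x, P x & ev (fun n => P (u n))]) _ _ _ _).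
- move=> Q u v x [a b c] [d _ e]; split=> //; first exact: cv_mix.
  by apply: ev_mp2 c e => n; case: (Q n).
- move=> u v x h [a b c]; split=> //; first exact: cv_tail a.
  by apply: ev_mp2 h c => n ->.
- by move=> u x [/cv_lim a b c]; split=> //; exact: evT.
- by move=> u x [/cv_mem a b c]; apply: ev_mp2 a c => n *; split=> //; exact: evT.
Defined.

Lemma val_sub (E : cs) (P : E -> Prop) (x : sub_cs P) :
  val x <-> val (x : E) /\ P x.
Proof. by split=> [[]|[a b]]; split=> //; exact: evT. Qed.

Definition Iv : cs := @sub_cs Rl (fun t : RR => 0 <= t <= 1).

Lemma val_Iv (t : RR) : 0 <= t <= 1 -> val (t : Iv).
Proof. by move=> h; apply/val_sub; split=> //; exact: rcv_cst. Qed.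

Lemma cv_clamp u a : rcv u a -> @cv Iv (fun n => cl (u n)) (cl a).
Proof.
by move=> h; split; [exact: rcv_cl|exact: cl01|apply: evT => n; exact: cl01].
Qed.

Definition vec (n : nat) : cs.
Proof.
refine (@Cs 'rV[RR]_n (fun u x => forall i, rcv (fun k => u k ord0 i) (x ord0 i))
  _ _ _ _).
- move=> P u v x a b i.
  by apply: rcv_tail (rcv_mix P (a i) (b i)); apply: evT => k; case: ifP.
- by move=> u v x h a i; apply: rcv_tail (a i); apply: ev_mp h => k ->.
- by move=> *; exact: rcv_cst.
- by move=> *; apply: evT => k i; exact: rcv_cst.
Defined.

Lemma val_vec n (x : vec n) : val x.
Proof. by move=> i; exact: rcv_cst. Qed.

Definition unit_cs : cs.
Proof. by refine (@Cs unit (fun _ _ => True) _ _ _ _) => // *; exact: evT. Defined.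

Definition pathv (X : cs) (w : RR -> X) : Prop :=
  forall t t0, rcv t t0 -> cv (fun n => w (t n)) (w t0).

(** Continuous convergence: nearby paths at nearby times have nearby values. Paths live on the whole
    line, so that reparametrisations need no range conditions. *)
Definition pth (X : cs) : cs.
Proof.
refine (@Cs (RR -> X) (fun u x => [/\ pathv x, ev (fun n => pathv (u n)) &
   forall t t0, rcv t t0 -> cv (fun n => u n (t n)) (x t0)]) _ _ _ _).
- move=> P u v x [a b c] [_ d e]; split=> //.
    by apply: ev_mp2 b d => n; case: (P n).
  move=> t t0 h; apply: cv_tail (cv_mix P (c _ _ h) (e _ _ h)).
  by apply: evT => n; case: ifP.
- move=> u v x h [a b c]; split=> //; first by apply: ev_mp2 h b => n ->.
  by move=> t t0 /c; apply: cv_tail; apply: ev_mp h => n ->.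
- by move=> u x [a b c]; split=> //; apply: evT.
- by move=> u x [a b c]; apply: ev_mp b => n h; split=> //; exact: evT.
Defined.

Lemma val_pth (X : cs) (w : pth X) : pathv w -> val w.
Proof. by move=> h; split=> //; exact: evT. Qed.

Lemma cv_pth (E X : cs) (F : E -> RR -> X) u x : cv u x ->
  (forall v y t t0, cv v y -> rcv t t0 -> cv (fun n => F (v n) (t n)) (F y t0)) ->
  cv (fun n => F (u n) : pth X) (F x).
Proof.
move=> h k; split.
- by move=> t t0 ht; apply: (k (fun _ => x)) => //; exact: cv_lim h.
- by apply: ev_mp (cv_mem h) => n hn t t0 ht; apply: (k (fun _ => u n)).
- by move=> t t0 ht; apply: k.
Qed.

(** * Pointed spaces and homotopies *)

Record pcs := Pcs { pcar :> cs; pt : pcar; val_pt : val pt }.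
Arguments pt : clear implicits.
Arguments val_pt : clear implicits.

Definition pmap (M N : pcs) (f : M -> N) : Prop := cts f /\ f (pt M) = pt N.

(** [A] will be the base point for pointed homotopies, and the complement of the open cube for
    spheroids. *)
Definition rhom (E : cs) (A : E -> Prop) (N : pcs) (f g : E -> N) : Prop :=
  exists H : RR -> E -> N,
    [/\ @cts (prod_cs Iv E) N (fun p => H p.1 p.2),
        forall t x, 0 <= t <= 1 -> A x -> H t x = pt N,
        forall x, val x -> H 0 x = f x &
        forall x, val x -> H 1 x = g x].

Definition hom (M N : pcs) (f g : M -> N) : Prop :=
  rhom (fun x => x = pt M) f g.

Lemma cts_ext (E F : cs) (f g : E -> F) :
  (forall x, val x -> f x = g x) -> cts f -> cts g.
Proof.
move=> h hf u x ux; rewrite -h; last exact: cv_val ux.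
by apply: cv_tail (hf _ _ ux); apply: ev_mp (cv_mem ux) => n /h.
Qed.

Lemma rhom_refl (E : cs) (A : E -> Prop) (N : pcs) (f g : E -> N) :
  cts f -> (forall x, A x -> f x = pt N) -> (forall x, val x -> f x = g x) ->
  rhom A f g.
Proof.
move=> hf f0 fg; exists (fun _ => f).
by split=> // [u x [_ h]|t x _ /f0//]; exact: hf h.
Qed.

Lemma hom_refl (M N : pcs) (f g : M -> N) : pmap f ->
  (forall x, val x -> f x = g x) -> hom f g.
Proof. by move=> [hf f0] fg; apply: rhom_refl => // x ->. Qed.

Lemma rhom_sym (E : cs) (A : E -> Prop) (N : pcs) (f g : E -> N) :
  rhom A f g -> rhom A g f.
Proof.
move=> [H [h hp h0 h1]]; exists (fun t => H (1 - t)); split.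
- move=> u x [[h2 h3 h4] h5].
  apply: (h (fun n => (1 - (u n).1, (u n).2)) (1 - x.1, x.2)); split=> //=.
  split; first by rcvt.
    by move: h3; lra.
  by apply: ev_mp h4 => n /=; lra.
- by move=> t x ht; apply: hp; lra.
- by move=> x; rewrite subr0; exact: h1.
- by move=> x; rewrite subrr; exact: h0.
Qed.

Lemma rhom_trans (E : cs) (A : E -> Prop) (N : pcs) (f g k : E -> N) :
  rhom A f g -> rhom A g k -> rhom A f k.
Proof.
move=> [H [h hp h0 h1]] [K [l lp l0 l1]].
exists (fun t x => if t <= 2^-1 then H (cl (2 * t)) x else K (cl (2 * t - 1)) x).
split.
- move=> u x [[h2 h3 h4] h5]; apply: cv_if => //.
  + move=> _; apply: (h (fun n => (cl (2 * (u n).1), (u n).2)) (_, _)).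
    split=> //; split; [by rcvt|exact: cl01|by apply: evT => n; exact: cl01].
  + move=> _; apply: (l (fun n => (cl (2 * (u n).1 - 1), (u n).2)) (_, _)).
    split=> //; split; [by rcvt|exact: cl01|by apply: evT => n; exact: cl01].
  + move=> ->; rewrite mulfV ?pnatr_eq0// subrr cl_ge1// cl_le0//.
    by rewrite h1 ?l0//; exact: cv_val h5.
- by move=> t x ht Ax; case: ifP => _; [apply: hp|apply: lp] => //; exact: cl01.
- by move=> x vx; rewrite ifT ?invr_ge0// mulr0 cl_le0// h0.
- move=> x vx; rewrite ifF; last by apply/negbTE; lra.
  by rewrite cl_ge1 ?l1//; lra.
Qed.

Lemma hom_trans (M N : pcs) (f g k : M -> N) : hom f g -> hom g k -> hom f k.
Proof. exact: rhom_trans. Qed.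

Lemma hom_comp (M N P Q : pcs) (a : M -> N) (f g : N -> P) (b : P -> Q) :
  pmap a -> pmap b -> hom f g -> hom (fun x => b (f (a x))) (fun x => b (g (a x))).
Proof.
move=> [ca a0] [cb b0] [H [h hp h0 h1]].
exists (fun t x => b (H t (a x))); split.
- move=> u x [h2 h3].
  by apply/cb/(h (fun n => ((u n).1, a (u n).2)) (_, _)); split=> //=; apply: ca.
- by move=> t x ht ->; rewrite a0 hp.
- by move=> x vx; rewrite h0//; exact: cts_val.
- by move=> x vx; rewrite h1//; exact: cts_val.
Qed.

Definition heq (M N : pcs) : Prop :=
  exists (f : M -> N) (g : N -> M),
    [/\ pmap f, pmap g, hom (fun x => g (f x)) id & hom (fun x => f (g x)) id].

Lemma pmap_comp (M N P : pcs) (f : M -> N) (g : N -> P) :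
  pmap f -> pmap g -> pmap (fun x => g (f x)).
Proof.
by move=> [cf f0] [cg g0]; split; [exact: cts_comp|rewrite f0].
Qed.

Lemma pmap_id (M : pcs) : @pmap M M id.
Proof. by split. Qed.

Lemma pmap_cst (M N : pcs) : @pmap M N (fun _ => pt N).
Proof. by split=> // u x _; exact: val_pt. Qed.

Lemma heq_iso (M N : pcs) (f : M -> N) (g : N -> M) : pmap f -> pmap g ->
  (forall x, val x -> g (f x) = x) -> (forall x, val x -> f (g x) = x) ->
  heq M N.
Proof.
move=> pf pg gf fg; exists f, g; split=> //.
  by apply: hom_refl => //; exact: pmap_comp.
by apply: hom_refl => //; exact: pmap_comp.
Qed.

Lemma heq_refl (M : pcs) : heq M M.
Proof. by apply: (@heq_iso _ _ id id) => //; exact: pmap_id. Qed.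

Lemma heq_sym (M N : pcs) : heq M N -> heq N M.
Proof. by move=> [f [g [*]]]; exists g, f; split. Qed.

Lemma heq_trans (M N P : pcs) : heq M N -> heq N P -> heq M P.
Proof.
move=> [f [g [pf pg gf fg]]] [k [l [pk pl lk kl]]].
exists (fun x => k (f x)), (fun x => g (l x)); split; try exact: pmap_comp.
- apply: hom_trans gf; exact: (hom_comp pf pg lk).
- apply: hom_trans kl; exact: (hom_comp pl pk fg).
Qed.

(** * Gauged spaces and coarse quotients *)

(* The gauge u measures the distance to the base point, and the topology at
   the base point is the one given by u. *)
Record gsp := Gsp {
  gcar :> pcs;
  gu : gcar -> RR;
  gu01 : forall x, 0 <= gu x <= 1;
  gu_cv : @cts gcar Rl gu;
  gu_pt : gu (pt gcar) = 0;
  gu_eq0 : forall x, val x -> gu x = 0 -> x = pt gcar;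
  gu_base : forall w, ev (fun n => val (w n)) -> rcv (fun n => gu (w n)) 0 ->
    cv w (pt gcar) }.

Lemma gu_gt0 (M : gsp) (x : M) : val x -> x <> pt M -> 0 < gu x.
Proof.
move=> vx x0; rewrite lt_neqAle; have /andP[-> _] := gu01 x; rewrite andbT.
by apply/negP => /eqP h; apply/x0/gu_eq0.
Qed.

Lemma ev_pt (M : gsp) u (x : M) : cv u x -> x <> pt M -> ev (fun n => u n <> pt M).
Proof.
move=> h x0; have /(ev_gt (gu_cv h)) := gu_gt0 (cv_val h) x0.
by apply: ev_mp => n /[swap] ->; rewrite /= gu_pt ltxx.
Qed.

Section CoarseQuotient.
Context (E : cs) (v : E -> RR).
Hypotheses (v01 : forall x, 0 <= v x <= 1) (vc : @cts E Rl v).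

(** [None] is the base point. Points of [E] of gauge 0 are collapsed to it, so [Some e] is valid
    only at positive gauge. *)
Definition oval (y : option E) : Prop :=
  if y is Some e then val e /\ 0 < v e else True.

Definition ou (y : option E) : RR := if y is Some e then v e else 0.

Definition ocv (w : nat -> option E) (y : option E) : Prop :=
  if y is Some e then
    0 < v e /\ exists2 z, cv z e & ev (fun n => w n = Some (z n))
  else ev (fun n => oval (w n)) /\ rcv (fun n => ou (w n)) 0.

Lemma oval_ocv y : oval y <-> ocv (fun _ => y) y.
Proof.
case: y => [e|] /=; split.
- by move=> [h k]; split=> //; exists (fun _ => e) => //; exact: evT.
- move=> [h [z hz [N /(_ N (leqnn N)) _]]]; split=> //; exact: cv_val hz.
- by move=> _; split; [exact: evT|exact: rcv_cst].
- by [].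
Qed.

Definition ocs : cs.
Proof.
refine (@Cs (option E) ocv _ _ _ _).
- move=> P w w' [e|] /=.
    move=> [h [z hz hw]] [_ [z' hz' hw']]; split=> //.
    exists (fun n => if P n then z n else z' n); first exact: cv_mix.
    by apply: ev_mp2 hw hw' => n; case: (P n).
  move=> [a b] [c d]; split; first by apply: ev_mp2 a c => n; case: (P n).
  apply: rcv_tail (rcv_mix P b d); apply: evT => n; by case: (P n).
- move=> w w' [e|] h /=.
    move=> [k [z hz hw]]; split=> //; exists z => //.
    by apply: ev_mp2 h hw => n ->.
  move=> [a b]; split; first by apply: ev_mp2 h a => n ->.
  by apply: rcv_tail b; apply: ev_mp h => n ->.
- move=> w [e|] /=; last by move=> _; split; [exact: evT|exact: rcv_cst].
  move=> [k [z hz hw]]; split=> //; exists (fun _ => e); last exact: evT.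
  exact: cv_lim hz.
- move=> w [e|] /=; last by move=> [a _]; apply: ev_mp a => n /oval_ocv.
  move=> [k [z hz hw]].
  have := ev_and (ev_gt (vc hz) k) (cv_mem hz); apply: ev_mp2 hw => n -> [a b].
  by apply/oval_ocv.
Defined.

Lemma oval_pt : @val ocs None.
Proof. by split; [exact: evT|exact: rcv_cst]. Qed.

Definition opcs := @Pcs ocs None oval_pt.

Lemma ou01 (y : opcs) : 0 <= ou y <= 1.
Proof. by case: y => [e|] //=; rewrite lexx ler01. Qed.

Lemma ou_cv : @cts opcs Rl ou.
Proof.
move=> w [e|] /=; last by case.
move=> [k [z hz hw]]; apply: (@rcv_tail (fun n => v (z n))); last exact: vc.
by apply: ev_mp hw => n ->.
Qed.

Lemma ou_eq0 (y : opcs) : val y -> ou y = 0 -> y = pt opcs.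
Proof. by case: y => [e|] // /oval_ocv [_ /= h] e0; move: h; rewrite e0 ltxx. Qed.

Lemma ou_base (w : nat -> opcs) : ev (fun n => val (w n)) ->
  rcv (fun n => ou (w n)) 0 -> cv w (pt opcs).
Proof. by move=> h k; split=> //; apply: ev_mp h => n /oval_ocv. Qed.

Definition CQ : gsp := @Gsp opcs ou ou01 ou_cv erefl ou_eq0 ou_base.

Definition mkq (e : E) : option E := if 0 < v e then Some e else None.

Lemma cv_mkq (w : nat -> E) e : rcv (fun n => v (w n)) (v e) ->
  (0 < v e -> cv w e) -> ev (fun n => 0 < v (w n) -> val (w n)) ->
  @cv CQ (fun n => mkq (w n)) (mkq e).
Proof.
move=> h k l; rewrite {2}/mkq; case: ifP => e0 /=.
  split=> //; exists w; first exact: k.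
  by apply: ev_mp (ev_gt h e0) => n; rewrite /mkq => ->.
have {e0}ve : v e = 0 by have := v01 e; move: e0; lra.
split.
  by apply: ev_mp l => n ln; rewrite /mkq; case: ifP => //= ?; split; auto.
rewrite -ve; apply: rcv_tail h; apply: evT => n; rewrite /mkq; case: ifP => //=.
by have := v01 (w n); lra.
Qed.

Lemma mkq_some (e : E) : 0 < v e -> mkq e = Some e.
Proof. by rewrite /mkq => ->. Qed.

Lemma mkq_none (e : E) : v e <= 0 -> mkq e = None.
Proof. by rewrite /mkq leNgt => /negbTE ->. Qed.

Lemma val_CQ (y : CQ) : val y <-> oval y.
Proof. by split=> /oval_ocv. Qed.

(* Near the base point one only controls the gauge of the argument. *)
Lemma cts_CQ (P X : cs) (F : P -> option E -> X) :
  (forall p q w e, @cv P p q -> 0 < v e -> cv w e ->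
     cv (fun n => F (p n) (Some (w n))) (F q (Some e))) ->
  (forall p q w, @cv P p q -> ev (fun n => oval (w n)) ->
     rcv (fun n => ou (w n)) 0 -> cv (fun n => F (p n) (w n)) (F q None)) ->
  @cts (prod_cs P CQ) X (fun z => F z.1 z.2).
Proof.
move=> h1 h2 u [q [e|]] [/= hp].
  move=> [e0 [z hz hw]]; apply: cv_tail (h1 _ _ _ _ hp e0 hz).
  by apply: ev_mp hw => n /= ->.
by move=> [a b]; exact: h2.
Qed.

End CoarseQuotient.

(** * Wedges, suspensions and half-smash products *)

Section Wedge2.
Context (M N : gsp).

Definition wdg_pred (p : M * N) : Prop := p.1 = pt M \/ p.2 = pt N.

Definition wdg_cs : cs := @sub_cs (prod_cs M N) wdg_pred.

Lemma wdg_val_pt : @val wdg_cs (pt M, pt N).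
Proof. by apply/val_sub; split; [split; exact: val_pt|left]. Qed.

Definition wdg_pcs := Pcs wdg_val_pt.

Definition wdg_u (p : wdg_pcs) : RR := Num.max (gu p.1) (gu p.2).

Lemma wdg_u01 p : 0 <= wdg_u p <= 1.
Proof.
by rewrite /wdg_u; have := gu01 p.1; have := gu01 p.2; minmax; lra.
Qed.

Lemma wdg_u_cv : @cts wdg_pcs Rl wdg_u.
Proof. by move=> u x [[h k] _ _]; apply: rcv_max; apply: (@gu_cv _ (fun n => _)). Qed.

Lemma wdg_u_eq0 p : val p -> wdg_u p = 0 -> p = pt wdg_pcs.
Proof.
move=> /val_sub [[v1 v2] _] h.
have [h1 h2] : gu p.1 = 0 /\ gu p.2 = 0.
  by move: h; rewrite /wdg_u; have := gu01 p.1; have := gu01 p.2; minmax; lra.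
by rewrite [p]surjective_pairing (gu_eq0 v1 h1) (gu_eq0 v2 h2).
Qed.

Lemma wdg_u_base (w : nat -> wdg_pcs) : ev (fun n => val (w n)) ->
  rcv (fun n => wdg_u (w n)) 0 -> cv w (pt wdg_pcs).
Proof.
move=> h k; split; [split|by left|].
- apply: gu_base; first by apply: ev_mp h => n /val_sub [[]].
  apply: rcv_le0 k; apply: evT => n; rewrite /wdg_u.
  by have := gu01 (w n).1; have := gu01 (w n).2; minmax; lra.
- apply: gu_base; first by apply: ev_mp h => n /val_sub [[]].
  apply: rcv_le0 k; apply: evT => n; rewrite /wdg_u.
  by have := gu01 (w n).1; have := gu01 (w n).2; minmax; lra.
- by apply: ev_mp h => n /val_sub [].
Qed.

Lemma wdg_u_pt : wdg_u (pt wdg_pcs) = 0.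
Proof. by rewrite /wdg_u /= !gu_pt maxxx. Qed.

Definition wdg : gsp := Gsp wdg_u01 wdg_u_cv wdg_u_pt wdg_u_eq0 wdg_u_base.

Lemma val_wdg (p : wdg) : val p <-> [/\ val p.1, val p.2 & wdg_pred p].
Proof. by split=> [/val_sub [[]]//|[a b c]]; apply/val_sub. Qed.

Lemma pmap_wdg1 : @pmap wdg M fst.
Proof. by split=> // u x [[]]. Qed.

Lemma pmap_wdg2 : @pmap wdg N snd.
Proof. by split=> // u x [[]]. Qed.

Definition win1 (x : M) : wdg := (x, pt N).
Definition win2 (y : N) : wdg := (pt M, y).

Lemma pmap_win1 : pmap win1.
Proof.
split=> // u x h; split; [|by right|by apply: evT; right].
by split=> //; exact: val_pt.
Qed.

Lemma pmap_win2 : pmap win2.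
Proof.
split=> // u x h; split; [|by left|by apply: evT; left].
by split=> //; exact: val_pt.
Qed.

Definition wfold (Z : Type) (f : M -> Z) (g : N -> Z) (p : wdg) : Z :=
  if gu p.2 == 0 then f p.1 else g p.2.

Lemma wfold1 (Z : Type) (f : M -> Z) (g : N -> Z) x :
  wfold f g (x, pt N) = f x.
Proof. by rewrite /wfold /= gu_pt eqxx. Qed.

Lemma wfold2 (Z : Type) (f : M -> Z) (g : N -> Z) y : f (pt M) = g (pt N) ->
  val y -> wfold f g (pt M, y) = g y.
Proof.
by rewrite /wfold /= => e vy; case: eqP => // h; rewrite (gu_eq0 vy h).
Qed.

Lemma cts_wfold (P : cs) (Z : pcs) (F : P -> M -> Z) (G : P -> N -> Z) :
  @cts (prod_cs P M) Z (fun z => F z.1 z.2) ->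
  @cts (prod_cs P N) Z (fun z => G z.1 z.2) ->
  (forall p, val p -> F p (pt M) = pt Z) ->
  (forall p, val p -> G p (pt N) = pt Z) ->
  @cts (prod_cs P wdg) Z (fun z => wfold (F z.1) (G z.1) z.2).
Proof.
move=> cF cG F0 G0 u [q [a b]] [/= hp [[/= ha hb] /= hab hn]].
have hF : cv (fun n => F (u n).1 (u n).2.1) (F q a).
  exact: (cF (fun n => ((u n).1, (u n).2.1)) (q, a)).
have hG : cv (fun n => G (u n).1 (u n).2.2) (G q b).
  exact: (cG (fun n => ((u n).1, (u n).2.2)) (q, b)).
have [b0|b0] := pselect (b = pt N).
  rewrite b0 wfold1; have [a0|a0] := pselect (a = pt M).
    rewrite a0 F0; last exact: cv_val hp.
    apply: cv_mix; first by rewrite a0 F0 in hF => //; exact: cv_val hp.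
    by rewrite b0 G0 in hG => //; exact: cv_val hp.
  apply: cv_tail hF; apply: ev_mp2 hn (ev_pt ha a0) => n.
  by rewrite /wfold => -[->//|->]; rewrite gu_pt eqxx.
have gb := gu_gt0 (cv_val hb) b0.
rewrite /wfold /= (gt_eqF gb); apply: cv_tail hG.
by apply: ev_mp (ev_gt (gu_cv hb) gb) => n /= k; rewrite (gt_eqF k).
Qed.

End Wedge2.

Lemma cts_par (E F : cs) (f : E -> F) (P : cs) :
  cts f -> @cts (prod_cs P E) F (fun z => f z.2).
Proof. by move=> h u x [_ hx]; exact: h hx. Qed.

Lemma val_Iv0 : val (0 : Iv).
Proof. by apply: val_Iv; rewrite lexx ler01. Qed.

Lemma cts_par0 (E F : cs) (f : E -> F) :
  @cts (prod_cs Iv E) F (fun z => f z.2) -> cts f.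
Proof.
move=> h u x hx; apply: (h (fun n => (0, u n)) (0, x)).
by split=> //; exact: val_Iv0.
Qed.

Lemma pmap_wfold (M N : gsp) (Z : pcs) (f : M -> Z) (g : N -> Z) :
  pmap f -> pmap g -> pmap (wfold f g).
Proof.
move=> [cf f0] [cg g0]; split; last by rewrite /wfold /= gu_pt eqxx.
apply: cts_par0; apply: (@cts_wfold M N Iv Z (fun _ => f) (fun _ => g)) => //;
exact: cts_par.
Qed.

Lemma hom_wfold (M N : gsp) (Z : pcs) (f f' : M -> Z) (g g' : N -> Z) :
  hom f f' -> hom g g' -> hom (wfold f g) (wfold f' g').
Proof.
move=> [H [h hp h0 h1]] [K [k kp k0 k1]].
exists (fun t => wfold (H t) (K t)); split.
- by apply: cts_wfold => // t /val_sub [_ ht]; auto.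
- by move=> t x ht ->; rewrite /wfold /= gu_pt eqxx hp.
- by move=> x /val_wdg [? ? _]; rewrite /wfold h0 ?k0.
- by move=> x /val_wdg [? ? _]; rewrite /wfold h1 ?k1.
Qed.

Definition wmap (M N M' N' : gsp) (f : M -> M') (g : N -> N') (p : wdg M N) :
  wdg M' N' := (f p.1, g p.2).

Lemma cts_wmap (P : cs) (M N M' N' : gsp) (F : P -> M -> M') (G : P -> N -> N') :
  @cts (prod_cs P M) M' (fun z => F z.1 z.2) ->
  @cts (prod_cs P N) N' (fun z => G z.1 z.2) ->
  (forall p, val p -> F p (pt M) = pt M') ->
  (forall p, val p -> G p (pt N) = pt N') ->
  @cts (prod_cs P (wdg M N)) (wdg M' N') (fun z => wmap (F z.1) (G z.1) z.2).
Proof.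
move=> cF cG F0 G0 u [q [a b]] [/= hp [[/= ha hb] /= hab hn]].
split; [split| |].
- exact: (cF (fun n => ((u n).1, (u n).2.1)) (q, a)).
- exact: (cG (fun n => ((u n).1, (u n).2.2)) (q, b)).
- by have := cv_val hp; case: hab => /= -> vq; [left|right]; rewrite /= ?F0 ?G0.
- apply: ev_mp2 (cv_mem hp) hn => n vp.
  by case=> h; [left|right]; rewrite /= h ?F0 ?G0.
Qed.

Lemma pmap_wmap (M N M' N' : gsp) (f : M -> M') (g : N -> N') :
  pmap f -> pmap g -> pmap (wmap f g).
Proof.
move=> [cf f0] [cg g0]; split; last by rewrite /wmap /= f0 g0.
apply: cts_par0.
by apply: (@cts_wmap Iv M N M' N' (fun _ => f) (fun _ => g)) => //; exact: cts_par.
Qed.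

Lemma hom_wmap (M N M' N' : gsp) (f f' : M -> M') (g g' : N -> N') :
  hom f f' -> hom g g' -> hom (wmap f g) (wmap f' g').
Proof.
move=> [H [h hp h0 h1]] [K [k kp k0 k1]].
exists (fun t => wmap (H t) (K t)); split.
- by apply: cts_wmap => // t /val_sub [_ ht]; auto.
- by move=> t x ht ->; rewrite /wmap /= hp ?kp.
- by move=> x /val_wdg [? ? _]; rewrite /wmap h0 ?k0.
- by move=> x /val_wdg [? ? _]; rewrite /wmap h1 ?k1.
Qed.

Lemma heq_wdg (M N M' N' : gsp) : heq M M' -> heq N N' ->
  heq (wdg M N) (wdg M' N').
Proof.
move=> [f [f' [pf pf' ff' f'f]]] [g [g' [pg pg' gg' g'g]]].
exists (wmap f g), (wmap f' g'); split; try exact: pmap_wmap.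
- have [H hH] := hom_wmap ff' gg'; exists H; case: hH => h1 h2 h3 h4; split=> //.
  by move=> x vx; rewrite h4//; case: (x).
- have [H hH] := hom_wmap f'f g'g; exists H; case: hH => h1 h2 h3 h4; split=> //.
  by move=> x vx; rewrite h4//; case: (x).
Qed.

Lemma heq_wdgC (M N : gsp) : heq (wdg M N) (wdg N M).
Proof.
have p (A B : gsp) : @pmap (wdg A B) (wdg B A) (fun p => (p.2, p.1)).
  split=> // u x [[h1 h2] h3 h4]; split; [by split|by case: h3; [right|left]|].
  by apply: ev_mp h4 => n [?|?]; [right|left].
apply: (heq_iso (p M N) (p N M)) => x _; exact/esym/surjective_pairing.
Qed.

Lemma heq_wdgA (M N P : gsp) : heq (wdg M (wdg N P)) (wdg (wdg M N) P).
Proof.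
have p : @pmap (wdg M (wdg N P)) (wdg (wdg M N) P)
    (fun p => ((p.1, p.2.1), p.2.2)).
  split=> // u x [[h1 [[h2 h3] h4 h5]] h6 h7]; split; [split=> //; split| |].
  - by split.
  - by case: h6 => /= [->|->]; [left|right].
  - by apply: ev_mp h7 => n [/= ->|/= ->]; [left|right].
  - case: h6 => /= [e|->]; last by right.
    by case: h4 => /= e'; [left; rewrite /= e e'|right].
  - apply: ev_mp2 h5 h7 => n h8 [/= e|/= ->]; last by right.
    by case: h8 => /= e'; [left; rewrite /= e e'|right].
have q : @pmap (wdg (wdg M N) P) (wdg M (wdg N P))
    (fun p => (p.1.1, (p.1.2, p.2))).
  split=> // u x [[[[h1 h2] h4 h5] h3] h6 h7]; split; [split=> //; split| |].
  - by split.
  - by case: h6 => /= [->|->]; [left|right].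
  - by apply: ev_mp h7 => n [/= ->|/= ->]; [left|right].
  - case: h6 => /= [->|e]; first by left.
    by case: h4 => /= e'; [left|right; rewrite /= e e'].
  - apply: ev_mp2 h5 h7 => n h8 [/= ->|/= e]; first by left.
    by case: h8 => /= e'; [left|right; rewrite /= e e'].
by apply: (heq_iso p q) => -[a b] //= _; [case: b|case: a].
Qed.

(** The gauge of a suspension coordinate: 0 off the open unit interval and 1 on [1/4, 3/4]. The
    plateau makes suspensions well-pointed: a point of gauge less than 1 lies over an outer quarter
    or over a point of [M] of gauge less than 1, and both can be pushed to the base point. *)
Definition bump (s : RR) : RR := cl (Num.min (4 * s) (4 * (1 - s))).

Lemma bump01 s : 0 <= bump s <= 1.
Proof. exact: cl01. Qed.

Lemma rcv_bump u a : rcv u a -> rcv (fun n => bump (u n)) (bump a).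
Proof. by move=> h; apply: rcv_cl; apply: rcv_min; rcvt. Qed.

Lemma bump_gt0 s : (0 < bump s) = (0 < s < 1).
Proof. by apply/idP/idP; rewrite /bump /cl; minmax; lra. Qed.

Lemma bump_le0 s : ~~ (0 < s < 1) -> bump s <= 0.
Proof. by rewrite -bump_gt0 -leNgt. Qed.

Section Suspension.
Context (M : gsp).

Definition susv (x : prod_cs Rl M) : RR := Num.min (bump x.1) (gu x.2).

Lemma susv01 x : 0 <= susv x <= 1.
Proof.
by rewrite /susv; have := bump01 x.1; have := gu01 x.2; minmax; lra.
Qed.

Lemma susv_cv : @cts (prod_cs Rl M) Rl susv.
Proof.
move=> u x [h1 h2]; apply: rcv_min; first exact: rcv_bump.
exact: (@gu_cv _ (fun n => _)).
Qed.

Definition Sus : gsp := CQ susv01 susv_cv.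

Definition smk (s : RR) (m : M) : Sus := mkq susv (s, m).

Lemma susv_gt0 s m : 0 < susv (s, m) -> 0 < s < 1 /\ 0 < gu m.
Proof. by rewrite /susv /= lt_min bump_gt0 => /andP[]. Qed.

End Suspension.

Definition smap (M N : gsp) (h : M -> N) (y : Sus M) : Sus N :=
  if y is Some e then smk e.1 (h e.2) else None.

Lemma oval_mkq (E : cs) (v : E -> RR) (e : E) : (0 < v e -> val e) -> oval v (mkq v e).
Proof. by rewrite /mkq; case: ifP => //= h k; split; auto. Qed.

Lemma ou_mkq (E : cs) (v : E -> RR) (e : E) : 0 <= v e -> ou v (mkq v e) = v e.
Proof. by rewrite /mkq; case: ifP => //= h k; lra. Qed.

Lemma cts_smap (P : cs) (M N : gsp) (H : P -> M -> N) :
  @cts (prod_cs P M) N (fun z => H z.1 z.2) ->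
  (forall p, val p -> H p (pt M) = pt N) ->
  @cts (prod_cs P (Sus M)) (Sus N) (fun z => smap (H z.1) z.2).
Proof.
move=> cH H0; apply: (@cts_CQ _ _ (susv01 (M := M)) (@susv_cv M) P (Sus N)
   (fun p => smap (H p))).
  move=> p q w e hp ve [h1 h2] /=.
  have h3 : cv (fun n => H (p n) (w n).2) (H q e.2).
    exact: (cH (fun n => (p n, (w n).2)) (q, e.2)).
  apply: (cv_mkq (@susv01 N) (@susv_cv N)).
  - by apply: (@susv_cv N (fun n => _)); split.
  - by move=> _; split.
  - by apply: ev_mp (cv_mem h3) => n vn _; split=> //; exact: rcv_cst.
move=> p q w hp hv hu.
(* The points [e.2] need not converge, since the gauge can be small through [bump e.1] alone. In
   that case [m] is the base point and [bump e.1] still bounds the gauge of the image; otherwise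
   [gu e.2] is the small one. Either way [m] converges to the base point. *)
pose m n : M := if w n is Some e then
  (if gu e.2 <= bump e.1 then e.2 else pt M) else pt M.
have hm : cv m (pt M).
  apply: gu_base.
    apply: ev_mp hv => n; rewrite /m; case: (w n) => [e|] /=.
      by case=> -[_ ?] _; case: ifP => // _; exact: val_pt.
    by move=> _; exact: val_pt.
  apply: rcv_le0 hu; apply: evT => n; rewrite /m; case: (w n) => [e|] /=.
    rewrite /susv; case: ifP; have := gu01 e.2; have := bump01 e.1;
    by rewrite ?gu_pt; minmax; lra.
  by rewrite gu_pt lexx.
have := cH (fun n => (p n, m n)) (q, pt M) (conj hp hm).
rewrite /= (H0 _ (cv_val hp)) => /gu_cv; rewrite /= gu_pt => hg; split.
  apply: ev_mp2 hv (cv_mem hp) => n + vp; case: (w n) => [e|] //= [[_ ve] _].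
  apply: oval_mkq => _; split; first exact: rcv_cst.
  by apply: (cH (fun _ => (p n, e.2)) (p n, e.2)).
have := rcv_max hu hg; rewrite maxxx; apply: rcv_le0.
apply: ev_mp2 hv (cv_mem hp) => n; rewrite /m; case: (w n) => [e|] /=.
  move=> _ vp; rewrite ou_mkq; last by have /andP[] := susv01 (e.1, H (p n) e.2).
  have := susv01 (e.1, H (p n) e.2); have := susv01 (e.1, e.2).
  rewrite /susv /=; case: ifP; rewrite ?(H0 _ vp) ?gu_pt; minmax; lra.
by move=> _ vp; rewrite (H0 _ vp) gu_pt maxxx lexx.
Qed.

Lemma pmap_smap (M N : gsp) (f : M -> N) : pmap f -> pmap (smap f).
Proof.
move=> [cf f0]; split=> //.
by apply: cts_par0; apply: (@cts_smap Iv M N (fun _ => f)) => //; exact: cts_par.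
Qed.

Lemma hom_smap (M N : gsp) (f g : M -> N) : hom f g -> hom (smap f) (smap g).
Proof.
move=> [H [h hp h0 h1]]; exists (fun t => smap (H t)); split.
- by apply: cts_smap => // t /val_sub [_ ht]; exact: hp.
- by move=> t x ht ->.
- by move=> [[s m]|] // /val_CQ /= [[_ vm] _]; rewrite h0.
- by move=> [[s m]|] // /val_CQ /= [[_ vm] _]; rewrite h1.
Qed.

(** The first map may already collapse the point, namely when [f m] is the base point; [g] then
    keeps it there. *)
Lemma smap_comp (M N P : gsp) (f : M -> N) (g : N -> P) y :
  pmap f -> pmap g -> val y ->
  smap g (smap f y) = smap (fun x => g (f x)) y.
Proof.
move=> [cf f0] [cg g0]; case: y => [[s m]|]; last by [].
move=> /val_CQ [[_ vm] /susv_gt0 [h _]] /=.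
have vfm : val (f m) := cts_val cf vm.
rewrite /smk; case: (ltP 0 (susv (s, f m))) => h2; first by rewrite (mkq_some h2).
rewrite (mkq_none h2) /=.
have -> : f m = pt N.
  apply: gu_eq0 => //; move: h2; rewrite leNgt /susv /= lt_min bump_gt0 h /=.
  by have := gu01 (f m); lra.
by rewrite g0 mkq_none// /susv /= gu_pt; have := bump01 s; minmax; lra.
Qed.

Lemma smap_id (M : gsp) (y : Sus M) : val y -> smap id y = y.
Proof.
by case: y => [[s m]|] // /val_CQ [_ h]; rewrite /= /smk mkq_some.
Qed.

Lemma rhom_ext (E : cs) (A : E -> Prop) (N : pcs) (f g f' g' : E -> N) :
  rhom A f g -> (forall x, val x -> f x = f' x) ->
  (forall x, val x -> g x = g' x) -> rhom A f' g'.
Proof.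
move=> [H [h1 h2 h3 h4]] ff gg; exists H; split=> // x vx.
  by rewrite h3 ?ff.
by rewrite h4 ?gg.
Qed.

Lemma heq_Sus (M N : gsp) : heq M N -> heq (Sus M) (Sus N).
Proof.
move=> [f [g [pf pg fg gf]]]; exists (smap f), (smap g).
split; try exact: pmap_smap.
- by apply: rhom_ext (hom_smap fg) _ _ => x vx; rewrite ?smap_comp ?smap_id.
- by apply: rhom_ext (hom_smap gf) _ _ => x vx; rewrite ?smap_comp ?smap_id.
Qed.

Section HalfSmash.
Context (M : gsp) (Q : cs).

Definition halfv (x : prod_cs M Q) : RR := gu x.1.

Lemma halfv01 x : 0 <= halfv x <= 1.
Proof. exact: gu01. Qed.

Lemma halfv_cv : @cts (prod_cs M Q) Rl halfv.
Proof. by move=> u x [h1 h2]; apply: (@gu_cv _ (fun n => _)). Qed.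

(** The half-smash product: the gauge ignores [Q], so all of [Q] over the base point of [M] is
    collapsed. *)
Definition Half : gsp := CQ halfv01 halfv_cv.

End HalfSmash.

Section DisjointBase.
Context (Q : cs).

Lemma one01 (x : Q) : 0 <= (1 : RR) <= 1.
Proof. by rewrite ler01 lexx. Qed.

Lemma one_cv : @cts Q Rl (fun _ => 1).
Proof. by move=> u x _; exact: rcv_cst. Qed.

(** [Q] with a disjoint base point, isolated by the constant gauge 1. *)
Definition Pls : gsp := CQ one01 one_cv.

End DisjointBase.

Lemma pt_cs_val : @val unit_cs tt. Proof. by []. Qed.

Definition ptp := Pcs pt_cs_val.

Definition Pt : gsp.
Proof.
refine (@Gsp ptp (fun _ => 0) _ _ _ _ _) => //.
- by move=> _; rewrite lexx ler01.
- by move=> *; exact: rcv_cst.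
- by case.
Defined.

(** * Homotopy groups *)

Section Spheroids.
Context (n : nat) (M : pcs).

Definition bd (t : vec n) : Prop := exists i, ~~ (0 < t ord0 i < 1).

(* Spheroids live on all of R^n and are trivial off the open cube. *)
Definition sph (f : vec n -> M) : Prop :=
  cts f /\ forall t, bd t -> f t = pt M.

Definition shom (f g : vec n -> M) : Prop := rhom bd f g.

Definition scls (f : vec n -> M) : set (vec n -> M) :=
  [set g | sph g /\ shom f g].

Definition pi : Type := {A : set (vec n -> M) | exists f, sph f /\ A = scls f}.

Lemma sph_cst : sph (fun _ => pt M).
Proof. by split=> // u x _; exact: val_pt. Qed.

Definition cls (f : vec n -> M) : pi :=
  match pselect (sph f) with
  | left h => exist _ (scls f) (ex_intro _ f (conj h erefl))
  | right _ => exist _ (scls (fun _ => pt M))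
                 (ex_intro _ (fun _ => pt M) (conj sph_cst erefl))
  end.

Definition rep (A : pi) : vec n -> M := sval (cid (svalP A)).

Lemma shom_refl f : sph f -> shom f f.
Proof. by move=> [cf f0]; apply: rhom_refl. Qed.

Lemma sph_rep A : sph (rep A).
Proof. by rewrite /rep; case: cid => f []. Qed.

Lemma pi_eq (A B : pi) : sval A = sval B -> A = B.
Proof.
case: A B => [A hA] [B hB] /= e; subst B; congr exist; exact: Prop_irrelevance.
Qed.

Lemma cls_val f : sph f -> sval (cls f) = scls f.
Proof. by move=> h; rewrite /cls; case: pselect. Qed.

Lemma cls_rep A : cls (rep A) = A.
Proof.
apply: pi_eq; rewrite cls_val; last exact: sph_rep.
by rewrite /rep; case: cid => f [].
Qed.

Lemma cls_eqP f g : sph f -> sph g -> (cls f = cls g <-> shom f g).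
Proof.
move=> sf sg; split=> h.
  have := congr1 (@proj1_sig _ _) h; rewrite !cls_val// => e.
  have : scls g g by split=> //; exact: shom_refl.
  by rewrite -e => -[].
apply: pi_eq; rewrite !cls_val//; apply/seteqP; split=> k [sk hk]; split=> //.
  exact: rhom_trans (rhom_sym h) hk.
exact: rhom_trans h hk.
Qed.

Lemma shom_rep f : sph f -> shom (rep (cls f)) f.
Proof. by move=> sf; apply/cls_eqP => //; [exact: sph_rep|exact: cls_rep]. Qed.

End Spheroids.

Lemma shom_map (n : nat) (M N : pcs) (h : M -> N) (f g : vec n -> M) :
  pmap h -> shom f g -> shom (fun t => h (f t)) (fun t => h (g t)).
Proof.
move=> [ch h0] [H [cH H0 H1 H2]]; exists (fun t x => h (H t x)).
by split=> [u x /cH/ch|t x t01 /H0 ->|x /H1 ->|x /H2 ->].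
Qed.

Lemma sph_map (n : nat) (M N : pcs) (h : M -> N) (f : vec n -> M) :
  pmap h -> sph f -> sph (fun t => h (f t)).
Proof.
by move=> [ch h0] [cf f0]; split=> [|t /f0 ->//]; exact: cts_comp ch.
Qed.

Lemma shom_hom (n : nat) (M N : pcs) (h k : M -> N) (f : vec n -> M) :
  hom h k -> sph f -> shom (fun t => h (f t)) (fun t => k (f t)).
Proof.
move=> [H [cH H0 H1 H2]] [cf f0]; exists (fun t x => H t (f x)); split.
- move=> u x [h1 h2]; apply: (cH (fun m => ((u m).1, f (u m).2)) (x.1, f x.2)).
  by split=> //; exact: cf.
- by move=> t x t01 /f0; apply: H0.
- by move=> x /(cts_val cf)/H1.
- by move=> x /(cts_val cf)/H2.
Qed.

Definition upd (n : nat) (t : vec n) (i : 'I_n) (s : RR) : vec n :=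
  \row_j (if j == i then s else t ord0 j).

Lemma updE n (t : vec n) i s j :
  upd t i s ord0 j = if j == i then s else t ord0 j.
Proof. by rewrite mxE. Qed.

Lemma updd n (t : vec n) i s : upd t i s ord0 i = s.
Proof. by rewrite updE eqxx. Qed.

Lemma upd_id n (t : vec n) i : upd t i (t ord0 i) = t.
Proof. by apply/rowP => j; rewrite updE; case: eqP => // ->. Qed.

Lemma cv_upd n (t : nat -> vec n) t0 i s s0 : cv t t0 -> rcv s s0 ->
  cv (fun k => upd (t k) i (s k)) (upd t0 i s0).
Proof.
move=> ht hs j; rewrite updE; case: eqP => ji.
  by apply: rcv_tail hs; apply: evT => k; rewrite updE ji eqxx.
by apply: rcv_tail (ht j); apply: evT => k; rewrite updE; case: eqP.
Qed.

Lemma bd_upd n (t : vec n) i s :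
  bd t -> (~~ (0 < t ord0 i < 1) -> ~~ (0 < s < 1)) -> bd (upd t i s).
Proof.
move=> [j hj] h; have [ji|ji] := eqVneq j i.
  by exists i; rewrite updd; apply: h; rewrite -ji.
by exists j; rewrite updE (negbTE ji).
Qed.

Lemma bd_upd2 n (t : vec n) i s : ~~ (0 < s < 1) -> bd (upd t i s).
Proof. by move=> h; exists i; rewrite updd. Qed.

Section Concatenation.
Context (n : nat) (M : pcs).
Implicit Types f g : vec n -> M.

(** The unit and inverse laws are reparametrisations of one coordinate. The last condition on [p]
    keeps what is outside the open interval outside, so the boundary stays at the base point
    throughout. *)
Lemma shom_upd f (i : 'I_n) (p : RR -> RR -> RR) : sph f ->
  (forall u v a b, rcv u a -> rcv v b -> rcv (fun k => p (u k) (v k)) (p a b)) ->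
  (forall t s, 0 <= t <= 1 -> ~~ (0 < s < 1) -> ~~ (0 < p t s < 1)) ->
  shom (fun t => f (upd t i (p 0 (t ord0 i)))) (fun t => f (upd t i (p 1 (t ord0 i)))).
Proof.
move=> [cf f0] hp hb; exists (fun r t => f (upd t i (p r (t ord0 i)))); split=> //.
- move=> u x [[h1 _ _] h2]; apply: cf; apply: cv_upd => //.
  by apply: hp => //; exact: h2.
- by move=> r t r01 bt; apply: f0; apply: bd_upd bt _; exact: hb.
Qed.

Definition cat (i : 'I_n) f g : vec n -> M := fun t =>
  if t ord0 i <= 2^-1 then f (upd t i (2 * t ord0 i))
  else g (upd t i (2 * t ord0 i - 1)).

Lemma cat_sph i f g : sph f -> sph g -> sph (cat i f g).
Proof.
move=> [cf f0] [cg g0]; split.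
  move=> u x h; apply: cv_if; first exact: h.
  - by move=> _; apply: cf; apply: cv_upd => //; rcvt; exact: h.
  - by move=> _; apply: cg; apply: cv_upd => //; rcvt; exact: h.
  - by move=> e; rewrite f0 ?g0//; apply: bd_upd2; rewrite e; lra.
move=> t bt; rewrite /cat; case: ifPn => h.
  by apply: f0; apply: bd_upd bt _; lra.
by apply: g0; apply: bd_upd bt _; lra.
Qed.

Lemma cat_shom i f f' g g' : sph f -> sph g -> shom f f' -> shom g g' ->
  shom (cat i f g) (cat i f' g').
Proof.
move=> [cf f0] [cg g0] [H [cH H0 H1 H2]] [K [cK K0 K1 K2]].
exists (fun r => cat i (H r) (K r)); split.
- move=> u x [h1 h2]; apply: cv_if; first exact: h2.
  + move=> _; apply: (cH (fun k => ((u k).1, upd (u k).2 i (2 * (u k).2 ord0 i)))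
      (x.1, _)).
    by split=> //; apply: cv_upd => //; rcvt; exact: h2.
  + move=> _; apply: (cK (fun k => ((u k).1, upd (u k).2 i (2 * (u k).2 ord0 i - 1)))
      (x.1, _)).
    by split=> //; apply: cv_upd => //; rcvt; exact: h2.
  + move=> e; case: h1 => _ h1 _.
    by rewrite H0 ?K0//; apply: bd_upd2; rewrite e; lra.
- move=> r t r01 bt; rewrite /cat; case: ifPn => h.
    by apply: H0 => //; apply: bd_upd bt _; lra.
  by apply: K0 => //; apply: bd_upd bt _; lra.
- by move=> x _; rewrite /cat H1 ?K1//; exact: val_vec.
- by move=> x _; rewrite /cat H2 ?K2//; exact: val_vec.
Qed.

Lemma cat_ptl i f : sph f -> shom (cat i (fun _ => pt M) f) f.
Proof.
move=> sf; have [cf f0] := sf.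
(* At [r = 0] the coordinate is [2 * s - 1], outside the open interval for [s] up to 1/2; at [r = 1]
   it is [s]. *)
have := @shom_upd f i (fun r s => (1 - r) * (2 * s - 1) + r * s) sf.
set F := (F in shom F _); set G := (G in shom _ G).
have -> : F = cat i (fun _ => pt M) f.
  apply/funext => t; rewrite /F /cat subr0 mul1r mul0r addr0; case: ifP => // h.
  by rewrite f0//; apply: bd_upd2; lra.
have -> : G = f.
  by apply/funext => t; rewrite /G subrr mul0r add0r mul1r upd_id.
apply.
  by move=> *; rcvt.
move=> r s r01 s01; have [h|h] : s <= 0 \/ 1 <= s by move: s01; lra.
  by nra.
by nra.
Qed.

Lemma cat_ptr i f : sph f -> shom (cat i f (fun _ => pt M)) f.
Proof.
move=> sf; have [cf f0] := sf.
have := @shom_upd f i (fun r s => (2 - r) * s) sf.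
set F := (F in shom F _); set G := (G in shom _ G).
have -> : F = cat i f (fun _ => pt M).
  apply/funext => t; rewrite /F /cat subr0; case: ifP => // h.
  by rewrite f0//; apply: bd_upd2; lra.
have -> : G = f.
  apply/funext => t; rewrite /G (_ : (2 - 1) * _ = t ord0 i) ?upd_id//; ring.
apply.
  by move=> *; rcvt.
move=> r s r01 s01; have [h|h] : s <= 0 \/ 1 <= s by move: s01; lra.
  by nra.
by nra.
Qed.

Definition rev (i : 'I_n) f : vec n -> M := fun t => f (upd t i (1 - t ord0 i)).

Lemma rev_sph i f : sph f -> sph (rev i f).
Proof.
move=> [cf f0]; split.
  by move=> u x h; apply: cf; apply: cv_upd => //; rcvt; exact: h.
by move=> t bt; apply: f0; apply: bd_upd bt _; lra.
Qed.

Lemma upd_upd (t : vec n) i r s : upd (upd t i r) i s = upd t i s.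
Proof. by apply/rowP => j; rewrite !updE; case: eqP. Qed.

Lemma upd_comm (t : vec n) i j r s : i != j ->
  upd (upd t i r) j s = upd (upd t j s) i r.
Proof.
move=> ij; apply/rowP => k; rewrite !updE; case: (eqVneq k j) => // ->.
by rewrite eq_sym (negbTE ij).
Qed.

Lemma cat_rev i f : sph f -> shom (cat i (rev i f) f) (fun _ => pt M).
Proof.
move=> sf; have [cf f0] := sf.
(* At [r = 0] the coordinate is |2s - 1|, which runs [f] backwards and then forwards; at [r = 1] it
   is at least 1 everywhere, where [f] is trivial. *)
have := @shom_upd f i (fun r s => Num.max (1 - 2 * s) (2 * s - 1) + r) sf.
set F := (F in shom F _); set G := (G in shom _ G).
have -> : F = cat i (rev i f) f.
  apply/funext => t; rewrite /F /cat addr0 /rev; case: ifP => // h.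
    rewrite upd_upd updd; congr (f (upd _ _ _)).
    by minmax; lra.
  by congr (f (upd _ _ _)); minmax; lra.
have -> : G = fun _ => pt M.
  by apply/funext => t; rewrite /G f0//; apply: bd_upd2; minmax; lra.
apply.
  by move=> *; rcvt.
by move=> r s r01 s01; minmax; lra.
Qed.

(** An equality of functions, since the two concatenations act on different coordinates. *)
Lemma cat_interchange i j a b c d : i != j ->
  cat i (cat j a b) (cat j c d) = cat j (cat i a c) (cat i b d).
Proof.
move=> ij; apply/funext => t; rewrite /cat !updE (negbTE ij) eq_sym (negbTE ij).
by case: ifP => h; case: ifP => k; rewrite upd_comm// eq_sym.
Qed.

Definition padd (i : 'I_n) (A B : pi n M) : pi n M := cls (cat i (rep A) (rep B)).

Lemma padd_cls i f g : sph f -> sph g ->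
  padd i (cls f) (cls g) = cls (cat i f g).
Proof.
move=> sf sg; have h := sph_rep (cls f); have k := sph_rep (cls g).
apply/cls_eqP; try exact: cat_sph.
by apply: cat_shom => //; exact: shom_rep.
Qed.

Definition pzero : pi n M := cls (fun _ => pt M).
Definition popp (i : 'I_n) (A : pi n M) : pi n M := cls (rev i (rep A)).

Lemma padd0 i A : padd i pzero A = A.
Proof.
rewrite -(cls_rep A) padd_cls; [|exact: sph_cst|exact: sph_rep].
apply/cls_eqP; [|exact: sph_rep|apply: cat_ptl; exact: sph_rep].
by apply: cat_sph; [exact: sph_cst|exact: sph_rep].
Qed.

Lemma padd0r i A : padd i A pzero = A.
Proof.
rewrite -(cls_rep A) padd_cls; [|exact: sph_rep|exact: sph_cst].
apply/cls_eqP; [|exact: sph_rep|apply: cat_ptr; exact: sph_rep].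
by apply: cat_sph; [exact: sph_rep|exact: sph_cst].
Qed.

Lemma paddN i A : padd i (popp i A) A = pzero.
Proof.
have h := sph_rep A; have k := rev_sph i h.
rewrite -{2}(cls_rep A) padd_cls//.
apply/cls_eqP; [exact: cat_sph|exact: sph_cst|exact: cat_rev].
Qed.

Lemma padd_inter i j A B C D : i != j ->
  padd i (padd j A B) (padd j C D) = padd j (padd i A C) (padd i B D).
Proof.
move=> ij; have [a b c d] := And4 (sph_rep A) (sph_rep B) (sph_rep C) (sph_rep D).
rewrite -(cls_rep A) -(cls_rep B) -(cls_rep C) -(cls_rep D).
rewrite (padd_cls j a b) (padd_cls j c d) (padd_cls i a c) (padd_cls i b d).
rewrite (padd_cls i (cat_sph j a b) (cat_sph j c d)).
by rewrite (padd_cls j (cat_sph i a c) (cat_sph i b d)) cat_interchange.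
Qed.

(* Eckmann-Hilton *)
Lemma padd_same i j A B : i != j -> padd i A B = padd j A B.
Proof.
move=> ij; rewrite -{1}(padd0r j A) -{1}(padd0 j B) padd_inter//.
by rewrite padd0r padd0.
Qed.

Lemma paddC i j A B : i != j -> padd i A B = padd i B A.
Proof.
move=> ij; rewrite -{1}(padd0 j A) -{1}(padd0r j B) padd_inter//.
by rewrite padd0 padd0r -(padd_same _ _ ij).
Qed.

Lemma paddA i j A B C : i != j -> padd i A (padd i B C) = padd i (padd i A B) C.
Proof.
move=> ij; rewrite [padd i B C](padd_same _ _ ij) -{1}(padd0r j A) padd_inter//.
by rewrite padd0 -(padd_same _ _ ij).
Qed.

End Concatenation.

(** The shift by 2 provides the two coordinates of the Eckmann-Hilton argument, from which
    associativity is obtained as well. *)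
Definition piG (n : nat) (M : pcs) : Type := pi n.+2 M.

HB.instance Definition _ n M := gen_eqMixin (piG n M).
HB.instance Definition _ n M := gen_choiceMixin (piG n M).

Lemma ord01 n : (ord0 : 'I_n.+2) != ord_max.
Proof. by []. Qed.

Lemma piG_addA n M : associative (@padd n.+2 M ord0).
Proof. by move=> a b c; exact: paddA (ord01 n). Qed.

Lemma piG_addC n M : commutative (@padd n.+2 M ord0).
Proof. by move=> a b; exact: paddC (ord01 n). Qed.

HB.instance Definition _ n M := GRing.isZmodule.Build (piG n M)
  (@piG_addA n M) (@piG_addC n M) (@padd0 n.+2 M ord0) (@paddN n.+2 M ord0).

Definition clsG (n : nat) (M : pcs) (f : vec n.+2 -> M) : piG n M := cls f.

Lemma clsG_add n (M : pcs) (f g : vec n.+2 -> M) : sph f -> sph g ->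
  clsG f + clsG g = clsG (cat ord0 f g).
Proof. exact: padd_cls. Qed.

Definition pif (n : nat) (M N : pcs) (h : M -> N) (A : piG n M) : piG n N :=
  clsG (fun t => h (rep A t)).

Lemma pif_cls n (M N : pcs) (h : M -> N) (f : vec n.+2 -> M) :
  pmap h -> sph f -> pif h (clsG f) = clsG (fun t => h (f t)).
Proof.
move=> ph sf; have sr := sph_rep (clsG f).
apply/cls_eqP; try exact: sph_map.
by apply: shom_map => //; exact: shom_rep.
Qed.

Lemma pif_add n (M N : pcs) (h : M -> N) (A B : piG n M) : pmap h ->
  pif h (A + B) = pif h A + pif h B.
Proof.
move=> ph; rewrite -(cls_rep A) -(cls_rep B) -/(clsG _) -/(clsG _).
have sA := sph_rep A; have sB := sph_rep B.
rewrite clsG_add// !pif_cls//; last exact: cat_sph.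
rewrite clsG_add; try exact: sph_map.
congr clsG; apply/funext => t; rewrite /cat; by case: ifP.
Qed.

Lemma pif_comp n (M N P : pcs) (h : M -> N) (k : N -> P) (A : piG n M) :
  pmap h -> pmap k -> pif k (pif h A) = pif (fun x => k (h x)) A.
Proof.
move=> ph pk; rewrite -(cls_rep A) -/(clsG _); have sA := sph_rep A.
rewrite !pif_cls//; [exact: pmap_comp|exact: sph_map].
Qed.

Lemma pif_hom n (M N : pcs) (h k : M -> N) (A : piG n M) :
  pmap h -> pmap k -> hom h k -> pif h A = pif k A.
Proof.
move=> ph pk hk; have sA := sph_rep A.
by apply/cls_eqP; try exact: sph_map; apply: shom_hom.
Qed.

Lemma pif_id n (M : pcs) (A : piG n M) : pif id A = A.
Proof. exact: cls_rep. Qed.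

(** * Isomorphisms of abelian groups *)

Definition giso (G H : zmodType) : Prop :=
  exists f : G -> H, (forall x y, f (x + y) = f x + f y) /\ bijective f.

Lemma giso_sym G H : giso G H -> giso H G.
Proof.
move=> [f [fD [g fg gf]]]; exists g; split; last by exists f.
by move=> x y; apply: (can_inj fg); rewrite fD !gf.
Qed.

Lemma giso_trans G H K : giso G H -> giso H K -> giso G K.
Proof.
move=> [f [fD bf]] [g [gD bg]]; exists (g \o f); split; last exact: bij_comp.
by move=> x y; rewrite /= fD gD.
Qed.

Lemma giso_heq n (M N : pcs) : heq M N -> giso (piG n M) (piG n N).
Proof.
move=> [f [g [pf pg gf fg]]]; exists (pif f); split.
  by move=> x y; exact: pif_add.
exists (pif g) => A; rewrite pif_comp//.
  rewrite (pif_hom _ _ _ gf) ?pif_id//; [exact: pmap_comp|exact: pmap_id].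
rewrite (pif_hom _ _ _ fg) ?pif_id//; [exact: pmap_comp|exact: pmap_id].
Qed.

(** * The kernel of the projection of a wedge onto a summand *)

Lemma pif_cst n (M N : pcs) (A : piG n M) : pif (fun _ => pt N) A = 0.
Proof. by []. Qed.

Lemma pif0 n (M N : pcs) (h : M -> N) : pmap h -> pif h (0 : piG n M) = 0.
Proof.
move=> ph; have := pif_add (0 : piG n M) 0 ph; rewrite addr0 => e.
by apply: (@addrI _ (pif h 0)); rewrite -e addr0.
Qed.

Lemma additive0 (G H : zmodType) (f : G -> H) :
  (forall x y, f (x + y) = f x + f y) -> f 0 = 0.
Proof.
by move=> fD; apply: (@addrI _ (f 0)); rewrite -fD !addr0.
Qed.

Lemma additiveB (G H : zmodType) (f : G -> H) :
  (forall x y, f (x + y) = f x + f y) -> forall x y, f (x - y) = f x - f y.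
Proof.
by move=> fD x y; apply: (@addIr _ (f y)); rewrite -fD !subrK.
Qed.

Lemma giso_split (G H K : zmodType) (p : G -> H) (s : H -> G) (j : K -> G) :
  (forall x y, p (x + y) = p x + p y) -> (forall x y, s (x + y) = s x + s y) ->
  (forall x y, j (x + y) = j x + j y) ->
  cancel s p -> (forall k, p (j k) = 0) -> (forall k, j k = 0 -> k = 0) ->
  (forall g, p g = 0 -> exists k, j k = g) -> giso G (H * K)%type.
Proof.
move=> pD sD jD ps pj j0 jk; apply: giso_sym.
pose f (x : H * K) := s x.1 + j x.2.
have fD (x y : H * K) : f (x + y) = f x + f y.
  by rewrite /f /= sD jD addrACA.
exists f; split=> //.
have surj g : exists x, f x = g.
  have [|k hk] := jk (g - s (p g)); first by rewrite additiveB// ps subrr.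
  by exists (p g, k); rewrite /f /= hk addrC subrK.
have inj x : f x = 0 -> x = 0.
  case: x => h k; rewrite /f /= => e.
  have h0 : h = 0 by rewrite -[h]ps -[s h](addrK (j k)) e additiveB// pj subr0 additive0.
  move: e; rewrite h0 (additive0 sD) add0r => /j0 ->; by [].
have [g hg] := choice surj.
exists g => // x; have := inj (g (f x) - x).
by rewrite (additiveB fD) hg subrr => /(_ erefl) /eqP; rewrite subr_eq0 => /eqP.
Qed.

Definition cut (T : Type) (w : RR -> T) (r : RR) : RR -> T := fun t => w (Num.min t r).

Lemma cv_cut (X : cs) (u : nat -> pth X) w r r0 : cv u w -> rcv r r0 ->
  @cv (pth X) (fun n => cut (u n) (r n)) (cut w r0).
Proof.
move=> [h1 h2 h3] hr; split.
- by move=> t t0 ht; apply: h1; rcvt.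
- by apply: ev_mp h2 => n h t t0 ht; apply: h; rcvt.
- by move=> t t0 ht; apply: h3; rcvt.
Qed.

Lemma cv_app (X : cs) (u : nat -> pth X) w r r0 : cv u w -> rcv r r0 ->
  cv (fun n => u n (r n)) (w r0).
Proof. by move=> [_ _ h]; exact: h. Qed.

Definition loopP (X : pcs) (w : pth X) : Prop :=
  forall t, ~~ (0 < t < 1) -> w t = pt X.

Definition loops (X : pcs) : cs := sub_cs (@loopP X).

(* Well-pointedness: psi contracts the neighbourhood of the base point where the
   gauge is less than 1. *)
Definition wellp (Y : gsp) (psi : RR -> Y -> Y) : Prop :=
  [/\ @cts (prod_cs Rl Y) Y (fun z => psi z.1 z.2),
      forall t, psi t (pt Y) = pt Y,
      forall y, val y -> psi 0 y = y &
      forall y t, val y -> gu y < 1 -> 1 <= t -> psi t y = pt Y].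

(** * The homotopy fibre as a half-smash product *)

Section Fibre.
Context (X Y : gsp) (psi : RR -> Y -> Y) (psiP : wellp psi).

Let W := wdg X Y.

Definition fibP (p : prod_cs W (pth X)) : Prop :=
  (forall t, t <= 0 -> p.2 t = pt X) /\ (forall t, 1 <= t -> p.2 t = p.1.1).

Definition fib_cs : cs := sub_cs fibP.

Lemma fib_val_pt : @val fib_cs (pt W, fun _ => pt X).
Proof.
apply/val_sub; split; last by split.
by split; [exact: (val_pt W)|apply: val_pth => t t0 _; exact: val_pt].
Qed.

(* The homotopy fibre of the projection of the wedge of X and Y onto X. *)
Definition fib : pcs := Pcs fib_val_pt.

Let HY := Half Y (loops X).

Definition hmk (y : Y) (w : loops X) : HY := mkq (@halfv Y (loops X)) (y, w).

(** If [p.1.2] is not the base point of [Y], then [p.1.1] is that of [X], and the path [p.2] is a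
    loop; otherwise [hmk] gives the base point. *)
Definition collapse (p : fib) : HY := hmk p.1.2 p.2.

(** It vanishes up to gauge 1/2, which makes [expand] constant near the base point, where the loop
    is uncontrolled. It is 1 at gauge 1, so the loop is complete wherever [psi 1 y] is not the base
    point. *)
Definition lev (y : Y) : RR := Num.max 0 (2 * gu y - 1).

Lemma lev01 y : 0 <= lev y <= 1.
Proof. by rewrite /lev; have := gu01 y; minmax; lra. Qed.

(** The loop stopped at time [r] is a path to its endpoint in [X]. While the loop is incomplete,
    [psi 1 y] is trivial, so the pair lies in the wedge. *)
Definition spread (y : Y) (w : RR -> X) (r : RR) : fib :=
  ((w r, psi 1 y), cut w r).

Definition expand (z : HY) : fib :=
  if z is Some (y, w) then spread y w (lev y) else pt fib.

Lemma psi_neq y : val y -> psi 1 y <> pt Y -> gu y = 1.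
Proof.
case: psiP => _ _ _ h vy y0; apply/eqP; rewrite eq_le; have /andP[_ ->] := gu01 y.
by rewrite leNgt; apply/negP => /(h y 1 vy); rewrite lexx => /(_ isT)/y0.
Qed.

Lemma lev1 y : gu y = 1 -> lev y = 1.
Proof. by rewrite /lev => ->; minmax; lra. Qed.

Lemma cts_psi t t0 y y0 : rcv t t0 -> cv y y0 ->
  cv (fun n => psi (t n) (y n)) (psi t0 y0).
Proof.
by case: psiP => h _ _ _ ht hy; apply: (h (fun n => (t n, y n)) (t0, y0)).
Qed.

Lemma psi_pt t : psi t (pt Y) = pt Y.
Proof. by case: psiP. Qed.

Lemma psi0 y : val y -> psi 0 y = y.
Proof. by case: psiP => _ _ h _; exact: h. Qed.

Lemma spreadP y (w : RR -> X) x r : val y ->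
  (forall t, t <= 0 -> w t = pt X) -> (forall t, 1 <= t -> w t = x) ->
  (y <> pt Y -> x = pt X) -> lev y <= r ->
  wdg_pred (spread y w r).1 /\ fibP (spread y w r).
Proof.
move=> vy w0 w1 yx hr; have l01 := lev01 y; split.
  rewrite /wdg_pred /=; have [h|h] := pselect (psi 1 y = pt Y); [by right|left].
  have y0 : y <> pt Y by move=> e; apply: h; rewrite e psi_pt.
  rewrite w1 ?yx//; apply: le_trans hr; rewrite lev1//; exact: psi_neq.
split=> /= t ht; rewrite /cut; first by rewrite w0//; minmax; lra.
by case: (leP t r) => // tr; rewrite !w1//; lra.
Qed.

Lemma cv_spread yn y (wn : nat -> pth X) w rn r : cv yn y -> cv wn w -> rcv rn r ->
  @cv (prod_cs (prod_cs X Y) (pth X))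
    (fun n => spread (yn n) (wn n) (rn n)) (spread y w r).
Proof.
move=> hy hw hr; split; [split|] => /=.
- exact: cv_app.
- by apply: cts_psi => //; exact: rcv_cst.
- exact: cv_cut.
Qed.

Lemma fib_cvP (u : nat -> fib) p :
  @cv (prod_cs (prod_cs X Y) (pth X)) u p ->
  wdg_pred p.1 /\ fibP p -> ev (fun n => wdg_pred (u n).1 /\ fibP (u n)) ->
  @cv fib u p.
Proof.
move=> [h1 h2] [h3 h4] h5; split=> //.
  by split=> //; split=> //; apply: ev_mp h5 => n [].
by apply: ev_mp h5 => n [].
Qed.

Lemma cv_fibP (u : nat -> fib) p : @cv fib u p ->
  [/\ cv (fun n => (u n).1.1) p.1.1, cv (fun n => (u n).1.2) p.1.2,
     @cv (pth X) (fun n => (u n).2) p.2, wdg_pred p.1 /\ fibP p &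
     ev (fun n => wdg_pred (u n).1 /\ fibP (u n))].
Proof.
by move=> [[[[h1 h2] h3 h4] h5] h6 h7]; split=> //; exact: ev_and.
Qed.

Lemma fib_loop (p : fib) : wdg_pred p.1 -> fibP p -> p.1.2 <> pt Y ->
  loopP p.2.
Proof.
move=> h [h0 h1] y0 t.
have x0 : p.1.1 = pt X by case: h.
move=> ht; have [h2|h2] : t <= 0 \/ 1 <= t by move: ht; lra.
  exact: h0.
by rewrite h1.
Qed.

Lemma gu_pt_neq (M : gsp) (x : M) : 0 < gu x -> x <> pt M.
Proof. by move=> /[swap] ->; rewrite gu_pt ltxx. Qed.

Lemma cv_hmk yn y (wn : nat -> pth X) w : cv yn y ->
  (0 < gu y -> cv wn w) ->
  (0 < gu y -> loopP w) ->
  ev (fun n => 0 < gu (yn n) -> @val (loops X) (wn n)) ->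
  cv (fun n => hmk (yn n) (wn n)) (hmk y w).
Proof.
move=> hy hw hl hv.
apply: (cv_mkq (@halfv01 Y (loops X)) (@halfv_cv Y (loops X))).
- exact: (gu_cv hy).
- move=> y0; split=> //; split=> //; [exact: hw|exact: hl|].
  apply: ev_mp2 (ev_gt (gu_cv hy) y0) hv => n h k.
  by have /val_sub [] := k h.
- apply: ev_mp2 (cv_mem hy) hv => n h k k2; split=> //; exact: k.
Qed.

Lemma pmap_collapse : pmap collapse.
Proof.
split; last by rewrite /collapse /hmk mkq_none// /halfv /= gu_pt.
move=> u p /cv_fibP [h1 h2 h3 [h4 h5] h6]; apply: cv_hmk => //.
  by move=> /gu_pt_neq; exact: fib_loop.
apply: ev_mp2 h6 (cv_mem h3) => n [h7 h8] h9 /gu_pt_neq y0; apply/val_sub.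
by split=> //; exact: fib_loop.
Qed.

Lemma loop_le0 (w : RR -> X) : loopP w -> forall t, t <= 0 -> w t = pt X.
Proof. by move=> h t t0; apply: h; lra. Qed.

Lemma loop_ge1 (w : RR -> X) : loopP w -> forall t, 1 <= t -> w t = pt X.
Proof. by move=> h t t0; apply: h; lra. Qed.

Lemma spread_pt (y : Y) (w : RR -> X) : val y -> gu y <= 2^-1 ->
  (forall t, t <= 0 -> w t = pt X) -> spread y w (lev y) = pt fib.
Proof.
move=> vy hy w0; have -> : lev y = 0 by rewrite /lev; minmax; lra.
have -> : spread y w 0 = ((pt X, pt Y), fun _ => pt X).
  rewrite /spread w0//; have -> : psi 1 y = pt Y.
    by case: psiP => _ _ _; apply => //; lra.
  by congr pair; apply/funext => t; rewrite /cut w0//; minmax; lra.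
by [].
Qed.

Lemma pmap_expand : pmap expand.
Proof.
split=> // u [[y w]|] /=.
  move=> [y0 [z [hz1 [hz2 hz3 hz4]] hu]].
  apply: (@cv_tail fib (fun n => spread (z n).1 (z n).2 (lev (z n).1))).
    by apply: ev_mp hu => n ->; case: (z n).
  apply: fib_cvP.
  - apply: cv_spread => //; apply: rcv_max; rcvt; exact: (gu_cv hz1).
  - apply: (spreadP (cv_val hz1) (loop_le0 hz3) (loop_ge1 hz3)) => //.
  - apply: ev_mp2 (cv_mem hz1) hz4 => n v1 v2.
    exact: (spreadP v1 (loop_le0 v2) (loop_ge1 v2)).
move=> [h1 h2]; apply: cv_eqcst; first exact: fib_val_pt.
have h : (0 : RR) < 2^-1 by lra.
apply: ev_mp2 h1 (ev_lt h2 h) => n; case: (u n) => [[y w]|] //=.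
move=> [[v1 /val_sub [_ v2]] _] h3; apply: spread_pt => //; first exact: ltW.
exact: loop_le0.
Qed.

Definition slide (t : RR) (z : HY) : HY :=
  if z is Some (y, w) then hmk (psi (1 - t) y) w else None.

(** The composite pairs [psi 1 y] with a stopped loop. The loop counts only where [psi 1 y] is
    nontrivial, and there it is not stopped early; so it suffices to undo [psi]. *)
Lemma collapse_expand : hom (fun z => collapse (expand z)) id.
Proof.
exists slide; split.
- apply: (@cts_CQ _ _ (@halfv01 Y (loops X)) (@halfv_cv Y (loops X)) Iv HY slide).
    move=> p q w e [hp _ _] ve [h1 h2].
    have h3 : cv (fun n => psi (1 - p n) (w n).1) (psi (1 - q) e.1).
      by apply: cts_psi => //; rcvt.
    have [h4 h5 h6] := h2.
    rewrite /slide; case: e ve h1 h2 h3 h4 h5 h6 => [y g] ve h1 h2 h3 h4 h5 h6.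
    apply: (@cv_tail HY (fun n => hmk (psi (1 - p n) (w n).1) (w n).2)).
      by apply: evT => n; case: (w n).
    by apply: cv_hmk => //; apply: ev_mp (cv_mem h2).
  move=> p q w [hp _ _] h1 h2.
  pose yn n : Y := if w n is Some e then e.1 else pt Y.
  have hy : cv yn (pt Y).
    apply: gu_base.
      by apply: ev_mp h1 => n; rewrite /yn; case: (w n) => [e|] /=;
        [case=> -[]|move=> _; exact: val_pt].
    apply: rcv_le0 h2; apply: evT => n; rewrite /yn; case: (w n) => [e|] /=.
      by have /andP[-> _] := gu01 e.1; rewrite /halfv lexx.
    by rewrite gu_pt lexx.
  have hs : cv (fun n => psi (1 - p n) (yn n)) (psi (1 - q) (pt Y)).
    by apply: cts_psi => //; rcvt.
  rewrite psi_pt in hs; split.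
    apply: ev_mp2 h1 (cv_mem hs) => n; rewrite /yn; case: (w n) => [[y g]|] //=.
    by move=> [[v1 v2] _] v3; apply: oval_mkq => _; split.
  have := gu_cv hs; rewrite /= gu_pt; apply: rcv_le0; apply: evT => n.
  rewrite /yn; case: (w n) => [[y g]|] /=.
    rewrite ou_mkq; last by have /andP[] := gu01 (psi (1 - p n) y).
    by rewrite /halfv /=; have /andP[-> _] := gu01 (psi (1 - p n) y); rewrite lexx.
  by rewrite psi_pt gu_pt lexx.
- by move=> t x _ ->.
- move=> [[y w]|] /val_CQ /=; last first.
    by move=> _; rewrite /collapse /hmk /= mkq_none// /halfv /= gu_pt.
  move=> [[v1 /val_sub [_ v2]] _]; rewrite subr0 /collapse /=.
  have [h|h] := pselect (psi 1 y = pt Y).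
    by rewrite h /hmk !mkq_none// /halfv /= gu_pt.
  rewrite lev1; last exact: psi_neq.
  congr hmk; apply/funext => t; rewrite /cut; case: (leP t 1) => // t1.
  by rewrite !loop_ge1//; lra.
- move=> [[y w]|] // /val_CQ /= [[v1 /val_sub [_ v2]] h].
  by rewrite subrr psi0// /hmk mkq_some.
Qed.

Lemma expand_collapse : hom (fun p => expand (collapse p)) id.
Proof.
(* First the stopping time is raised from [lev] to 1, which restores the point of [X] and the whole
   path; then [psi] is undone. *)
apply: (@hom_trans _ _ _ (fun p : fib => ((p.1.1, psi 1 p.1.2), p.2) : fib)).
  exists (fun t p => spread p.1.2 p.2 (Num.max (lev p.1.2) t)); split.
  - move=> u [q p] [[/= hq q01 qn] /cv_fibP [/= h1 h2 h3 [h4 [h5 h6]] h7]].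
    apply: fib_cvP.
    + apply: cv_spread => //; apply: rcv_max => //; apply: rcv_max; rcvt.
      exact: (gu_cv h2).
    + apply: (spreadP (cv_val h2) h5 h6).
        by move=> y0; case: h4.
      by rewrite le_max lexx.
    + apply: ev_mp2 (cv_mem h2) h7 => n v2 [k4 [k5 k6]].
      apply: (spreadP v2 k5 k6).
        by move=> y0; case: k4.
      by rewrite le_max lexx.
  - move=> t x /andP[t0 _] ->; rewrite /spread psi_pt.
    by rewrite (_ : lev (pt fib).1.2 = 0) //= /lev gu_pt; minmax; lra.
  - move=> [[x y] w] /cv_fibP [/= h1 h2 h3 [h4 [h5 h6]] h7].
    rewrite (_ : Num.max _ 0 = lev y); last by have := lev01 y; minmax; lra.
    rewrite /collapse /hmk /mkq /halfv /=; case: ifPn => // y0.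
    rewrite spread_pt//.
    by have := gu01 y; move: y0; lra.
  - move=> [[x y] w] /cv_fibP [/= h1 h2 h3 [h4 [h5 h6]] h7].
    rewrite (_ : Num.max _ 1 = 1); last by have := lev01 y; minmax; lra.
    have {}h6 t : 1 <= t -> w t = x by exact: h6.
    rewrite /spread h6//; congr pair; apply/funext => t; rewrite /cut.
    by case: (leP t 1) => // t1; rewrite !h6//; lra.
exists (fun t p => ((p.1.1, psi (1 - t) p.1.2), p.2)); split.
- move=> u [q p] [[/= hq q01 qn] /cv_fibP [/= h1 h2 h3 [h4 h5] h7]].
  apply: fib_cvP.
  + split=> //; split=> //=; apply: cts_psi => //; rcvt.
  + split=> //; case: h4 => /= [->|->]; [by left|by right; rewrite /= psi_pt].
  + apply: ev_mp h7 => n [k4 k5]; split=> //.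
    by case: k4 => /= [->|->]; [by left|by right; rewrite /= psi_pt].
- by move=> t x t01 -> /=; rewrite psi_pt.
- by move=> x _; rewrite subr0.
- move=> [[x y] w] /cv_fibP [/= h1 h2 h3 [h4 h5] h7].
  by rewrite subrr psi0//; exact: cv_val h2.
Qed.

Lemma heq_fib : heq HY fib.
Proof.
exists expand, collapse; split;
  [exact: pmap_expand|exact: pmap_collapse|exact: collapse_expand|
   exact: expand_collapse].
Qed.

Definition fibq (p : fib) : W := p.1.

Lemma pmap_fibq : pmap fibq.
Proof. by split=> // u x [[]]. Qed.

Lemma fibq_fst n (a : piG n fib) : pif (fun w : W => w.1) (pif fibq a) = 0.
Proof.
have pq := pmap_fibq; have p1 := pmap_wdg1 X Y.
rewrite pif_comp// -(pif_cst X a); apply: pif_hom.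
- exact: pmap_comp.
- exact: pmap_cst.
(* The path carried by a point of the fibre contracts its own endpoint. *)
apply: rhom_sym; exists (fun t p => p.2 t); split.
- move=> u [q p] [[/= hq q01 qn] /cv_fibP [/= h1 h2 h3 h4 h7]].
  exact: (cv_app h3 hq).
- by move=> t x _ ->.
- by move=> p /cv_fibP [/= h1 h2 h3 [h4 [h5 _]] h7]; rewrite h5.
- by move=> p /cv_fibP [/= h1 h2 h3 [h4 [_ h5]] h7]; rewrite h5.
Qed.

Lemma clsG0P n (M : pcs) (f : vec n.+2 -> M) : sph f ->
  clsG f = 0 <-> shom f (fun _ => pt M).
Proof. by move=> sf; apply: cls_eqP => //; exact: sph_cst. Qed.

Lemma fibq_surj n (A : piG n W) : pif (fun w : W => w.1) A = 0 ->
  exists a, pif fibq a = A.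
Proof.
have p1 := pmap_wdg1 X Y.
have sr := sph_rep A; rewrite -(cls_rep A) -/(clsG _) pif_cls//.
move: (rep A) sr => f [cf f0] /clsG0P h.
have [|H [cH H0 H1 H2]] := h; first exact: (sph_map p1).
(* The nullhomotopy of the first coordinate, run backwards, is the path that the fibre asks for. *)
pose g (t : vec n.+2) : fib := (f t, fun r => H (1 - cl r) t).
have sg : sph g.
  split.
    move=> u t hu; split.
    + split; first exact: (cf u t hu).
      apply: (@cv_pth (vec n.+2) X (fun t r => H (1 - cl r) t)) => // v y r r0 hv hr.
      apply: (cH (fun k => (1 - cl (r k), v k)) (_, _)); split=> //=; split.
      * by rcvt.
      * by change (0 <= 1 - cl r0 <= 1); have := cl01 r0; lra.
      * by apply: evT => k; change (0 <= 1 - cl (r k) <= 1); have := cl01 (r k); lra.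
    + split=> r hr /=; first by rewrite cl_le0// subr0 H2//; exact: val_vec.
      by rewrite cl_ge1// subrr H1//; exact: val_vec.
    + apply: evT => k.
      split=> r hr /=; first by rewrite cl_le0// subr0 H2//; exact: val_vec.
      by rewrite cl_ge1// subrr H1//; exact: val_vec.
  move=> t bt; rewrite /g f0//; congr pair; apply/funext => r.
  by rewrite H0//; have := cl01 r; lra.
by exists (clsG g); rewrite pif_cls//; exact: pmap_fibq.
Qed.

(** By exactness the kernel comes from loops in [X]. These die because [X] itself lies in the wedge:
    the free end of such a loop can be drawn back along it inside the fibre. *)
Lemma fibq_inj n (a : piG n fib) : pif fibq a = 0 -> a = 0.
Proof.
have pq := pmap_fibq.
have sr := sph_rep a; rewrite -(cls_rep a) -/(clsG _) pif_cls//.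
move: (rep a) sr => g sg; have [cg g0] := sg.
move=> /clsG0P h; have [|K [cK K0 K1 K2]] := h; first exact: (sph_map pq).
apply/clsG0P => //.
have gP t : [/\ wdg_pred (g t).1, (forall r, r <= 0 -> (g t).2 r = pt X) &
    (forall r, 1 <= r -> (g t).2 r = (g t).1.1)].
  by have /cv_fibP [_ _ _ [? []]] := cts_val cg (val_vec t).
have ct u t r r0 : cv u t -> rcv r r0 -> cv (fun k => (g (u k)).2 (r k)) ((g t).2 r0).
  by move=> /cg /cv_fibP [_ _ h1 _ _] hr; exact: (cv_app h1 hr).
(* The path of [g t] up to time 1/2, then the trace in [X] of the nullhomotopy [K] up to stage
   [q]. *)
pose s (q : RR) (t : vec n.+2) (r : RR) : X :=
  if r <= 2^-1 then (g t).2 (2 * r) else (K (cl (Num.min (2 * r - 1) q)) t).1.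
have cs q q0 u t r r0 : 0 <= q0 <= 1 -> rcv q q0 -> cv u t -> rcv r r0 ->
    cv (fun k => s (q k) (u k) (r k)) (s q0 t r0).
  move=> q01 hq hu hr; apply: cv_if => //.
  + by move=> _; apply: ct => //; rcvt.
  + move=> _.
    have hc : @cv Iv (fun k => cl (Num.min (2 * r k - 1) (q k)))
        (cl (Num.min (2 * r0 - 1) q0)) by apply: cv_clamp; rcvt.
    by have [[h1 _] _ _] := cK (fun k => (_, u k)) (_, t) (conj hc hu).
  + move=> ->; rewrite mulfV ?pnatr_eq0// subrr.
    rewrite (_ : Num.min 0 q0 = 0); last by minmax; lra.
    rewrite cl_le0// K1; last exact: val_vec.
    by have [_ _ ->] := gP t.
(* Doubling the speed of the path frees the times after 1/2 for the trace of [K]. *)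
apply: (@rhom_trans _ _ fib _ (fun t => ((g t).1, fun r => (g t).2 (2 * r)))).
  exists (fun q t => ((g t).1, fun r => (g t).2 ((1 + q) * r))); split.
  - move=> u [q t] [[/= hq q01 qn] ht].
    have hP (q' : RR) t' : 0 <= q' <= 1 ->
        fibP ((g t').1, fun r => (g t').2 ((1 + q') * r)).
      move=> q'01; have [_ h1 h2] := gP t'; split=> r hr /=.
        by apply: h1; nra.
      by apply: h2; nra.
    split; [split| |].
    + by have [[]] := cg _ _ ht.
    + split=> /=.
      * by move=> r r0 hr; apply: (ct (fun _ => t)); rcvt; exact: val_vec.
      * by apply: evT => k r r0 hr; apply: (ct (fun _ => _)); rcvt; exact: val_vec.
      * by move=> r r0 hr; apply: ct; rcvt.
    + exact: hP.
    + by apply: ev_mp qn => k; exact: hP.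
  - by move=> q t _ bt; rewrite g0.
  - move=> t _; rewrite [RHS]surjective_pairing; congr pair; apply/funext => r.
    by rewrite addr0 mul1r.
  - by move=> t _; congr pair; apply/funext => r; congr ((g t).2 _); lra.
apply: (@rhom_trans _ _ fib _ (fun t => (pt W, s 1 t))).
  exists (fun q t => (K q t, s q t)); split.
  - move=> u [q t] [hq ht]; have [/= hq1 q01 qn] := hq.
    have hP (q' : RR) t' : 0 <= q' <= 1 -> fibP (K q' t', s q' t').
      move=> q'01; have [_ h1 h2] := gP t'; split=> r hr /=; rewrite /s.
        by rewrite ifT ?h1//; lra.
      rewrite ifF; last by lra.
      by rewrite (_ : Num.min _ _ = q') ?cl_id//; minmax; lra.
    split; [split| |].
    + exact: (cK u (q, t)).
    + split=> /=.
      * by move=> r r0 hr; apply: (cs (fun _ => q) q (fun _ => t)) => //;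
          [exact: rcv_cst|exact: val_vec].
      * by apply: ev_mp qn => k qk r r0 hr;
          apply: (cs (fun _ => (u k).1) (u k).1 (fun _ => (u k).2)) => //;
          [exact: rcv_cst|exact: val_vec].
      * by move=> r r0 hr; apply: cs.
    + exact: hP.
    + by apply: ev_mp qn => k; exact: hP.
  - move=> q t q01 bt; rewrite K0//; congr pair; apply/funext => r.
    by rewrite /s g0// K0 ?if_same//; exact: cl01.
  - move=> t vt; rewrite K1//; congr pair; apply/funext => r; rewrite /s.
    case: ifPn => // hr; rewrite cl_le0; last by minmax; lra.
    by rewrite K1//; have [_ _ ->] := gP t => //; lra.
  - by move=> t vt; rewrite K2.
have s1 t r : 1 <= r -> s 1 t r = pt X.
  move=> hr; rewrite /s ifF; last by lra.
  rewrite (_ : Num.min _ _ = 1); last by minmax; lra.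
  by rewrite cl_ge1// K2//; exact: val_vec.
have s0 t r : r <= 0 -> s 1 t r = pt X.
  move=> hr; rewrite /s ifT; last by lra.
  by have [_ -> ] := gP t => //; lra.
(* Only a loop in [X] is left, and its free end is drawn back along it. *)
exists (fun q t => ((s 1 t (1 - q), pt Y), cut (s 1 t) (1 - q))); split.
- move=> u [q t] [hq ht]; have [/= hq1 q01 qn] := hq.
  have hP (q' : RR) t' : 0 <= q' <= 1 ->
      @fibP ((s 1 t' (1 - q'), pt Y), cut (s 1 t') (1 - q')).
    move=> q'01; split=> r hr /=; rewrite /cut.
      by rewrite s0//; minmax; lra.
    by rewrite (_ : Num.min _ _ = 1 - q')//; minmax; lra.
  have k01 : 0 <= (1 : RR) <= 1 by rewrite ler01 lexx.
  have hr : rcv (fun k => 1 - (u k).1) (1 - q) by rcvt.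
  have hs : @cv (pth X) (fun k => s 1 (u k).2) (s 1 t).
    apply: (@cv_pth (vec n.+2) X (s 1) (fun k => (u k).2)) => // v y r r0 hv hr'.
    by apply: (cs (fun _ => 1)) => //; exact: rcv_cst.
  apply: fib_cvP.
  + split; [split|] => /=.
    * exact: (cv_app hs hr).
    * exact: val_pt.
    * exact: (cv_cut hs hr).
  + by split; [right|exact: hP].
  + by apply: ev_mp qn => k qk; split; [right|exact: hP].
- move=> q t q01 bt.
  have sp r : s 1 t r = pt X.
    by rewrite /s g0// K0 ?if_same//; exact: cl01.
  by rewrite sp; congr pair; apply/funext => r; rewrite /cut sp.
- move=> t vt; rewrite subr0 s1//; congr pair; apply/funext => r; rewrite /cut.
  by case: (leP r 1) => // hr; rewrite !s1//; lra.
- move=> t vt; rewrite subrr s0//; congr pair; apply/funext => r; rewrite /cut.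
  by rewrite s0//; minmax; lra.
Qed.

Lemma wedge_kernel n : exists j : piG n HY -> piG n W,
  [/\ forall x y, j (x + y) = j x + j y, forall k, j k = 0 -> k = 0,
      forall k, pif (fun w : W => w.1) (j k) = 0 &
      forall g, pif (fun w : W => w.1) g = 0 -> exists k, j k = g].
Proof.
have [f [fD [g fg gf]]] := giso_heq n heq_fib.
have pq := pmap_fibq; exists (fun x => pif fibq (f x)); split.
- by move=> x y; rewrite fD pif_add.
- move=> k /fibq_inj k0; rewrite -(fg k) k0 -(additive0 fD) fg; by [].
- by move=> k; exact: fibq_fst.
- by move=> A /fibq_surj [a <-]; exists (g a); rewrite gf.
Qed.

Lemma pi_wedge n : giso (piG n W) (piG n X * piG n HY)%type.
Proof.
have [j [jD j0 pj jk]] := wedge_kernel n.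
have p1 := pmap_wdg1 X Y; have i1 := pmap_win1 X Y.
apply: (@giso_split _ _ _ (pif (fun w : W => w.1)) (pif (@win1 X Y)) j) => //.
- by move=> x y; exact: pif_add.
- by move=> x y; exact: pif_add.
- by move=> x; rewrite pif_comp// pif_id.
Qed.

End Fibre.

(** * Suspending a loop space *)

Lemma bump_le_l a c : 4 * a <= c -> 0 <= c -> bump a <= c.
Proof. by rewrite /bump /cl; minmax; lra. Qed.

Lemma bump_le_r a c : 4 * (1 - a) <= c -> 0 <= c -> bump a <= c.
Proof. by rewrite /bump /cl; minmax; lra. Qed.

(** A gauge below 1/2 puts the coordinate within 1/8 of an end, where [bump] is linear; this is how
    closeness to the base point of a suspension is exploited below. *)
Lemma bump_small s : 0 <= s <= 1 -> bump s < 2^-1 ->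
  (s < 8^-1 /\ bump s = 4 * s) \/ (1 - 8^-1 < s /\ bump s = 4 * (1 - s)).
Proof.
rewrite /bump /cl => h; minmax; solve [lra | left; lra | right; lra].
Qed.

Lemma bump_mid s : 4^-1 <= s <= 1 - 4^-1 -> bump s = 1.
Proof. by rewrite /bump /cl => h; minmax; lra. Qed.

Definition pc (T : Type) (w d : RR -> T) : RR -> T :=
  fun t => if t <= 2^-1 then w (2 * t) else d (2 * t - 1).

Lemma cv_pc (X : cs) (w d : nat -> pth X) w0 d0 : cv w w0 -> cv d d0 ->
  w0 1 = d0 0 -> ev (fun n => w n 1 = d n 0) ->
  @cv (pth X) (fun n => pc (w n) (d n)) (pc w0 d0).
Proof.
move=> hw hd e en.
have key (w1 d1 : nat -> pth X) w2 d2 : cv w1 w2 -> cv d1 d2 -> w2 1 = d2 0 ->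
    forall t t0, rcv t t0 -> cv (fun n => pc (w1 n) (d1 n) (t n)) (pc w2 d2 t0).
  move=> hw1 hd1 e1 t t0 ht; apply: cv_if => //.
  - move=> _; have h : rcv (fun n => 2 * t n) (2 * t0) by rcvt.
    exact: (cv_app hw1 h).
  - move=> _; have h : rcv (fun n => 2 * t n - 1) (2 * t0 - 1) by rcvt.
    exact: (cv_app hd1 h).
  - by move=> ->; rewrite mulfV ?pnatr_eq0// subrr.
split.
- by apply: (key (fun _ => w0) (fun _ => d0)) => //; [exact: (cv_val hw)|exact: (cv_val hd)].
- apply: ev_mp2 en (ev_and (cv_mem hw) (cv_mem hd)) => n en [h1 h2].
  exact: (key (fun _ => w n) (fun _ => d n)).
- exact: key.
Qed.

Lemma cv_comp_pth (X : cs) (w : nat -> pth X) w0 (a : nat -> RR -> RR) a0 :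
  cv w w0 -> (forall n t t0, rcv t t0 -> rcv (fun k => a n (t k)) (a n t0)) ->
  (forall t t0, rcv t t0 -> rcv (fun k => a k (t k)) (a0 t0)) ->
  (forall t t0, rcv t t0 -> rcv (fun k => a0 (t k)) (a0 t0)) ->
  @cv (pth X) (fun n t => w n (a n t)) (fun t => w0 (a0 t)).
Proof.
move=> [h1 h2 h3] ha hb hc; split.
- by move=> t t0 ht; apply: h1; exact: hc.
- by apply: ev_mp h2 => n h t t0 ht; apply: h; exact: ha.
- by move=> t t0 ht; apply: h3; exact: hb.
Qed.

(** * Paths over a space, collapsed over its base point *)

Section PathsOver.
Context (X : gsp).

Let E := prod_cs X (pth X).

Section Pred.
Context (P : E -> Prop).

Definition overv (p : sub_cs P) : RR := gu p.1.

Lemma overv01 p : 0 <= overv p <= 1.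
Proof. exact: gu01. Qed.

Lemma overv_cv : @cts (sub_cs P) Rl overv.
Proof. by move=> u p [[h _] _ _]; exact: (gu_cv h). Qed.

(* Pairs of a point x and a path constrained by P, with everything over the
   base point of X collapsed. *)
Definition over : gsp := CQ overv01 overv_cv.

Definition omk (x : X) (w : pth X) : over := mkq overv (x, w).

Lemma cv_omk xn x (wn : nat -> pth X) w : cv xn x ->
  (0 < gu x -> cv wn w) -> (0 < gu x -> P (x, w)) ->
  ev (fun n => 0 < gu (xn n) -> val (wn n) /\ P (xn n, wn n)) ->
  cv (fun n => omk (xn n) (wn n)) (omk x w).
Proof.
move=> hx hw hP hv; apply: (cv_mkq overv01 overv_cv).
- exact: (gu_cv hx).
- move=> x0; split.
  + by split=> //; exact: hw.
  + exact: hP.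
  + by apply: ev_mp2 (ev_gt (gu_cv hx) x0) hv => n h /(_ h) [].
- apply: ev_mp2 (cv_mem hx) hv => n h k /k [k1 k2]; apply/val_sub.
  by split=> //; split.
Qed.

Lemma gu_omk x w : gu (omk x w) = gu x.
Proof. by rewrite /= ou_mkq //; have /andP[] := gu01 x. Qed.

Lemma val_omk x w : val x -> (0 < gu x -> val w /\ P (x, w)) -> val (omk x w).
Proof.
move=> vx h; apply/val_CQ; apply: oval_mkq => h0; apply/val_sub.
by have [] := h h0; split=> //; split.
Qed.

Lemma omk_some x w : 0 < gu x -> omk x w = Some (x, w).
Proof. exact: (@mkq_some _ overv (x, w)). Qed.

Lemma omk_none x w : gu x = 0 -> omk x w = None.
Proof. by move=> h; apply: mkq_none; rewrite /overv /= h. Qed.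

Lemma omk_none0 w : omk (pt X) w = None.
Proof. by apply: omk_none; rewrite gu_pt. Qed.

Lemma val_over x w : @val over (Some (x, w)) ->
  [/\ val x, @val (pth X) w, P (x, w) & 0 < gu x].
Proof. by move=> /val_CQ [/val_sub [[h1 h2] h3] h4]. Qed.

Lemma cts_over (K Z : cs) (F : K -> X -> pth X -> Z) (z0 : Z) :
  (forall k q xn x (wn : nat -> pth X) w, cv k q -> 0 < gu x ->
     cv xn x -> cv wn w -> P (x, w) -> ev (fun n => P (xn n, wn n)) ->
     cv (fun n => F (k n) (xn n) (wn n)) (F q x w)) ->
  (forall k q xn (wn : nat -> pth X), cv k q -> cv xn (pt X) ->
     ev (fun n => 0 < gu (xn n) -> @val over (Some (xn n, wn n))) ->
     cv (fun n => if 0 < gu (xn n) then F (k n) (xn n) (wn n) else z0) z0) ->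
  @cts (prod_cs K over) Z
    (fun z => if z.2 is Some (x, w) then F z.1 x w else z0).
Proof.
move=> h1 h2.
apply: (@cts_CQ _ _ overv01 overv_cv K Z
  (fun k y => if y is Some (x, w) then F k x w else z0)).
  move=> k q wn [x w] hk hx [[/= hxn hwn] hP hPn].
  have := h1 _ _ _ _ _ _ hk hx hxn hwn hP.
  set a := (fun n => F (k n) (wn n).1 (wn n).2).
  move=> h; apply: (@cv_tail Z a); first by apply: evT => n; rewrite /a; case: (wn n).
  by apply: h; apply: ev_mp hPn => n; case: (wn n).
move=> k q yn hk hv hu.
pose xn n : X := if yn n is Some (x, w) then x else pt X.
pose wn n : pth X := if yn n is Some (x, w) then w else fun _ => pt X.
have hx : cv xn (pt X).
  apply: gu_base.
    by apply: ev_mp hv => n; rewrite /xn; case: (yn n) => [[x w]|] /=;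
      [case=> -[[]]|move=> _; exact: val_pt].
  apply: rcv_tail hu; apply: evT => n; rewrite /xn; case: (yn n) => [[x w]|] //=.
  by rewrite gu_pt.
have := h2 k q xn wn hk hx.
set a := (fun n => if _ then _ else _) => h; apply: (@cv_tail Z a).
  apply: ev_mp hv => n; rewrite /a /xn /wn; case: (yn n) => [[x w]|] /=.
    by move=> [_ h0]; rewrite (h0 : 0 < gu x).
  by rewrite gu_pt ltxx.
apply: h; apply: ev_mp hv => n; rewrite /xn /wn; case: (yn n) => [[x w]|] h.
  by move=> _; apply/val_CQ.
by rewrite gu_pt ltxx.
Qed.

End Pred.

Definition omap (P Q : E -> Prop) (f : X -> (RR -> X) -> RR -> X) (y : over P) :
  over Q := if y is Some (x, w) then omk Q x (f x w) else None.

Lemma cts_omap (K : cs) (P Q : E -> Prop) (f : K -> X -> pth X -> pth X) :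
  (forall k q xn x (wn : nat -> pth X) w, cv k q -> 0 < gu x ->
     cv xn x -> cv wn w -> P (x, w) -> ev (fun n => P (xn n, wn n)) ->
     cv (fun n => f (k n) (xn n) (wn n)) (f q x w)) ->
  (forall q x w, val q -> val x -> 0 < gu x -> P (x, w) -> Q (x, f q x w)) ->
  @cts (prod_cs K (over P)) (over Q) (fun z => @omap P Q (f z.1) z.2).
Proof.
move=> h1 h2; apply: (@cts_over P K (over Q) (fun k x w => omk Q x (f k x w)) None).
  move=> k q xn x wn w hk hx hxn hwn hP hPn; have hf := h1 _ _ _ _ _ _ hk hx hxn hwn hP hPn.
  apply: cv_omk => //.
    by move=> _; apply: h2 => //; [exact: cv_val hk|exact: cv_val hxn].
  have := ev_and (cv_mem hk) (cv_mem hxn).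
  apply: ev_mp2 (ev_and hPn (cv_mem hf)) => n [k1 k2] [k3 k4] x0; split=> //.
  exact: h2.
move=> k q xn wn hk hx hv.
apply: (@gu_base (over Q)).
  apply: ev_mp2 (ev_and (cv_mem hx) (cv_mem hk)) hv => n [k1 k2] k3.
  case: ifPn => x0; last exact: (val_pt (over Q)).
  have [_ k4 k5 _] := val_over (k3 x0).
  apply: val_omk => // _; split; last exact: h2.
  by apply: (h1 (fun _ => k n) _ (fun _ => xn n) _ (fun _ => wn n)) => //; exact: evT.
have := gu_cv hx; rewrite gu_pt; apply: rcv_tail; apply: evT => n.
case: ifPn => x0; first by rewrite gu_omk.
by rewrite /=; have := gu01 (xn n); move: x0; lra.
Qed.

Lemma pmap_omap (P Q : E -> Prop) (f : X -> pth X -> pth X) :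
  (forall xn x (wn : nat -> pth X) w, 0 < gu x ->
     cv xn x -> cv wn w -> P (x, w) -> ev (fun n => P (xn n, wn n)) ->
     cv (fun n => f (xn n) (wn n)) (f x w)) ->
  (forall x w, val x -> 0 < gu x -> P (x, w) -> Q (x, f x w)) ->
  pmap (@omap P Q f).
Proof.
move=> h1 h2; split=> //; apply: cts_par0.
apply: (@cts_omap Iv P Q (fun _ => f)).
  by move=> k q *; exact: h1.
by move=> q *; exact: h2.
Qed.

Lemma hom_omap (P Q : E -> Prop) (f : RR -> X -> pth X -> pth X)
    (g k : over P -> over Q) :
  (forall t q xn x (wn : nat -> pth X) w, @cv Iv t q -> 0 < gu x ->
     cv xn x -> cv wn w -> P (x, w) -> ev (fun n => P (xn n, wn n)) ->
     cv (fun n => f (t n) (xn n) (wn n)) (f q x w)) ->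
  (forall q x w, 0 <= q <= 1 -> val x -> 0 < gu x -> P (x, w) -> Q (x, f q x w)) ->
  (g None = None) -> (k None = None) ->
  (forall x w, val x -> @val (pth X) w -> 0 < gu x -> P (x, w) ->
     omk Q x (f 0 x w) = g (Some (x, w))) ->
  (forall x w, val x -> @val (pth X) w -> 0 < gu x -> P (x, w) ->
     omk Q x (f 1 x w) = k (Some (x, w))) -> hom g k.
Proof.
move=> h1 h2 g0 k0 hg hk; exists (fun t => @omap P Q (f t)); split.
- by apply: (@cts_omap Iv P Q f) => // q x w /val_sub [_ ?]; exact: h2.
- by move=> t x _ ->.
- by move=> [[x w]|] // /val_over [? ? ? ?]; exact: hg.
- by move=> [[x w]|] // /val_over [? ? ? ?]; exact: hk.
Qed.

Definition epP (p : E) : Prop :=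
  (forall t, t <= 0 -> p.2 t = pt X) /\ (forall t, 1 <= t -> p.2 t = p.1).

Definition lpP (p : E) : Prop := @loopP X p.2.

Lemma heq_over_loops : heq (over lpP) (Half X (loops X)).
Proof.
have f : @pmap (over lpP) (Half X (loops X)) id.
  split=> // u [[x w]|] [h1 h2]; split=> //.
    have {h2}[z [[h2 h3] h4 h5] h6] := h2; exists z => //.
  by apply: ev_mp h1 => n; case: (u n) => //= -[x w] [] /val_sub [[h1 h3] h4] h5;
    split=> //; split=> //; apply/val_sub.
have g : @pmap (Half X (loops X)) (over lpP) id.
  split=> // u [[x w]|] [h1 h2]; split=> //.
    by have {h2}[z [h2 [h3 h4 h5]] h6] := h2; exists z.
  by apply: ev_mp h1 => n; case: (u n) => //= -[x w] [] [h1 /val_sub [h3 h4]] h5;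
    split=> //; apply/val_sub.
exact: (heq_iso f g).
Qed.

(** Rays to the base point, continuous only away from it: a ray starting close to the base point may
    make a long detour. *)
Definition rayed (rho : RR -> X -> X) : Prop :=
  [/\ forall t t0 x x0, rcv t t0 -> cv x x0 -> 0 < gu x0 ->
        cv (fun n => rho (t n) (x n)) (rho t0 x0),
      forall x t, val x -> 0 < gu x -> t <= 0 -> rho t x = x &
      forall x t, val x -> 0 < gu x -> 1 <= t -> rho t x = pt X].

Context (rho : RR -> X -> X) (rhoP : rayed rho).

Lemma cv_ray xn x (a : nat -> RR -> RR) a0 : cv xn x -> 0 < gu x ->
  (forall n t t0, rcv t t0 -> rcv (fun k => a n (t k)) (a n t0)) ->
  (forall t t0, rcv t t0 -> rcv (fun k => a k (t k)) (a0 t0)) ->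
  (forall t t0, rcv t t0 -> rcv (fun k => a0 (t k)) (a0 t0)) ->
  @cv (pth X) (fun n t => rho (a n t) (xn n)) (fun t => rho (a0 t) x).
Proof.
move=> hx x0 ha hb hc; have [hr _ _] := rhoP; split.
- move=> t t0 ht; apply: hr => //; [exact: hc|exact: cv_val hx].
- have := ev_and (cv_mem hx) (ev_gt (gu_cv hx) x0).
  by apply: ev_mp => n [k1 k2] t t0 ht; apply: hr => //; exact: ha.
- by move=> t t0 ht; apply: hr => //; exact: hb.
Qed.

(** Appending the ray of [x] turns a path ending at [x] into a loop, and the reversed ray does the
    opposite. This trivialises the path fibration off the base point. *)
Definition close (x : X) (w : RR -> X) : RR -> X := pc w (fun t => rho t x).
Definition unclose (x : X) (w : RR -> X) : RR -> X := pc w (fun t => rho (1 - t) x).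

Lemma ep_le0 x (w : RR -> X) t : epP (x, w) -> t <= 0 -> w t = pt X.
Proof. by move=> [h _]; exact: h. Qed.

Lemma ep_ge1 x (w : RR -> X) t : epP (x, w) -> 1 <= t -> w t = x.
Proof. by move=> [_ h]; exact: h. Qed.

Lemma pmap_close : pmap (@omap epP lpP close).
Proof.
have [hr h0 h1] := rhoP; apply: pmap_omap.
  move=> xn x wn w x0 hx hw hP hPn; apply: cv_pc => //.
  - apply: (cv_ray (a := fun _ t => t) hx) => //.
  - by rewrite h0 ?(ep_ge1 hP)//; exact: (cv_val hx).
  - have := ev_and (cv_mem hx) (ev_gt (gu_cv hx) x0).
    by apply: ev_mp2 hPn => n k [k1 k2]; rewrite h0 ?(ep_ge1 k).
move=> x w vx x0 hP t ht; rewrite /close /pc /=.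
have [h|h] : t <= 0 \/ 1 <= t by move: ht; lra.
  by rewrite ifT ?(ep_le0 hP)//=; lra.
by rewrite ifF ?h1//; lra.
Qed.

Lemma lp_le0 x (w : RR -> X) t : lpP (x, w) -> t <= 0 -> w t = pt X.
Proof. by move=> h ht; apply: h; lra. Qed.

Lemma lp_ge1 x (w : RR -> X) t : lpP (x, w) -> 1 <= t -> w t = pt X.
Proof. by move=> h ht; apply: h; lra. Qed.

Lemma pmap_unclose : pmap (@omap lpP epP unclose).
Proof.
have [hr h0 h1] := rhoP; apply: pmap_omap.
  move=> xn x wn w x0 hx hw hP hPn; apply: cv_pc => //.
  - by apply: (cv_ray (a := fun _ t => 1 - t) hx) => // *; rcvt.
  - by rewrite subr0 h1 ?(lp_ge1 hP)//; exact: (cv_val hx).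
  - have := ev_and (cv_mem hx) (ev_gt (gu_cv hx) x0).
    by apply: ev_mp2 hPn => n k [k1 k2]; rewrite subr0 h1 ?(lp_ge1 k).
move=> x w vx x0 hP; split=> t ht; rewrite /unclose /pc /=.
  by rewrite ifT ?(lp_le0 hP)//; lra.
by rewrite ifF ?h0//; lra.
Qed.

Lemma unclose_close :
  hom (fun y => @omap lpP epP unclose (@omap epP lpP close y)) id.
Proof.
have [hr h0 h1] := rhoP.
pose k (x : X) (w : pth X) : pth X := fun t => w (4 * t).
apply: (@hom_trans _ _ _ (@omap epP epP k)).
  (* The detour along the ray and back is cut down to its part before time [1 - q]; in the end [w]
     remains, run at speed 4. *)
  apply: (@hom_omap epP epP (fun q x w => pc (pc w (fun t => rho (Num.min t (1 - q)) x))
    (fun t => rho (Num.min (1 - t) (1 - q)) x))) => //.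
  - move=> s q xn x wn w [hs q01 sn] x0 hx hw hP hPn.
    have vx := cv_val hx; have hxn := ev_and (cv_mem hx) (ev_gt (gu_cv hx) x0).
    apply: cv_pc; first apply: cv_pc => //.
    + by apply: (cv_ray (a := fun n t => Num.min t (1 - s n)) hx) => // *; rcvt.
    + by rewrite h0 ?(ep_ge1 hP)//; minmax; lra.
    + apply: ev_mp2 hPn (ev_and hxn sn) => n k1 [[k2 k3] k4].
      by rewrite h0 ?(ep_ge1 k1)//; minmax; lra.
    + by apply: (cv_ray (a := fun n t => Num.min (1 - t) (1 - s n)) hx) => // *; rcvt.
    + rewrite /pc ifF; last by lra.
      by congr (rho _ x); minmax; lra.
    + apply: evT => n; rewrite /pc ifF; last by lra.
      by congr (rho _ (xn n)); minmax; lra.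
  - move=> q x w q01 vx x0 hP; split=> t ht; rewrite /pc /=.
      by rewrite !ifT ?(ep_le0 hP)//=; lra.
    by rewrite ifF ?h0//; minmax; lra.
  - move=> x w vx vw x0 hP; rewrite /omap; do ! rewrite omk_some//=.
    congr (Some (x, _)); apply/funext => t.
    rewrite /unclose /close /pc; case: ifPn => ht; [case: ifPn => // ht'|].
      rewrite subr0; case: (leP (2 * (2 * t) - 1) 1) => // h.
      by rewrite !h1//; lra.
    rewrite subr0; case: (leP (1 - (2 * t - 1)) 1) => // h.
    by rewrite !h1//; lra.
  - move=> x w vx vw x0 hP /=; congr (omk _ _ _); apply/funext => t.
    rewrite /k /pc; case: ifPn => ht; [case: ifPn => ht'|].
    + by congr w; lra.
    + by rewrite h0 ?(ep_ge1 hP)//; minmax; lra.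
    + by rewrite h0 ?(ep_ge1 hP)//; minmax; lra.
apply: (@hom_omap epP epP (fun q x w t => w ((4 - 3 * q) * t))) => //.
- move=> s q xn x wn w [hs q01 sn] x0 hx hw hP hPn.
  by apply: (@cv_comp_pth X wn w (fun n t => (4 - 3 * s n) * t)) => // *; rcvt.
- move=> q x w q01 vx x0 hP; split=> t ht /=.
    by apply: (ep_le0 hP); nra.
  by apply: (ep_ge1 hP); nra.
- move=> x w vx vw x0 hP /=; congr (omk _ _ _); apply/funext => t.
  by rewrite /k; congr w; lra.
- move=> x w vx vw x0 hP /=; rewrite omk_some//; congr (Some (x, _)).
  by apply/funext => t; congr w; lra.
Qed.

Lemma close_unclose :
  hom (fun y => @omap epP lpP close (@omap lpP epP unclose y)) id.
Proof.
have [hr h0 h1] := rhoP.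
pose k (x : X) (w : pth X) : pth X := fun t => w (4 * t).
apply: (@hom_trans _ _ _ (@omap lpP lpP k)).
  (* Now the detour begins at the base point, follows the ray backwards only down to time [q], and
     returns. *)
  apply: (@hom_omap lpP lpP (fun q x w => pc (pc w (fun t => rho (Num.max (1 - t) q) x))
    (fun t => rho (Num.max t q) x))) => //.
  - move=> s q xn x wn w [hs q01 sn] x0 hx hw hP hPn.
    have vx := cv_val hx; have hxn := ev_and (cv_mem hx) (ev_gt (gu_cv hx) x0).
    apply: cv_pc; first apply: cv_pc => //.
    + by apply: (cv_ray (a := fun n t => Num.max (1 - t) (s n)) hx) => // *; rcvt.
    + by rewrite h1 ?(lp_ge1 hP)//; minmax; lra.
    + apply: ev_mp2 hPn (ev_and hxn sn) => n k1 [[k2 k3] k4].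
      by rewrite h1 ?(lp_ge1 k1)//; minmax; lra.
    + by apply: (cv_ray (a := fun n t => Num.max t (s n)) hx) => // *; rcvt.
    + rewrite /pc ifF; last by lra.
      by congr (rho _ x); minmax; lra.
    + apply: evT => n; rewrite /pc ifF; last by lra.
      by congr (rho _ (xn n)); minmax; lra.
  - move=> q x w q01 vx x0 hP t ht; rewrite /pc /=.
    have [h|h] : t <= 0 \/ 1 <= t by move: ht; lra.
      by rewrite !ifT ?(lp_le0 hP)//=; lra.
    by rewrite ifF ?h1//; minmax; lra.
  - move=> x w vx vw x0 hP; rewrite /omap; do ! rewrite omk_some//=.
    congr (Some (x, _)); apply/funext => t.
    rewrite /unclose /close /pc; case: ifPn => ht; [case: ifPn => // ht'|].
      case: (leP (1 - (2 * (2 * t) - 1)) 0) => // h.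
      by rewrite !h0//; lra.
    by congr (rho _ x); minmax; lra.
  - move=> x w vx vw x0 hP /=; congr (omk _ _ _); apply/funext => t.
    rewrite /k /pc; case: ifPn => ht; [case: ifPn => ht'|].
    + by congr w; lra.
    + by rewrite h1 ?(lp_ge1 hP)//; minmax; lra.
    + by rewrite h1 ?(lp_ge1 hP)//; minmax; lra.
apply: (@hom_omap lpP lpP (fun q x w t => w ((4 - 3 * q) * t))) => //.
- move=> s q xn x wn w [hs q01 sn] x0 hx hw hP hPn.
  by apply: (@cv_comp_pth X wn w (fun n t => (4 - 3 * s n) * t)) => // *; rcvt.
- move=> q x w q01 vx x0 hP t ht /=.
  have [h|h] : t <= 0 \/ 1 <= t by move: ht; lra.
    by apply: (lp_le0 hP); nra.
  by apply: (lp_ge1 hP); nra.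
- move=> x w vx vw x0 hP /=; congr (omk _ _ _); apply/funext => t.
  by rewrite /k; congr w; lra.
- move=> x w vx vw x0 hP /=; rewrite omk_some//; congr (Some (x, _)).
  by apply/funext => t; congr w; lra.
Qed.

Lemma heq_over : heq (over epP) (Half X (loops X)).
Proof.
apply: heq_trans heq_over_loops.
exists (@omap epP lpP close), (@omap lpP epP unclose).
by split; [exact: pmap_close|exact: pmap_unclose|exact: unclose_close|
  exact: close_unclose].
Qed.

End PathsOver.

Section SusPlus.
Context (Q : cs).

Definition tmk (s : RR) (q : Q) : Sus (Pls Q) := smk s (Some q : Pls Q).

Lemma susv_Some s (q : Q) : susv (s, Some q : Pls Q) = bump s.
Proof. by rewrite /susv /=; have := bump01 s; minmax; lra. Qed.

Lemma gu_tmk s q : gu (tmk s q) = bump s.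
Proof.
by rewrite /= /tmk /smk ou_mkq susv_Some //; have /andP[] := bump01 s.
Qed.

Lemma tmk_some s q : 0 < s < 1 -> tmk s q = Some (s, Some q).
Proof. by move=> h; apply: mkq_some; rewrite susv_Some bump_gt0. Qed.

Lemma tmk_none s q : ~~ (0 < s < 1) -> tmk s q = None.
Proof. by move=> h; apply: mkq_none; rewrite susv_Some bump_le0. Qed.

Lemma val_Pls (q : Q) : val q -> @val (Pls Q) (Some q).
Proof. by move=> h; apply/val_CQ; split=> //; exact: ltr01. Qed.

Lemma val_tmk s q : (0 < s < 1 -> val q) -> val (tmk s q).
Proof.
move=> h; apply/val_CQ; apply: oval_mkq; rewrite susv_Some bump_gt0 => /h vq.
by split; [exact: rcv_cst|exact: val_Pls].
Qed.

Lemma cv_tmk sn s (qn : nat -> Q) q : rcv sn s -> (0 < s < 1 -> cv qn q) ->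
  ev (fun n => 0 < sn n < 1 -> val (qn n)) ->
  cv (fun n => tmk (sn n) (qn n)) (tmk s q).
Proof.
move=> hs hq hv; apply: (cv_mkq (@susv01 (Pls Q)) (@susv_cv (Pls Q))).
- rewrite susv_Some; apply: rcv_tail (rcv_bump hs).
  by apply: evT => n; rewrite susv_Some.
- rewrite susv_Some bump_gt0 => h; split=> //; split=> /=; first exact: ltr01.
  by exists qn; [exact: hq|exact: evT].
- apply: ev_mp hv => n; rewrite susv_Some bump_gt0 => h /h vq.
  by split; [exact: rcv_cst|exact: val_Pls].
Qed.

Lemma val_SusPls s q : @val (Sus (Pls Q)) (Some (s, Some q)) -> 0 < s < 1 /\ val q.
Proof.
by move=> /val_CQ [[_ /val_CQ [h _]]]; rewrite susv_Some bump_gt0.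
Qed.

Lemma SusPls_cases (y : Sus (Pls Q)) : val y ->
  y = None \/ exists s q, [/\ y = Some (s, Some q), 0 < s < 1 & val q].
Proof.
case: y => [[s [q|]]|] vy; last by left.
  by right; exists s, q; have [] := val_SusPls vy.
exfalso; move: vy => /val_CQ [_]; rewrite /susv /=; have := bump01 s; minmax; lra.
Qed.

Lemma cts_SusPls (K Z : cs) (F : K -> RR -> Q -> Z) (z0 : Z) :
  (forall k p sn s (qn : nat -> Q) q, cv k p -> rcv sn s -> 0 < s < 1 ->
     cv qn q -> cv (fun n => F (k n) (sn n) (qn n)) (F p s q)) ->
  (forall k p (yn : nat -> Sus (Pls Q)), cv k p -> ev (fun n => val (yn n)) ->
     rcv (fun n => gu (yn n)) 0 ->
     cv (fun n => if yn n is Some (s, Some q) then F (k n) s q else z0) z0) ->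
  @cts (prod_cs K (Sus (Pls Q))) Z
    (fun z => if z.2 is Some (s, Some q) then F z.1 s q else z0).
Proof.
move=> h1 h2.
apply: (@cts_CQ _ _ (@susv01 (Pls Q)) (@susv_cv (Pls Q)) K Z
  (fun k y => if y is Some (s, Some q) then F k s q else z0)).
  move=> k p wn [s [q|]] hk; last by rewrite /susv /=; have := bump01 s; minmax; lra.
  rewrite susv_Some bump_gt0 => hs [/= hsn [_ [qn hq hqn]]].
  apply: cv_tail (h1 k p (fun n => (wn n).1) s qn q hk hsn hs hq).
  by apply: ev_mp hqn => n; case: (wn n) => a b /= ->.
move=> k p yn hk hv hu; apply: (h2 k p) => //.
by apply: ev_mp hv => n h; apply/val_CQ.
Qed.

End SusPlus.

Lemma base_le (M : gsp) (w : nat -> M) (b : nat -> RR) (c : RR) :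
  ev (fun n => val (w n) /\ gu (w n) <= c * b n) -> rcv b 0 -> cv w (pt M).
Proof.
move=> h hb; apply: gu_base; first by apply: ev_mp h => n [].
have hc : rcv (fun n => c * b n) 0 by rewrite -(mulr0 c); rcvt.
apply: rcv_le0 hc; apply: ev_mp h => n [_ ->].
by have /andP[->] := gu01 (w n).
Qed.

(** * Splitting the suspension of a loop space *)

Section SusLoops.
Context (X : gsp) (psi : RR -> X -> X) (psiP : wellp psi).

Let T1 := Sus (Pls (loops X)).
Let S1 := Sus (Pls unit_cs).
Let RX := over (@epP X).

Definition sig (s : RR) : S1 := @tmk unit_cs s tt.
Definition rmk (x : X) (w : pth X) : RX := omk (@epP X) x w.
Definition tl (s : RR) (q : pth X) : T1 := @tmk (loops X) s q.
Definition cstp : pth X := fun _ => pt X.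

Lemma val_cstp : @val (loops X) cstp.
Proof. by apply/val_sub; split=> //; apply: val_pth => t t0 _; exact: val_pt. Qed.

Lemma loops_val (q : loops X) : val q <-> @val (pth X) q /\ loopP q.
Proof. exact: val_sub. Qed.

Lemma cut_ep (q : pth X) r : (forall t, t <= 0 -> q t = pt X) ->
  (1 <= r -> forall t, 1 <= t -> q t = q r) -> epP (q r, cut q r).
Proof.
move=> h0 h1; split=> t ht; rewrite /cut /=; first by rewrite h0//; minmax; lra.
by case: (leP t r) => // tr; apply: h1 => //; lra.
Qed.

(** For [r] from 0 to 1 this is the map from the suspension of the loop space to paths modulo loops:
    at both ends the point [q r] is the base point. *)
Definition trace (r : RR) (q : pth X) : RX := rmk (q r) (cut q r).

Lemma cv_trace (r : nat -> RR) r0 (q : nat -> pth X) q0 : rcv r r0 -> cv q q0 ->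
  epP (q0 r0, cut q0 r0) -> ev (fun n => epP (q n (r n), cut (q n) (r n))) ->
  cv (fun n => trace (r n) (q n)) (trace r0 q0).
Proof.
move=> hr hq he hen; apply: cv_omk => //.
- exact: (cv_app hq hr).
- by move=> _; exact: cv_cut.
- apply: ev_mp2 hen (cv_mem hq) => n h1 h2 _; split=> //.
  by apply: (@cv_cut X (fun _ => q n) (q n) (fun _ => r n)) => //; exact: rcv_cst.
Qed.

Lemma val_trace r (q : pth X) : @val (pth X) q -> epP (q r, cut q r) ->
  val (trace r q).
Proof.
move=> vq he; apply: (@cv_trace (fun _ => r) r (fun _ => q) q) => //.
  exact: rcv_cst.
exact: evT.
Qed.

Lemma trace_none r (q : pth X) : q r = pt X -> trace r q = None.
Proof. by move=> h; rewrite /trace h /rmk omk_none0. Qed.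

Lemma loop_ep (q : pth X) r : loopP q -> epP (q r, cut q r).
Proof.
move=> h; apply: cut_ep; first by move=> t t0; apply: h; lra.
by move=> r1 t t1; rewrite !h//; lra.
Qed.

(** The coordinate goes round the circle for [s] up to 1/2 and traces the loop for [s] from 5/8 to
    7/8. The last margin is essential: near the base point, where the loop is uncontrolled, its
    trace is over. *)
Definition pinchF (s : RR) (q : pth X) : wdg S1 RX :=
  (sig (2 * s), trace (4 * s - 5 / 2) q).

Definition pinch (y : T1) : wdg S1 RX :=
  if y is Some (s, Some q) then pinchF s q else pt (wdg S1 RX).

Lemma sig_none s : ~~ (0 < s < 1) -> sig s = None.
Proof. exact: tmk_none. Qed.

Lemma pinchF_pred s (q : pth X) : loopP q -> wdg_pred (pinchF s q).
Proof.
move=> hq; have [h|h] := leP s 2^-1; [right|left].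
  by apply: trace_none; apply: hq; lra.
by apply: sig_none; lra.
Qed.

Lemma cv_sig s s0 : rcv s s0 -> cv (fun n => sig (s n)) (sig s0).
Proof. by move=> h; apply: cv_tmk => //; exact: evT. Qed.

Lemma cv_pinchF s s0 (q : nat -> loops X) q0 : rcv s s0 -> cv q q0 ->
  cv (fun n => pinchF (s n) (q n)) (pinchF s0 q0).
Proof.
move=> hs [hq hl hln]; split; [split|exact: pinchF_pred|] => /=.
- by apply: cv_sig; rcvt.
- apply: cv_trace => //; first by rcvt.
    exact: loop_ep.
  by apply: ev_mp hln => n; exact: loop_ep.
- by apply: ev_mp hln => n; exact: pinchF_pred.
Qed.

Lemma pmap_pinch : pmap pinch.
Proof.
split=> //; apply: cts_par0.
apply: (@cts_SusPls (loops X) Iv (wdg S1 RX) (fun _ => pinchF) (pt (wdg S1 RX))).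
  by move=> k p sn s qn q _ hs _ hq; exact: cv_pinchF.
move=> k p yn _ hv hu; apply: (@base_le (wdg S1 RX) _ _ 2 _ hu).
have h : (0 : RR) < 2^-1 by lra.
apply: ev_mp2 hv (ev_lt hu h) => n vy.
case: (SusPls_cases vy) => [->|[s [q [-> hs vq]]]].
  by move=> _; split; [exact: val_pt|rewrite gu_pt /= mulr0].
have -> : gu (Some (s, Some q) : T1) = bump s by rewrite -(gu_tmk s q) tmk_some.
have /loops_val [vq1 vq2] := vq; move=> hb.
have vp : val (pinchF s q).
  by apply: (@cv_pinchF (fun _ => s) s (fun _ => q)) => //; exact: rcv_cst.
split=> //.
have s01 : 0 <= s <= 1 by lra.
have -> : pinchF s q = win1 RX (sig (2 * s)).
  congr pair; apply: trace_none; apply: vq2.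
  by have [[? _]|[? _]] := bump_small s01 hb; lra.
rewrite [X in X <= _](_ : _ = bump (2 * s)); last first.
  rewrite /win1 /= /wdg_u /=; rewrite -[ou _ _]/(gu (sig (2 * s))) gu_tmk.
  by have := bump01 (2 * s); minmax; lra.
have [[h1 ->]|[h1 ->]] := bump_small s01 hb.
  by apply: bump_le_l; lra.
by apply: bump_le_r; lra.
Qed.

Definition inclS (y : S1) : T1 := if y is Some (s, Some _) then tl s cstp else None.

Lemma pmap_inclS : pmap inclS.
Proof.
split=> //; apply: cts_par0.
apply: (@cts_SusPls unit_cs Iv T1 (fun _ s _ => tl s cstp) None).
  move=> k p sn s qn q _ hs _ _; apply: cv_tmk => //; first by move=> _; exact: val_cstp.
  by apply: evT => n _; exact: val_cstp.
move=> k p yn _ hv hu; apply: (@base_le T1 _ _ 1 _ hu).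
apply: ev_mp hv => n vy; case: (SusPls_cases vy) => [->|[s [q [-> hs vq]]]].
  by split; [exact: (val_pt T1)|rewrite mulr0].
split; first by apply: val_tmk => _; exact: val_cstp.
by rewrite mul1r gu_tmk -(gu_tmk s q) tmk_some.
Qed.

Definition lasso (x : X) (w : pth X) : pth X := pc w (fun t => psi t x).

Lemma cv_psi t t0 x x0 : rcv t t0 -> cv x x0 ->
  cv (fun n => psi (t n) (x n)) (psi t0 x0).
Proof. exact: cts_psi. Qed.

Lemma cv_psi_pth x (x0 : X) : cv x x0 ->
  @cv (pth X) (fun n t => psi t (x n)) (fun t => psi t x0).
Proof.
move=> hx; apply: (@cv_pth X X (fun x t => psi t x)) => // v y t t0 hv ht.
exact: cv_psi.
Qed.

Lemma cv_lasso xn (x : X) (wn : nat -> pth X) w : cv xn x -> cv wn w ->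
  w 1 = x -> ev (fun n => wn n 1 = xn n) ->
  @cv (pth X) (fun n => lasso (xn n) (wn n)) (lasso x w).
Proof.
have [_ _ p0 _] := psiP.
move=> hx hw e en; apply: cv_pc => //; first exact: cv_psi_pth.
  by rewrite p0//; exact: (cv_val hx).
by apply: ev_mp2 en (cv_mem hx) => n -> vx; rewrite p0.
Qed.

Lemma loop_lasso (x : X) (w : pth X) : val x -> gu x < 1 ->
  (forall t, t <= 0 -> w t = pt X) -> loopP (lasso x w).
Proof.
have [_ _ _ p1] := psiP => vx hx h0 t ht.
have [h|h] : t <= 0 \/ 1 <= t by move: ht; lra.
  by rewrite /lasso /pc ifT ?h0//; lra.
by rewrite /lasso /pc ifF ?p1//; lra.
Qed.

(** The lasso closes up to a loop only if [gu x < 1], for only then does [psi] lead to the base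
    point. At gauge 1 the suspension coordinate [1 - gu x] is 0, so that this failure is collapsed;
    over the base point it is 1. *)
Definition lassoT (x : X) (w : pth X) : T1 := tl (1 - gu x) (lasso x w).

Definition lassoM (y : RX) : T1 := if y is Some (x, w) then lassoT x w else None.

Lemma val_lassoT x (w : pth X) : val x -> @val (pth X) w -> epP (x, w) ->
  val (lassoT x w).
Proof.
move=> vx vw he; apply: val_tmk => h; apply/loops_val; split.
  apply: (@cv_lasso (fun _ => x) x (fun _ => w)) => //; first exact: (ep_ge1 he).
  by apply: evT => _; exact: (ep_ge1 he).
by apply: loop_lasso => //; [lra|move=> t; exact: (ep_le0 he)].
Qed.

Lemma pmap_lassoM : pmap lassoM.
Proof.
split=> //; apply: cts_par0.
apply: (@cts_over X (@epP X) Iv T1 (fun _ => lassoT) None).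
  move=> k q xn x wn w _ x0 hx hw he hen.
  have hl : @cv (pth X) (fun n => lasso (xn n) (wn n)) (lasso x w).
    apply: cv_lasso => //; first exact: (ep_ge1 he).
    by apply: ev_mp hen => n h; exact: (ep_ge1 h).
  have hg := gu_cv hx.
  apply: cv_tmk.
  - by rcvt.
  - move=> h; have h1 : gu x < 1 by lra.
    split=> //.
      by apply: loop_lasso => //; [exact: cv_val hx|move=> t; exact: (ep_le0 he)].
    apply: ev_mp2 (ev_and (ev_lt hg h1) (cv_mem hx)) hen => n [k1 k2] k3.
    by apply: loop_lasso => // t; exact: (ep_le0 k3).
  - apply: ev_mp2 (ev_and (cv_mem hx) (cv_mem hl)) hen => n [k1 k2] k3 k4.
    apply/loops_val; split=> //.
    by apply: loop_lasso => //; [lra|move=> t; exact: (ep_le0 k3)].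
move=> k q xn wn _ hx hv.
have := gu_cv hx; rewrite gu_pt => hu; apply: (@base_le T1 _ _ 4 _ hu).
apply: ev_mp hv => n; case: ifPn => h.
  move=> /(_ isT) /val_over [h1 h2 h3 h4]; split; first exact: val_lassoT.
  by rewrite gu_tmk; apply: bump_le_r; rewrite /=; lra.
by move=> _; split; [exact: (val_pt T1)|have := gu01 (xn n); rewrite /=; lra].
Qed.

Definition unpinch : wdg S1 RX -> T1 := wfold inclS lassoM.

Lemma pmap_unpinch : pmap unpinch.
Proof. exact: (pmap_wfold pmap_inclS pmap_lassoM). Qed.

End SusLoops.

Section SusLoopsInverse.
Context (X : gsp) (psi : RR -> X -> X) (psiP : wellp psi).

Let T1 := Sus (Pls (loops X)).
Let S1 := Sus (Pls unit_cs).
Let RX := over (@epP X).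

Local Notation tl := (@tl X).
Local Notation cstp := (@cstp X).
Local Notation trace := (@trace X).
Local Notation pinch := (@pinch X).
Local Notation inclS := (@inclS X).
Local Notation lasso := (lasso psi).
Local Notation lassoT := (lassoT psi).
Local Notation lassoM := (lassoM psi).
Local Notation unpinch := (unpinch psi).

Lemma sig_hom : hom (fun y : S1 => if y is Some (s, Some _) then sig (2 * s) else None) id.
Proof.
exists (fun t y => if y is Some (s, Some _) then sig ((2 - t) * s) else None).
split.
- apply: (@cts_SusPls unit_cs Iv S1 (fun t s _ => sig ((2 - t) * s)) None).
    move=> k p sn s qn q [hk _ _] hs _ _; apply: cv_sig; rcvt.
  move=> k p yn [_ _ k01] hv hu; apply: (@base_le S1 _ _ 2 _ hu).
  have h : (0 : RR) < 2^-1 by lra.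
  apply: ev_mp2 (ev_and hv k01) (ev_lt hu h) => n [vy kn] hb.
  move: hb; case: (SusPls_cases vy) => [->|[s [q [-> hs vq]]]].
    by move=> _; split; [exact: (val_pt S1)|rewrite /= mulr0].
  have -> : gu (Some (s, Some q) : S1) = bump s by rewrite -(gu_tmk s q) tmk_some.
  move=> hb; split; first by apply: val_tmk.
  rewrite gu_tmk; have s01 : 0 <= s <= 1 by lra.
  have [[h1 ->]|[h1 ->]] := bump_small s01 hb.
    by apply: bump_le_l; nra.
  by apply: bump_le_r; nra.
- by move=> t x _ ->.
- move=> y vy; case: (SusPls_cases vy) => [->//|[s [q [-> hs vq]]]].
  by rewrite subr0.
- move=> y vy; case: (SusPls_cases vy) => [->//|[s [[] [-> hs vq]]]].
  rewrite (_ : (2 - 1) * s = s); last by lra.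
  exact: tmk_some.
Qed.

Lemma trace_ptE r : trace r cstp = None.
Proof. exact: trace_none. Qed.

Lemma pinch_tl s (q : loops X) : loopP q -> pinch (tl s q) = pinchF s q.
Proof.
move=> hq; have [hs|hs] := boolP (0 < s < 1); first by rewrite /tl tmk_some.
rewrite /tl tmk_none//; rewrite /pinchF sig_none; last by lra.
rewrite trace_none//; apply: hq; by lra.
Qed.

Lemma pinch_inclS : hom (fun y : S1 => pinch (inclS y)) (@win1 S1 RX).
Proof.
have := hom_comp (pmap_id S1) (pmap_win1 S1 RX) sig_hom.
move=> h; apply: rhom_ext h _ _ => //.
move=> y vy; case: (SusPls_cases vy) => [->//|[s [q [-> hs vq]]]] /=.
by rewrite pinch_tl// /pinchF trace_ptE.
Qed.

Lemma lasso_join (x : X) (w : pth X) : val x -> epP (x, w) ->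
  lasso x w 2^-1 = x.
Proof.
by move=> vx he; rewrite /lasso /pc lexx (ep_ge1 he)// mulfV ?pnatr_eq0.
Qed.

Lemma lasso_early (x : X) (w : pth X) t : epP (x, w) -> t <= 0 ->
  lasso x w t = pt X.
Proof. by move=> he h; rewrite /lasso /pc ifT ?(ep_le0 he)//; lra. Qed.

Lemma lasso_late (x : X) (w : pth X) t : val x -> gu x < 1 -> 1 <= t ->
  lasso x w t = pt X.
Proof.
by have [_ _ _ p1] := psiP => vx h ht; rewrite /lasso /pc ifF ?p1//; lra.
Qed.

Lemma lasso_psi (x : X) (w : pth X) t : val x -> epP (x, w) -> 2^-1 <= t ->
  lasso x w t = psi (2 * t - 1) x.
Proof.
have [_ _ p0 _] := psiP => vx he h; rewrite /lasso /pc; case: ifPn => // h'.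
have -> : t = 2^-1 by lra.
by rewrite mulfV ?pnatr_eq0// subrr p0// (ep_ge1 he).
Qed.

Lemma lasso_ep (x : X) (w : pth X) r : val x -> epP (x, w) ->
  (1 <= r -> gu x < 1) -> epP (lasso x w r, cut (lasso x w) r).
Proof.
move=> vx he hr; apply: cut_ep; first by move=> t; exact: lasso_early.
by move=> r1 t t1; rewrite !lasso_late//; exact: hr.
Qed.

Lemma cv_lassos xn (x : X) (wn : nat -> pth X) w : cv xn x -> cv wn w ->
  epP (x, w) -> ev (fun n => epP (xn n, wn n)) ->
  @cv (pth X) (fun n => lasso (xn n) (wn n)) (lasso x w).
Proof.
move=> hx hw he hen; apply: cv_lasso => //; first exact: (ep_ge1 he).
by apply: ev_mp hen => n h; exact: (ep_ge1 h).
Qed.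

Lemma val_lasso (x : X) (w : pth X) : val x -> @val (pth X) w -> epP (x, w) ->
  @val (pth X) (lasso x w).
Proof.
move=> vx vw he; apply: (@cv_lassos (fun _ => x) x (fun _ => w)) => //.
exact: evT.
Qed.

(** The second condition on [lv] stops the lasso before its end whenever it does not close up. By
    the third, near the base point the trace ends on the [psi] part of the lasso, hence at a point
    controlled by [x] and not by the path. *)
Lemma cts_lasso_trace (lv : RR -> RR -> RR) :
  (forall t u t0 u0, rcv t t0 -> rcv u u0 -> rcv (fun n => lv (t n) (u n)) (lv t0 u0)) ->
  (forall t u, 0 <= t <= 1 -> 0 <= u <= 1 -> 1 <= lv t u -> u < 1) ->
  (forall t u, 0 <= t <= 1 -> 0 <= u <= 4^-1 -> 2^-1 <= lv t u) ->
  @cts (prod_cs Iv RX) RX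
    (fun z => if z.2 is Some (x, w) then trace (lv z.1 (gu x)) (lasso x w) else None).
Proof.
move=> lc l1 l2.
apply: (@cts_over X (@epP X) Iv RX
   (fun t x w => trace (lv t (gu x)) (lasso x w)) None).
  move=> k q xn x wn w [hk q01 kn] x0 hx hw he hen; have hg := gu_cv hx.
  apply: cv_trace; [exact: lc|exact: cv_lassos| |].
    by apply: lasso_ep => //; [exact: (cv_val hx)|apply: l1 => //; exact: gu01].
  apply: ev_mp2 (ev_and hen kn) (cv_mem hx) => n [k1 k2] k3.
  by apply: lasso_ep => //; apply: l1 => //; exact: gu01.
move=> k q xn wn [hk q01 kn] hx hv.
have := gu_cv hx; rewrite gu_pt => hu.
have h4 : (0 : RR) < 4^-1 by lra.
have hl := lc _ _ _ _ hk hu.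
pose zn n := psi (2 * lv (k n) (gu (xn n)) - 1) (xn n).
have hz : cv zn (psi (2 * lv q 0 - 1) (pt X)).
  by apply: (cv_psi psiP) => //; rcvt.
have [_ pp _ _] := psiP; rewrite pp in hz.
have := gu_cv hz; rewrite gu_pt => hgz.
apply: (@base_le RX _ _ 1 _ hgz).
apply: ev_mp2 (ev_and (ev_and kn (ev_lt hu h4)) hv) (cv_mem hz) => n [[k1 k2] k3] k4.
case: ifPn => x0; last first.
  by split; [exact: (val_pt RX)|have := gu01 (zn n); rewrite /=; lra].
have [vx vw he _] := val_over (k3 x0).
have lh : 2^-1 <= lv (k n) (gu (xn n)) by apply: l2 => //; have := gu01 (xn n); lra.
split.
  apply: val_trace; first exact: val_lasso.
  by apply: lasso_ep => // _; lra.
by rewrite mul1r /trace /rmk gu_omk lasso_psi.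
Qed.

Lemma cts_sig_gauge (K : cs) (s : K -> RR -> RR) :
  (forall k q u u0, cv k q -> rcv u u0 -> rcv (fun n => s (k n) (u n)) (s q u0)) ->
  (forall q u, val q -> 0 <= u <= 2^-1 -> 1 <= s q u) ->
  @cts (prod_cs K RX) S1 (fun z =>
    if z.2 is Some (x, w) then sig (s z.1 (gu x)) else pt S1).
Proof.
move=> sc s1.
apply: (@cts_over X (@epP X) K S1 (fun q x w => sig (s q (gu x))) (pt S1)).
  move=> k q xn x wn w hk x0 hx _ _ _; apply: cv_sig; apply: sc => //.
  exact: (gu_cv hx).
move=> k q xn wn hk hx _; apply: cv_eqcst; first exact: val_pt.
have := gu_cv hx; rewrite gu_pt => hu.
have h : (0 : RR) < 2^-1 by lra.
apply: ev_mp2 (cv_mem hk) (ev_lt hu h) => n vk hn; case: ifP => // x0.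
apply: sig_none; have := s1 (k n) (gu (xn n)) vk.
by have := gu01 (xn n); rewrite /= in hn *; lra.
Qed.

Lemma cts_wpair (E : cs) (M N : gsp) (f : E -> M) (g : E -> N) :
  cts f -> cts g -> (forall x, val x -> f x = pt M \/ g x = pt N) ->
  @cts E (wdg M N) (fun x => (f x, g x)).
Proof.
move=> cf cg fg u x h; split; first by split; [exact: cf|exact: cg].
  by apply: fg; exact: cv_val h.
by apply: ev_mp (cv_mem h) => n; exact: fg.
Qed.

Definition wpair (M N : gsp) (a : M) (b : N) : wdg M N := (a, b).

Lemma cts_win2_over (K : cs) (s : K -> RR -> RR) (F : K -> X -> pth X -> RX) :
  @cts (prod_cs K RX) RX (fun z => if z.2 is Some (x, w) then F z.1 x w else pt RX) ->
  (forall k q u u0, cv k q -> rcv u u0 -> rcv (fun n => s (k n) (u n)) (s q u0)) ->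
  (forall q u, val q -> 0 <= u <= 2^-1 -> 1 <= s q u) ->
  (forall q x w, val q -> @val RX (Some (x, w)) -> s q (gu x) < 1 -> F q x w = pt RX) ->
  @cts (prod_cs K RX) (wdg S1 RX) (fun z =>
    if z.2 is Some (x, w) then wpair (sig (s z.1 (gu x))) (F z.1 x w)
    else pt (wdg S1 RX)).
Proof.
move=> cF sc s1 sF.
suff t1 (z : prod_cs K RX) : val z ->
    (if z.2 is Some (x, w) then sig (s z.1 (gu x)) else pt S1) = pt S1 \/
    (if z.2 is Some (x, w) then F z.1 x w else pt RX) = pt RX.
  by apply: cts_ext (cts_wpair (cts_sig_gauge sc s1) cF t1) => -[q [[x w]|]].
case: z => q [[x w]|]; last by left.
move=> [vq vy]; have [h|h] := ltP (s q (gu x)) 1; first by right; exact: sF.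
by left; apply: sig_none; rewrite [X in _ && X]ltNge h andbF.
Qed.

Lemma pinch_lassoM : hom (fun y : RX => pinch (lassoM y)) (@win2 S1 RX).
Proof.
(* [lv0] is [4 * (1 - u) - 5 / 2], the time at which [pinchF] traces the lasso over a point of gauge
   [u]. [lv1] moves it to 1/2, the joint of the lasso, where exactly the path [w] has been run. *)
pose lv0 (t u : RR) : RR := 3 / 2 - 4 * u.
pose lv1 (t u : RR) : RR := (1 - t) * (3 / 2 - 4 * u) + t * 2^-1.
have c0 := @cts_lasso_trace lv0; have c1 := @cts_lasso_trace lv1.
have {}c0 : @cts (prod_cs Iv RX) RX (fun z => if z.2 is Some (x, w) then
    trace (lv0 z.1 (gu x)) (lasso x w) else None).
  by apply: c0 => [t u t0 u0 ht hu|t u t01 u01|t u t01 u01]; rewrite /lv0;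
      [rcvt|lra|lra].
have {}c1 : @cts (prod_cs Iv RX) RX (fun z => if z.2 is Some (x, w) then
    trace (lv1 z.1 (gu x)) (lasso x w) else None).
  by apply: c1 => [t u t0 u0 ht hu|t u t01 u01|t u t01 u01]; rewrite /lv1;
      [rcvt|nra|nra].
pose G (y : RX) : wdg S1 RX := if y is Some (x, w) then
  win2 S1 (trace (lv0 0 (gu x)) (lasso x w)) else pt (wdg S1 RX).
apply: (@hom_trans _ _ _ G).
  (* The circle coordinate is pushed beyond 1. As long as it is below 1, the gauge of [x] exceeds
     1/2 and the traced time is negative, so the wedge is not left. *)
  pose H (t : RR) (y : RX) : wdg S1 RX := if y is Some (x, w) then
    wpair (sig (2 - 2 * gu x + 2 * t)) (trace (lv0 t (gu x)) (lasso x w))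
    else pt (wdg S1 RX).
  exists H; split.
  - apply: (@cts_win2_over Iv (fun t u => 2 - 2 * u + 2 * t)
      (fun t x w => trace (lv0 t (gu x)) (lasso x w)) c0).
    + by move=> k q u u0 [hk _ _] hu; rcvt.
    + by move=> q u /val_sub [_ q01] u01; lra.
    + move=> q x w /val_sub [_ q01] /val_over [vx vw he x0] h.
      by apply: trace_none; apply: lasso_early => //; rewrite /lv0; lra.
  - by move=> t x _ ->.
  - move=> [[x w]|] vy //=; have [vx vw he x0] := val_over vy.
    have [u1|u1] := ltP (gu x) 1.
      rewrite /lassoT pinch_tl; last by apply: loop_lasso => // t; exact: (ep_le0 he).
      rewrite /pinchF /wpair (_ : 2 - _ + _ = 2 * (1 - gu x)); last by lra.
      by rewrite (_ : lv0 0 _ = 4 * (1 - gu x) - 5 / 2)// /lv0; lra.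
    rewrite /lassoT /tl tmk_none; last by lra.
    rewrite /wpair sig_none; last by lra.
    by rewrite trace_none// lasso_early// /lv0; lra.
  - move=> [[x w]|] vy //=; rewrite /wpair sig_none//.
    by have := gu01 x; lra.
have h2 : hom (fun y : RX => if y is Some (x, w) then
    trace (lv0 0 (gu x)) (lasso x w) else None) id.
  apply: (@hom_trans _ _ _ (@omap X (@epP X) (@epP X) (fun x w t => w (2 * t)))).
    exists (fun t y => if y is Some (x, w) then trace (lv1 t (gu x)) (lasso x w) else None).
    split=> //.
    - by move=> t x _ ->.
    - move=> [[x w]|] // _.
      by rewrite (_ : lv1 0 (gu x) = lv0 0 (gu x))// /lv0 /lv1; lra.
    - move=> [[x w]|] // /val_over [vx vw he x0].
      rewrite /trace (_ : lv1 1 _ = 2^-1); last by rewrite /lv1; lra.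
      rewrite lasso_join//=; congr (omk _ _ _); apply/funext => t.
      rewrite /cut /lasso /pc ifT; last by minmax; lra.
      case: (leP t 2^-1) => // h; rewrite !(ep_ge1 he)//; lra.
  apply: (@hom_omap X (@epP X) (@epP X) (fun q x w t => w ((2 - q) * t))) => //.
  - move=> s q xn x wn w [hs q01 sn] x0 hx hw hP hPn.
    by apply: (@cv_comp_pth X wn w (fun n t => (2 - s n) * t)) => // *; rcvt.
  - move=> q x w q01 vx x0 hP; split=> t ht /=.
      by apply: (ep_le0 hP); nra.
    by apply: (ep_ge1 hP); nra.
  - by move=> x w vx vw x0 hP /=; rewrite subr0.
  - move=> x w vx vw x0 hP /=; rewrite omk_some//; congr (Some (x, _)).
    by apply/funext => t; congr w; lra.
have := hom_comp (pmap_id RX) (pmap_win2 S1 RX) h2.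
by move=> h; apply: rhom_ext h _ _ => // -[[x w]|].
Qed.

Lemma pinch_unpinch : hom (fun y => pinch (unpinch y)) id.
Proof.
apply: rhom_ext (hom_wfold pinch_inclS pinch_lassoM) _ _ => -[a b] h.
  by rewrite /unpinch /wfold /=; case: ifP.
have /val_wdg [va vb hab] := h.
rewrite /wfold /=; case: eqP => hb.
  by rewrite /win1 -(gu_eq0 vb hb).
case: hab => e; first by rewrite /win2; congr pair; exact: esym e.
by case: hb; rewrite (e : b = pt RX).
Qed.

End SusLoopsInverse.

Section SusLoopsEquivalence.
Context (X : gsp) (psi : RR -> X -> X) (psiP : wellp psi).

Let T1 := Sus (Pls (loops X)).
Let S1 := Sus (Pls unit_cs).
Let RX := over (@epP X).

Local Notation tl := (@tl X).
Local Notation cstp := (@cstp X).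
Local Notation trace := (@trace X).
Local Notation pinch := (@pinch X).
Local Notation inclS := (@inclS X).
Local Notation lasso := (lasso psi).
Local Notation unpinch := (unpinch psi).

(** Continuity of [F] is asked only for converging loops; near the base point, where loops are
    arbitrary, the bound on the gauge takes over. *)
Lemma hom_SusLoops (F : RR -> RR -> pth X -> T1) (f g : T1 -> T1) (c : RR) :
  (forall k q sn s (qn : nat -> pth X) p, @cv Iv k q -> rcv sn s -> 0 < s < 1 ->
     @cv (loops X) qn p -> cv (fun n => F (k n) (sn n) (qn n)) (F q s p)) ->
  (forall t s q, 0 <= t <= 1 -> 0 < s < 1 -> bump s < 2^-1 -> loopP q ->
     gu (F t s q) <= c * bump s) ->
  f None = None -> g None = None ->
  (forall s q, 0 < s < 1 -> @val (loops X) q -> F 0 s q = f (Some (s, Some q))) ->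
  (forall s q, 0 < s < 1 -> @val (loops X) q -> F 1 s q = g (Some (s, Some q))) ->
  hom f g.
Proof.
move=> h1 h2 f0 g0 hf hg.
exists (fun t y => if y is Some (s, Some q) then F t s q else None); split.
- apply: (@cts_SusPls (loops X) Iv T1 F None).
    by move=> k p sn s qn q hk hs s01 hq; exact: h1.
  move=> k p yn [_ _ k01] hv hu; apply: (@base_le T1 _ _ c _ hu).
  have h : (0 : RR) < 2^-1 by lra.
  apply: ev_mp2 (ev_and hv k01) (ev_lt hu h) => n [vy kn].
  case: (SusPls_cases vy) => [->|[s [q [-> hs vq]]]].
    by move=> _; split; [exact: (val_pt T1)|rewrite /= mulr0].
  have -> : gu (Some (s, Some q) : T1) = bump s by rewrite -(gu_tmk s q) tmk_some.
  move=> hb; split; last by apply: h2 => //; have /loops_val [] := vq.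
  apply: (h1 (fun _ => k n) _ (fun _ => s) _ (fun _ => q)) => //.
    exact: val_Iv.
  exact: rcv_cst.
- by move=> t x _ ->.
- by move=> y vy; case: (SusPls_cases vy) => [->|[s [q [-> hs vq]]]] //; rewrite hf.
- by move=> y vy; case: (SusPls_cases vy) => [->|[s [q [-> hs vq]]]] //; rewrite hg.
Qed.

(** At [t = 0] this is [lassoT] applied to the trace in [pinchF]. At [t = 1] the term
    [bump (2 * s - 1)] is 1 for [s] from 5/8 to 7/8 and collapses everything there; elsewhere the
    loop is not yet begun or already complete. *)
Definition half_turn (t s : RR) (q : pth X) : T1 :=
  let r := 4 * s - 5 / 2 in
  tl (1 - Num.max (gu (q r)) (t * bump (2 * s - 1))) (lasso (q r) (cut q r)).

Lemma cv_half_turn k q sn s (qn : nat -> pth X) p : @cv Iv k q -> rcv sn s ->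
  @cv (loops X) qn p -> cv (fun n => half_turn (k n) (sn n) (qn n)) (half_turn q s p).
Proof.
move=> [hk k01 kn] hs [hq lq ln].
have hr : rcv (fun n => 4 * sn n - 5 / 2) (4 * s - 5 / 2) by rcvt.
have hx := cv_app hq hr; have hg := gu_cv hx.
have hb : rcv (fun n => bump (2 * sn n - 1)) (bump (2 * s - 1)).
  by apply: rcv_bump; rcvt.
have hl : @cv (pth X) (fun n => lasso (qn n (4 * sn n - 5 / 2))
    (cut (qn n) (4 * sn n - 5 / 2))) (lasso (p (4 * s - 5 / 2)) (cut p (4 * s - 5 / 2))).
  apply: (cv_lassos psiP) => //; [exact: cv_cut|exact: loop_ep|].
  by apply: ev_mp ln => n; exact: loop_ep.
have ll (x : pth X) r m : loopP x -> val (x r) -> 0 < 1 - Num.max (gu (x r)) m ->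
    loopP (lasso (x r) (cut x r)).
  move=> lx vx hm; apply: (loop_lasso psiP) => //; first by move: hm; minmax; lra.
  by move=> t; exact: (ep_le0 (loop_ep r lx)).
apply: cv_tmk.
- by rcvt.
- move=> h; have /andP[h1 _] := h; split=> //; first exact: (ll p _ _ lq (cv_val hx) h1).
  have hm : rcv (fun n => 1 - Num.max (gu (qn n (4 * sn n - 5 / 2)))
      (k n * bump (2 * sn n - 1)))
    (1 - Num.max (gu (p (4 * s - 5 / 2))) (q * bump (2 * s - 1))) by rcvt.
  apply: ev_mp2 (ev_gt hm h1) (ev_and (cv_mem hx) ln) => n h2 [h3 h4].
  exact: (ll (qn n) _ _ h4 h3 h2).
- apply: ev_mp2 (ev_and (cv_mem hx) ln) (cv_mem hl) => n [h1 h2] h3 h4.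
  apply/loops_val; split=> //.
  by have /andP[h5 _] := h4; exact: (ll (qn n) _ _ h2 h1 h5).
Qed.

Lemma bump0 : bump 0 = 0.
Proof. by rewrite /bump /cl; minmax; lra. Qed.

Lemma tl_none s q : ~~ (0 < s < 1) -> tl s q = None.
Proof. exact: tmk_none. Qed.

Lemma half_turn_start t s (q : pth X) : loopP q -> s <= 2^-1 -> s >= 0 ->
  bump (2 * s - 1) <= 0 -> half_turn t s q = None.
Proof.
move=> lq hs s0 hb; apply: tl_none; rewrite (lq (4 * s - 5 / 2)); last by lra.
rewrite gu_pt (_ : bump _ = 0); last by have := bump01 (2 * s - 1); lra.
by rewrite mulr0; minmax; lra.
Qed.

(** The constant loop goes up by [2 * s] until 1/2 and down by [5 - 8 * s] until 5/8; from 7/8 on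
    the whole loop is suspended. Increasing [t] cancels the first part. Between 5/8 and 7/8 both
    branches are trivial, so the switch at 3/4 is harmless. *)
Definition midF (t s : RR) (q : pth X) : T1 :=
  if s <= 3 / 4 then tl ((1 - t) * Num.min (2 * s) (5 - 8 * s)) cstp
  else tl (8 * s - 7) (fun r => q (2 * r)).

Definition midM (y : T1) : T1 := if y is Some (s, Some q) then midF 0 s q else None.

Lemma lasso_pt (w : RR -> X) t : lasso (pt X) w t =
  if t <= 2^-1 then w (2 * t) else pt X.
Proof. by have [_ pp _ _] := psiP; rewrite /lasso /pc pp. Qed.

Lemma unpinch_pinchF s (q : pth X) : loopP q -> 0 < s < 1 ->
  unpinch (pinchF s q) =
  if s <= 2^-1 then tl (2 * s) cstp else half_turn 0 s q.
Proof.
move=> lq s01; rewrite /pinchF /unpinch; case: ifPn => hs.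
  rewrite trace_none; last by apply: lq; lra.
  rewrite /wfold /= eqxx; have [h|h] := boolP (0 < 2 * s < 1).
    by rewrite /sig tmk_some.
  by rewrite sig_none ?tl_none.
rewrite sig_none; last by lra.
rewrite /half_turn mul0r; set r := 4 * s - 5 / 2.
have g01 := gu01 (q r).
rewrite (_ : Num.max (gu (q r)) 0 = gu (q r)); last by minmax; lra.
rewrite /wfold /trace /rmk /=; have [g0|g0] := ltP 0 (gu (q r)).
  rewrite (omk_some _ _ g0) /=.
  by rewrite (_ : (overv _ == 0) = false)//; apply/negbTE; rewrite gt_eqF.
rewrite omk_none /=; last by lra.
by rewrite eqxx tl_none//; lra.
Qed.

Lemma half_turn_mid s (q : pth X) : loopP q -> 2^-1 < s < 1 ->
  half_turn 1 s q = midF 0 s q.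
Proof.
move=> lq s01; rewrite /half_turn /midF mul1r subr0 mul1r.
have g01 := gu01 (q (4 * s - 5 / 2)).
have [h1|h1] := leP s (5 / 8).
  rewrite ifT; last by lra.
  rewrite lq ?gu_pt; last by lra.
  have -> : bump (2 * s - 1) = 4 * (2 * s - 1) by rewrite /bump /cl; minmax; lra.
  congr (tl _ _); first by minmax; lra.
  apply/funext => t; rewrite lasso_pt /cut; case: ifP => // _.
  by apply: lq; minmax; lra.
have [h2|h2] := ltP s (7 / 8).
  rewrite bump_mid; last by lra.
  rewrite tl_none; last by minmax; lra.
  by case: ifP => h3; rewrite tl_none//; minmax; lra.
rewrite ifF; last by lra.
rewrite lq ?gu_pt; last by lra.
have -> : bump (2 * s - 1) = 8 * (1 - s) by rewrite /bump min_r ?cl_id; lra.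
congr (tl _ _); first by minmax; lra.
apply/funext => t; rewrite lasso_pt /cut; case: ifPn => h3.
  by congr q; minmax; lra.
by rewrite lq//; lra.
Qed.

Lemma turn_mid : hom (fun y : T1 => unpinch (pinch y)) midM.
Proof.
apply: (@hom_SusLoops (fun t s q => if s <= 2^-1 then tl (2 * s) cstp
  else half_turn t s q) _ _ 8) => //.
- move=> k q sn s qn p hk hs s01 hq; apply: cv_if => //.
  + move=> _; apply: cv_tmk; first by rcvt.
      by move=> _; exact: val_cstp.
    by apply: evT => n _; exact: val_cstp.
  + by move=> _; exact: cv_half_turn.
  + move=> e; rewrite tl_none; last by lra.
    rewrite half_turn_start//; try lra; first by case: hq.
    by rewrite e mulfV ?pnatr_eq0// subrr bump0.
- move=> t s q t01 s01 hb lq; have s01' : 0 <= s <= 1 by lra.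
  have [[h1 e]|[h1 e]] := bump_small s01' hb.
    rewrite ifT; last by lra.
    by rewrite gu_tmk e; apply: bump_le_l; lra.
  rewrite ifF; last by lra.
  rewrite gu_tmk e; apply: bump_le_r; last by lra.
  rewrite lq; last by lra.
  have -> : bump (2 * s - 1) = 8 * (1 - s) by rewrite /bump min_r ?cl_id; lra.
  by rewrite gu_pt; minmax; nra.
- by rewrite /unpinch /wfold /= eqxx.
- by move=> s q s01 /loops_val [_ lq] /=; rewrite unpinch_pinchF.
- move=> s q s01 /loops_val [_ lq] /=; case: ifPn => hs; last first.
    by rewrite half_turn_mid//; lra.
  rewrite /midF ifT; last by lra.
  by congr (tl _ _); minmax; lra.
Qed.

Lemma turn_end : hom midM id.
Proof.
apply: (@hom_trans _ _ _ (fun y : T1 => if y is Some (s, Some q) then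
    midF 1 s q else None)).
  apply: (@hom_SusLoops midF _ _ 8) => //.
  - move=> k q sn s qn p [hk k01 kn] hs s01 [hq lq ln]; apply: cv_if => //.
    + move=> _; apply: cv_tmk; first by rcvt.
        by move=> _; exact: val_cstp.
      by apply: evT => n _; exact: val_cstp.
    + move=> _.
      have h2 : @cv (loops X) (fun n r => qn n (2 * r)) (fun r => p (2 * r)).
        split.
        * by apply: (@cv_comp_pth X qn p (fun n r => 2 * r)) => // *; rcvt.
        * by move=> r hr; apply: lq; lra.
        * by apply: ev_mp ln => n l r hr; apply: l; lra.
      apply: cv_tmk; first by rcvt.
        by [].
      by apply: ev_mp (cv_mem h2) => n.
    + by move=> ->; rewrite !tl_none//; minmax; nra.
  - move=> t s q t01 s01 hb lq; have s01' : 0 <= s <= 1 by lra.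
    rewrite /midF; have [[h1 e]|[h1 e]] := bump_small s01' hb.
      rewrite ifT; last by lra.
      rewrite gu_tmk e (_ : Num.min _ _ = 2 * s); last by minmax; lra.
      by apply: bump_le_l; nra.
    rewrite ifF; last by lra.
    by rewrite gu_tmk e; apply: bump_le_r; lra.
apply: (@hom_SusLoops (fun t s q => tl ((1 - t) * (8 * s - 7) + t * s)
  (fun r => q ((2 - t) * r))) _ _ 8) => //.
- move=> k q sn s qn p [hk k01 kn] hs s01 [hq lq ln].
  have h2 : @cv (loops X) (fun n r => qn n ((2 - k n) * r)) (fun r => p ((2 - q) * r)).
    split.
    + by apply: (@cv_comp_pth X qn p (fun n r => (2 - k n) * r)) => // *; rcvt.
    + move=> r hr; apply: lq.
      have [h|h] : r <= 0 \/ 1 <= r by move: hr; lra.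
        by nra.
      by nra.
    + apply: ev_mp2 kn ln => n k1 l r hr; apply: l.
      have [h|h] : r <= 0 \/ 1 <= r by move: hr; lra.
        by nra.
      by nra.
  by apply: cv_tmk; [rcvt|by []|apply: ev_mp (cv_mem h2)].
- move=> t s q t01 s01 hb lq; have s01' : 0 <= s <= 1 by lra.
  rewrite gu_tmk; have [[h1 e]|[h1 e]] := bump_small s01' hb.
    by rewrite e; apply: bump_le_l; nra.
  by rewrite e; apply: bump_le_r; nra.
- move=> s q s01 /loops_val [_ lq] /=; rewrite !subr0 mul0r addr0 mul1r /midF.
  case: ifP => // h; rewrite !tl_none//; lra.
- move=> s q s01 vq /=.
  have -> : (1 - 1) * (8 * s - 7) + 1 * s = s by lra.
  have -> : (fun r => q ((2 - 1) * r)) = q by apply/funext => r; congr q; lra.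
  exact: (@tmk_some (loops X) s q s01).
Qed.

Lemma unpinch_pinch : hom (fun y : T1 => unpinch (pinch y)) id.
Proof. exact: hom_trans turn_mid turn_end. Qed.

Lemma heq_SusLoops : heq T1 (wdg S1 RX).
Proof.
exists pinch, unpinch; split; [exact: pmap_pinch|exact: pmap_unpinch psiP| |].
- exact: unpinch_pinch.
- exact: pinch_unpinch psiP.
Qed.

Context (rho : RR -> X -> X) (rhoP : rayed rho).

Lemma SusLoops_split :
  heq (Sus (Pls (loops X))) (wdg (Sus (Pls unit_cs)) (Half X (loops X))).
Proof.
apply: heq_trans heq_SusLoops _; apply: heq_wdg; [exact: heq_refl|].
exact: heq_over rhoP.
Qed.

End SusLoopsEquivalence.

(** * Wedges of suspensions *)

(** Preserving the gauge gives continuity at the base point for free. *)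
Lemma pmap_gauge (M N : gsp) (f : M -> N) : f (pt M) = pt N ->
  (forall x, val x -> val (f x)) -> (forall x, val x -> gu (f x) = gu x) ->
  (forall u x, cv u x -> x <> pt M -> cv (fun n => f (u n)) (f x)) -> pmap f.
Proof.
move=> f0 fv fg fc; split=> // u x h; have [e|/fc] := pselect (x = pt M); last exact.
rewrite e f0; apply: gu_base; first by apply: ev_mp (cv_mem h) => n; exact: fv.
have := gu_cv h; rewrite e gu_pt; apply: rcv_tail.
by apply: ev_mp (cv_mem h) => n /fg ->.
Qed.

Section HalfMap.
Context (Q : cs).

Definition hmk2 (M : gsp) (m : M) (q : Q) : Half M Q := mkq (@halfv M Q) (m, q).

Lemma val_Half (M : gsp) (m : M) (q : Q) :
  @val (Half M Q) (Some (m, q)) <-> [/\ val m, val q & 0 < gu m].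
Proof.
split=> [/val_CQ [[h1 h2] h3]|[h1 h2 h3]]; first by [].
by apply/val_CQ; split=> //; split.
Qed.

Lemma hmk2_none (M : gsp) (q : Q) : hmk2 (pt M) q = None.
Proof. by apply: mkq_none; rewrite /halfv /= gu_pt. Qed.

Lemma hmk2_some (M : gsp) (m : M) (q : Q) : 0 < gu m -> hmk2 m q = Some (m, q).
Proof. exact: (@mkq_some _ (@halfv M Q) (m, q)). Qed.

Definition hmap (M N : gsp) (h : M -> N) (y : Half M Q) : Half N Q :=
  if y is Some (m, q) then hmk2 (h m) q else None.

Lemma pmap_hmap (M N : gsp) (h : M -> N) : pmap h -> pmap (hmap h).
Proof.
move=> [ch h0]; split=> //; apply: cts_par0.
apply: (@cts_CQ _ _ (@halfv01 M Q) (@halfv_cv M Q) Iv (Half N Q) (fun _ => hmap h)).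
  move=> _ _ w [m q] _ m0 [/= hm hq].
  have hn := ch _ _ hm.
  apply: (@cv_tail (Half N Q) (fun n => hmk2 (h (w n).1) (w n).2)).
    by apply: evT => n; case: (w n).
  apply: (cv_mkq (@halfv01 N Q) (@halfv_cv N Q)) => //.
    exact: (gu_cv hn).
  by apply: ev_mp2 (cv_mem hn) (cv_mem hq).
move=> _ _ w _ hv hu.
pose m n : M := if w n is Some (x, _) then x else pt M.
have hm : cv m (pt M).
  apply: gu_base.
    by apply: ev_mp hv => n; rewrite /m; case: (w n) => [[x q]|] /=;
      [case=> -[]|move=> _; exact: val_pt].
  apply: rcv_tail hu; apply: evT => n; rewrite /m; case: (w n) => [[x q]|] //=.
  by rewrite gu_pt.
have hn := ch _ _ hm; have := gu_cv hn; rewrite h0 gu_pt => hg.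
apply: (@gu_base (Half N Q)).
  apply: ev_mp2 hv (cv_mem hn) => n; rewrite /m; case: (w n) => [[x q]|] /=.
    by move=> [[v1 v2] _] v3; apply/val_CQ; apply: oval_mkq.
  by move=> _ _; exact: (val_pt (Half N Q)).
apply: rcv_tail hg; apply: evT => n; rewrite /m; case: (w n) => [[x q]|] /=.
  by rewrite ou_mkq//; have /andP[] := gu01 (h x).
by rewrite h0 gu_pt.
Qed.

Lemma heq_Half_wdg (M N : gsp) :
  heq (Half (wdg M N) Q) (wdg (Half M Q) (Half N Q)).
Proof.
have pf1 := pmap_hmap (pmap_wdg1 M N); have pf2 := pmap_hmap (pmap_wdg2 M N).
have pg := pmap_wfold (pmap_hmap (pmap_win1 M N)) (pmap_hmap (pmap_win2 M N)).
have pf : @pmap (Half (wdg M N) Q) (wdg (Half M Q) (Half N Q))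
    (fun y => (hmap (fun p : wdg M N => p.1) y, hmap (fun p : wdg M N => p.2) y)).
  split=> //; apply: cts_wpair; [by case: pf1|by case: pf2|].
  move=> [[[m n] q]|]; last by left.
  move=> /val_Half [/val_wdg [_ _ [/= ->|/= ->]] _ _].
    by left; exact: hmk2_none.
  by right; exact: hmk2_none.
apply: (heq_iso pf pg).
- move=> [[[m n] q]|] vy; last by rewrite /wfold /= eqxx.
  have /val_Half [/val_wdg [/= v1 v2 h] vq] := vy.
  rewrite /= /wdg_u /= => g0; have h1 := gu01 m; have h2 := gu01 n.
  case: h => /= e; rewrite e gu_pt in g0 *; rewrite ?e hmk2_none /wfold /=.
  + have n0 : 0 < gu n by move: g0; minmax; lra.
    rewrite (hmk2_some _ n0) /= ifF; last by apply/negbTE; rewrite gt_eqF.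
    by rewrite hmk2_some// /= /wdg_u /= gu_pt; move: g0; minmax; lra.
  + have m0 : 0 < gu m by move: g0; minmax; lra.
    rewrite eqxx (hmk2_some _ m0) /=.
    by rewrite hmk2_some// /= /wdg_u /= gu_pt; move: g0; minmax; lra.
- move=> [a b] /val_wdg [/= va vb h]; rewrite /wfold /=; case: eqP => eb.
    have b0 : b = None := @gu_eq0 (Half N Q) b vb eb; rewrite b0.
    case: a va {h} => [[m q]|] // /val_Half [vm vq m0] /=.
    rewrite hmk2_some /=; last by rewrite /wdg_u /= gu_pt; minmax; lra.
    by rewrite hmk2_some// hmk2_none.
  have a0 : a = None by case: h => //= e; case: eb; rewrite e.
  rewrite a0; case: b vb eb {h} => [[m q]|] // /val_Half [vm vq m0] _ /=.
  rewrite hmk2_some /=; last by rewrite /wdg_u /= gu_pt; minmax; lra.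
  by rewrite hmk2_none hmk2_some.
Qed.

Lemma heq_trivial (M N : gsp) : (forall x : M, val x -> x = pt M) ->
  (forall x : N, val x -> x = pt N) -> heq M N.
Proof.
move=> hM hN; apply: (heq_iso (pmap_cst M N) (pmap_cst N M)) => x vx.
  by rewrite (hM x vx).
by rewrite (hN x vx).
Qed.

Lemma heq_Half_Pt : heq (Half Pt Q) Pt.
Proof.
apply: heq_trivial => [[[m q]|]|[]] // /val_Half [_ _]; by rewrite /= ltxx.
Qed.

Lemma heq_Half_Pls : heq (Half (Pls unit_cs) Q) (Pls Q).
Proof.
have vP (q : Q) : val q -> @val (Half (Pls unit_cs) Q) (Some (Some tt, q)).
  by move=> vq; apply/val_Half; split=> //=; exact: val_Pls.
have pf : @pmap (Half (Pls unit_cs) Q) (Pls Q)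
    (fun y => if y is Some (Some _, q) then Some q else None).
  apply: pmap_gauge => //.
  + move=> [[[[]|] q]|] //; last by move=> _; exact: (val_pt (Pls Q)).
    by move=> /val_Half [_ vq _]; exact: val_Pls.
  + by move=> [[[[]|] q]|].
  + move=> u [[[[]|] q]|] // [x0 [z [hz1 hz2] hz]] _; last by rewrite /= ltxx in x0.
    split; first exact: ltr01.
    exists (fun n => (z n).2) => //; have [_ [t _ ht]] := hz1.
    apply: ev_mp2 hz ht => n -> /=; by case: (z n) => a b /= ->.
have pg : @pmap (Pls Q) (Half (Pls unit_cs) Q)
    (fun y => if y is Some q then Some (Some tt, q) else None).
  apply: pmap_gauge => //.
  + move=> [q|]; last by move=> _; exact: (val_pt (Half (Pls unit_cs) Q)).
    by move=> /val_CQ [vq _]; exact: vP.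
  + by move=> [q|].
  + move=> u [q|] // [x0 [z hz1 hz]] _.
    split; first exact: ltr01.
    exists (fun n => (Some tt, z n)); last by apply: ev_mp hz => n ->.
    by split=> //; exact: (@val_Pls unit_cs tt).
apply: (heq_iso pf pg).
  by move=> [[[[]|] q]|] // /val_Half [_ _]; rewrite /= ltxx.
by move=> [q|].
Qed.

Lemma heq_Half_Sus (M : gsp) : heq (Half (Sus M) Q) (Sus (Half M Q)).
Proof.
have vS s (m : M) : @val (Sus M) (Some (s, m)) <-> val m /\ 0 < susv (s, m).
  split=> [/val_CQ [[_ h1] h2]//|[h1 h2]]; apply/val_CQ; split=> //.
  by split=> //; exact: rcv_cst.
have vSH s (m : M) q : @val (Sus (Half M Q)) (Some (s, Some (m, q))) <->
    [/\ val m, val q & 0 < susv (s, m)].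
  split=> [/val_CQ [[_ /val_Half [h1 h2 h3]] h4]//|[h1 h2 h3]]; apply/val_CQ.
  by split=> //; split; [exact: rcv_cst|apply/val_Half; have [] := susv_gt0 h3].
have pf : @pmap (Half (Sus M) Q) (Sus (Half M Q))
    (fun y => if y is Some (Some (s, m), q) then Some (s, Some (m, q)) else None).
  apply: pmap_gauge => //.
  + move=> [[[[s m]|] q]|]; try by move=> _; exact: (val_pt (Sus (Half M Q))).
    by move=> /val_Half [/vS [h1 h2] h3 h4]; apply/vSH.
  + by move=> [[[[s m]|] q]|].
  + move=> u [[[[s m]|] q]|] // [x0 [z [hz1 hz2] hz]] _; last by rewrite /= ltxx in x0.
    have [x1 [t [ht1 ht2] ht]] := hz1; split=> //.
    exists (fun n => ((t n).1, Some ((t n).2, (z n).2))).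
      split=> //=; split; first by have [] := susv_gt0 x1.
      exists (fun n => ((t n).2, (z n).2)); [by split|exact: evT].
    apply: ev_mp2 hz ht => n ->; case: (z n) => a b /= ->.
    by case: (t n).
have pg : @pmap (Sus (Half M Q)) (Half (Sus M) Q)
    (fun y => if y is Some (s, Some (m, q)) then Some (Some (s, m), q) else None).
  apply: pmap_gauge => //.
  + move=> [[s [[m q]|]]|]; try by move=> _; exact: (val_pt (Half (Sus M) Q)).
    by move=> /vSH [h1 h2 h3]; apply/val_Half; split=> //; apply/vS.
  + move=> [[s [[m q]|]]|] //.
    move=> /val_CQ [_]; rewrite /susv /=.
    by have := bump01 s; minmax; lra.
  + move=> u [[s [[m q]|]]|] // [x0 [z [hz1 hz2] hz]] _; last first.
      by move: x0; rewrite /susv /=; have := bump01 s; minmax; lra.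
    have [x1 [t [ht1 ht2] ht]] := hz2; split=> //.
    exists (fun n => (Some ((z n).1, (t n).1), (t n).2)).
      split=> //=; split; first by [].
      exists (fun n => ((z n).1, (t n).1)); [by split|exact: evT].
    apply: ev_mp2 hz ht => n ->; case: (z n) => a b /= ->.
    by case: (t n).
apply: (heq_iso pf pg).
  by move=> [[[[s m]|] q]|] // /val_Half [_ _]; rewrite /= ltxx.
move=> [[s [[m q]|]]|] //.
move=> /val_CQ [_ h]; exfalso; move: h; rewrite /susv /=.
by have := bump01 s; minmax; lra.
Qed.

End HalfMap.

Lemma val_Sus (M : gsp) s (m : M) :
  @val (Sus M) (Some (s, m)) <-> val m /\ 0 < susv (s, m).
Proof.
split=> [/val_CQ [[_ h1] h2]//|[h1 h2]]; apply/val_CQ; split=> //.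
by split=> //; exact: rcv_cst.
Qed.

Lemma smk_none (M : gsp) s : smk s (pt M) = None.
Proof.
by apply: mkq_none; rewrite /susv /= gu_pt; have := bump01 s; minmax; lra.
Qed.

Lemma smk_none2 (M : gsp) s (m : M) : susv (s, m) <= 0 -> smk s m = None.
Proof. exact: mkq_none. Qed.

Lemma smk_some (M : gsp) s (m : M) : 0 < susv (s, m) -> smk s m = Some (s, m).
Proof. exact: mkq_some. Qed.

Lemma susv_win1 (M N : gsp) s (x : M) :
  susv (s, (x, pt N) : wdg M N) = susv (s, x).
Proof.
rewrite /susv; congr (Num.min _ _); change (Num.max (gu x) (gu (pt N)) = gu x).
by rewrite gu_pt; apply/max_idPl; case/andP: (gu01 x).
Qed.

Lemma susv_win2 (M N : gsp) s (y : N) :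
  susv (s, (pt M, y) : wdg M N) = susv (s, y).
Proof.
rewrite /susv; congr (Num.min _ _); change (Num.max (gu (pt M)) (gu y) = gu y).
by rewrite gu_pt; apply/max_idPr; case/andP: (gu01 y).
Qed.

Lemma heq_Sus_wdg (M N : gsp) : heq (Sus (wdg M N)) (wdg (Sus M) (Sus N)).
Proof.
have pf1 := pmap_smap (pmap_wdg1 M N); have pf2 := pmap_smap (pmap_wdg2 M N).
have pg := pmap_wfold (pmap_smap (pmap_win1 M N)) (pmap_smap (pmap_win2 M N)).
have pf : @pmap (Sus (wdg M N)) (wdg (Sus M) (Sus N))
    (fun y => (smap (fun p : wdg M N => p.1) y, smap (fun p : wdg M N => p.2) y)).
  split=> //; apply: cts_wpair; [by case: pf1|by case: pf2|].
  move=> [[s [m n]]|]; last by left.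
  move=> /val_Sus [/val_wdg [_ _ [/= ->|/= ->]] _].
    by left; exact: smk_none.
  by right; exact: smk_none.
apply: (heq_iso pf pg).
- move=> [[s [m n]]|] vy; last by rewrite /wfold /= eqxx.
  have /val_Sus [/val_wdg [/= v1 v2 h]] := vy.
  move=> s0; case: h => /= e; rewrite e in s0 *; rewrite ?e smk_none /wfold /=.
  + have n0 : 0 < susv (s, n) by rewrite -(susv_win2 M).
    rewrite (smk_some n0) /= ifF; last by apply/negbTE; rewrite gt_eqF.
    by rewrite smk_some.
  + have m0 : 0 < susv (s, m) by rewrite -(susv_win1 N).
    by rewrite eqxx (smk_some m0) /= smk_some.
- move=> [a b] /val_wdg [/= va vb h]; rewrite /wfold /=; case: eqP => eb.
    have b0 : b = None := @gu_eq0 (Sus N) b vb eb; rewrite b0.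
    case: a va {h} => [[s m]|] // /val_Sus [vm m0] /=.
    rewrite smk_some /=; first by rewrite smk_some// smk_none.
    by rewrite susv_win1.
  have a0 : a = None by case: h => //= e; case: eb; rewrite e.
  rewrite a0; case: b vb eb {h} => [[s m]|] // /val_Sus [vm m0] _ /=.
  rewrite smk_some /=; first by rewrite smk_none smk_some.
  by rewrite susv_win2.
Qed.

Lemma heq_Sus_Pt : heq (Sus Pt) Pt.
Proof.
apply: heq_trivial => [[[s m]|]|[]] // /val_Sus [_ h]; exfalso.
by move: h; rewrite /susv /=; have := bump01 s; minmax; lra.
Qed.

Lemma heq_wdg_Pt (M : gsp) : heq (wdg Pt M) M.
Proof.
apply: (heq_iso (pmap_wdg2 Pt M) (pmap_win2 Pt M)) => //.
by move=> [[] m].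
Qed.

(** The sphere of dimension [d] when [Q] is a point; the [d]-fold suspension of a loop space, with
    the extra sphere from the disjoint point, when [Q] is [loops X]. *)
Definition Sn (Q : cs) (d : nat) : gsp := iter d Sus (Pls Q).

Definition bw (Q : cs) (l : seq nat) : gsp :=
  foldr (fun d M => wdg (Sn Q d) M) Pt l.

Lemma heq_Half_Sn Q d : heq (Half (Sn unit_cs d) Q) (Sn Q d).
Proof.
elim: d => [|d IH]; first exact: heq_Half_Pls.
exact: heq_trans (heq_Half_Sus _ _) (heq_Sus IH).
Qed.

Lemma heq_Half_bw Q l : heq (Half (bw unit_cs l) Q) (bw Q l).
Proof.
elim: l => [|d l IH]; first exact: heq_Half_Pt.
exact: heq_trans (heq_Half_wdg _ _ _) (heq_wdg (heq_Half_Sn _ _) IH).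
Qed.

Lemma heq_iter_Sus k (M N : gsp) : heq M N -> heq (iter k Sus M) (iter k Sus N).
Proof. by elim: k => //= k IH h; apply: heq_Sus; exact: IH. Qed.

Lemma heq_iter_Sus_wdg k (M N : gsp) :
  heq (iter k Sus (wdg M N)) (wdg (iter k Sus M) (iter k Sus N)).
Proof.
elim: k => [|k IH] /=; first exact: heq_refl.
exact: heq_trans (heq_Sus IH) (heq_Sus_wdg _ _).
Qed.

Lemma heq_iter_Sus_Pt k : heq (iter k Sus Pt) Pt.
Proof.
elim: k => [|k IH]; first exact: heq_refl.
exact: heq_trans (heq_Sus IH) heq_Sus_Pt.
Qed.

Lemma heq_iter_Sus_bw Q k l :
  heq (iter k Sus (bw Q l)) (bw Q [seq (k + d)%N | d <- l]).
Proof.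
elim: l => [|d l IH]; first exact: heq_iter_Sus_Pt.
apply: heq_trans (heq_iter_Sus_wdg k (Sn Q d) (bw Q l)) _.
have h : heq (iter k Sus (Sn Q d)) (Sn Q (k + d)) by rewrite /Sn iterD; exact: heq_refl.
exact: heq_wdg h IH.
Qed.

Lemma heq_bw_cat Q l1 l2 : heq (bw Q (l1 ++ l2)) (wdg (bw Q l1) (bw Q l2)).
Proof.
elim: l1 => [|d l1 IH] /=; first exact/heq_sym/heq_wdg_Pt.
apply: heq_trans (heq_wdg (heq_refl _) IH) _.
exact: heq_wdgA.
Qed.

Lemma heq_bw_catC Q l1 l2 : heq (bw Q (l1 ++ l2)) (bw Q (l2 ++ l1)).
Proof.
apply: heq_trans (heq_bw_cat _ _ _) _.
apply: heq_trans (heq_wdgC _ _) _.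
exact/heq_sym/heq_bw_cat.
Qed.

Lemma heq_bw_pull Q l1 d l2 :
  heq (bw Q (l1 ++ d :: l2)) (bw Q (d :: l1 ++ l2)).
Proof.
apply: heq_trans (heq_bw_catC _ _ _) _ => /=; apply: heq_wdg; [exact: heq_refl|].
exact: heq_bw_catC.
Qed.

(** * Contractions near the base point, and rays, in wedges of spheres *)

Definition is_wellp (M : gsp) : Prop := exists psi, @wellp M psi.
Definition is_rayed (M : gsp) : Prop := exists rho, @rayed M rho.

Lemma wellp_Pls Q : is_wellp (Pls Q).
Proof.
exists (fun _ y => y); split=> //.
- by move=> u x [].
- move=> y t vy hy _; apply: gu_eq0 => //.
  by move: hy; case: (y) => [e|] //=; rewrite ltxx.
Qed.

Lemma wellp_Pt : is_wellp Pt.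
Proof. by exists (fun _ y => y); split; [by move=> u x []|by []|by []|by case]. Qed.

Lemma wellp_wdg (M N : gsp) : is_wellp M -> is_wellp N -> is_wellp (wdg M N).
Proof.
move=> [p [p1 p2 p3 p4]] [q [q1 q2 q3 q4]].
exists (fun t => wmap (p t) (q t)); split.
- by apply: cts_wmap.
- by move=> t; rewrite /wmap /= p2 q2.
- by move=> [a b] /val_wdg [/= va vb _]; rewrite /wmap /= p3 ?q3.
- move=> [a b] t /val_wdg [/= va vb _] h t1; rewrite /wmap /=.
  by rewrite p4 ?q4//; move: h; rewrite /= /wdg_u /=; minmax; lra.
Qed.

Lemma cts_shift (P : cs) (M : gsp) (s : P -> RR -> RR) :
  (forall p q u u0, cv p q -> rcv u u0 -> rcv (fun n => s (p n) (u n)) (s q u0)) ->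
  (forall p u, val p -> 0 < u < 1 -> bump (s p u) <= bump u) ->
  @cts (prod_cs P (Sus M)) (Sus M)
    (fun z => if z.2 is Some e then smk (s z.1 e.1) e.2 else None).
Proof.
move=> sc sb; apply: (@cts_CQ _ _ (@susv01 M) (@susv_cv M) P (Sus M)
   (fun p y => if y is Some e then smk (s p e.1) e.2 else None)).
  move=> p q w e hp ve [h1 h2] /=; have hs := sc _ _ _ _ hp h1.
  apply: (cv_mkq (@susv01 M) (@susv_cv M)).
  - by apply: (@susv_cv M (fun n => _)); split.
  - by move=> _; split.
  - by apply: ev_mp (cv_mem h2) => n vn _; split=> //; exact: rcv_cst.
move=> p q w hp hv hu; apply: (@gu_base (Sus M)).
  apply: ev_mp hv => n; case: (w n) => [[r m]|] /=.
    by move=> [[_ vm] _]; apply/val_CQ; apply: oval_mkq => _; split=> //; exact: rcv_cst.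
  by move=> _; exact: (val_pt (Sus M)).
apply: rcv_le0 hu; apply: ev_mp2 hv (cv_mem hp) => n + vp.
case: (w n) => [[r m]|] /=; last by rewrite lexx.
move=> [_ /susv_gt0 [r01 m0]].
rewrite ou_mkq; last by have /andP[] := susv01 (s (p n) r, m).
have /andP[-> _] := susv01 (s (p n) r, m).
by have := sb _ _ vp r01; rewrite /susv /=; minmax; lra.
Qed.

Lemma wellp_Sus (M : gsp) : is_wellp M -> is_wellp (Sus M).
Proof.
move=> [p [p1 p2 p3 p4]].
(* At [t >= 1] this is [2 * s - 1 / 2], which throws the outer quarters, where [bump s < 1], out of
   the open interval. *)
pose st (t s : RR) := (1 + cl t) * s - cl t / 2.
pose sh (t : RR) (y : Sus M) : Sus M := if y is Some e then smk (st t e.1) e.2 else None.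
have ch : @cts (prod_cs Rl (Sus M)) (Sus M) (fun z => sh z.1 z.2).
  apply: (@cts_shift Rl M st).
    by move=> t q u u0 ht hu; rewrite /st; rcvt.
  move=> t s _ s01; rewrite /st; have c01 := cl01 t; have [h|h] := leP s 2^-1.
    rewrite {2}/bump (_ : Num.min _ _ = 4 * s); last by minmax; lra.
    have -> : cl (4 * s) = Num.min 1 (4 * s) by rewrite /cl; minmax; lra.
    have := bump01 ((1 + cl t) * s - cl t / 2); rewrite le_min => /andP[_ ->] /=.
    by apply: bump_le_l; nra.
  rewrite {2}/bump (_ : Num.min _ _ = 4 * (1 - s)); last by minmax; lra.
  have -> : cl (4 * (1 - s)) = Num.min 1 (4 * (1 - s)) by rewrite /cl; minmax; lra.
  have := bump01 ((1 + cl t) * s - cl t / 2); rewrite le_min => /andP[_ ->] /=.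
  by apply: bump_le_r; nra.
exists (fun t y => sh t (smap (p t) y)); split.
- move=> u x [h1 h2].
  have h3 : cv (fun n => smap (p (u n).1) (u n).2) (smap (p x.1) x.2).
    exact: (@cts_smap Rl M M p p1 (fun t _ => p2 t) u x).
  exact: (ch (fun n => ((u n).1, smap (p (u n).1) (u n).2)) (x.1, smap (p x.1) x.2)).
- by [].
- move=> [[s m]|] // vy; have /val_Sus [vm s0] := vy.
  have e : smap (p 0) (Some (s, m) : Sus M) = Some (s, m).
    by rewrite /= p3// smk_some.
  rewrite e /sh /= /st cl_le0// addr0 mul1r mul0r subr0.
  exact: smk_some.
- move=> [[s m]|] // t vy; have /val_Sus [vm s0] := vy.
  rewrite /= /susv /= => h t1.
  have [hm|hm] := ltP (gu m) 1; first by rewrite p4// smk_none.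
  have [h0|h0] := ltP 0 (susv (s, p t m)); last by rewrite (smk_none2 h0).
  rewrite (smk_some h0) /sh; apply: smk_none2.
  have hb : bump s < 1 by move: h; minmax; lra.
  rewrite /susv /= /st cl_ge1// (_ : bump _ = 0).
    by have := gu01 (p t m); minmax; lra.
  have [/susv_gt0 [s01 _]] := s0.
  apply/eqP; rewrite eq_le; have /andP[-> _] := bump01 ((1 + 1) * s - 1 / 2).
  rewrite andbT; apply: bump_le0; have [h1|h1] := boolP (4^-1 <= s <= 1 - 4^-1).
    by rewrite bump_mid in hb => //; lra.
  lra.
Qed.

Lemma wellp_bw Q l : is_wellp (bw Q l).
Proof.
elim: l => [|d l IH] /=; first exact: wellp_Pt.
apply: wellp_wdg => //; elim: d => [|d IHd]; first exact: wellp_Pls.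
exact: wellp_Sus.
Qed.

Lemma rayed_Pt : is_rayed Pt.
Proof.
by exists (fun _ y => y); split=> [t t0 x x0 _ _|x t _|x t _] /=; rewrite ltxx.
Qed.

(** Shrinking the suspension coordinate to 0 leads every point to the base point. *)
Lemma rayed_Sus (M : gsp) : is_rayed (Sus M).
Proof.
exists (fun t y => if y is Some e then smk ((1 - cl t) * e.1) e.2 else None).
split.
- move=> t t0 u [[s m]|] ht; last by move=> _; rewrite /= ltxx.
  move=> [x0 [z [/= hz1 hz2] hz]] _.
  apply: (@cv_tail (Sus M) (fun n => smk ((1 - cl (t n)) * (z n).1) (z n).2)).
    by apply: ev_mp hz => n ->.
  have hs : rcv (fun n => (1 - cl (t n)) * (z n).1) ((1 - cl t0) * s) by rcvt.
  apply: (cv_mkq (@susv01 M) (@susv_cv M)).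
  + by apply: (@susv_cv M (fun n => _)); split.
  + by move=> _; split.
  + by apply: ev_mp (cv_mem hz2) => n vn _; split=> //; exact: rcv_cst.
- move=> [[s m]|] // t /val_Sus [_ s0] _ t0 /=.
  by rewrite cl_le0// subr0 mul1r smk_some.
- move=> [[s m]|] // t /val_Sus [_ s0] _ t0 /=.
  rewrite cl_ge1// subrr mul0r; apply: smk_none2; rewrite /susv /= bump0.
  by have := gu01 m; minmax; lra.
Qed.

Lemma rayed_wdg (M N : gsp) : is_rayed M -> is_rayed N -> is_rayed (wdg M N).
Proof.
move=> [p [p1 p2 p3]] [q [q1 q2 q3]].
(* Rays are arbitrary at the base point, so they are made constant there in order to stay in the
   wedge. *)
pose f (K : gsp) (r : RR -> K -> K) t x := if gu x == 0 then pt K else r t x.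
have fz (K : gsp) (r : RR -> K -> K) t x : gu x = 0 -> f K r t x = pt K.
  by rewrite /f => ->; rewrite eqxx.
have fnz (K : gsp) (r : RR -> K -> K) t x : 0 < gu x -> f K r t x = r t x.
  by rewrite /f => h; rewrite gt_eqF.
exists (fun t x => (f M p t x.1, f N q t x.2)); split.
- move=> t t0 u [a b] ht [[/= ha hb] hab hn].
  have [ga gb] := (gu01 a, gu01 b).
  rewrite /= /wdg_u /= => h0; case: hab => /= e.
    have b0 : 0 < gu b by move: h0; rewrite e gu_pt; minmax; lra.
    have hz : ev (fun n => gu (u n).1 = 0 /\ 0 < gu (u n).2).
      apply: ev_mp2 hn (ev_gt (gu_cv hb) b0) => n [->|k] k'; first by rewrite gu_pt.
      by move: k'; rewrite /= k gu_pt ltxx.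
    split; [split| |] => /=.
    + rewrite e fz ?gu_pt//; apply: cv_eqcst; first exact: val_pt.
      by apply: ev_mp hz => n [k _]; rewrite fz.
    + rewrite fnz//; apply: cv_tail (q1 _ _ _ _ ht hb b0).
      by apply: ev_mp hz => n [_ k]; rewrite fnz.
    + by left; rewrite /= e fz ?gu_pt.
    + by apply: ev_mp hz => n [k _]; left; rewrite /= fz.
  have a0 : 0 < gu a by move: h0; rewrite e gu_pt; minmax; lra.
  have hz : ev (fun n => gu (u n).2 = 0 /\ 0 < gu (u n).1).
    apply: ev_mp2 hn (ev_gt (gu_cv ha) a0) => n [k|->] k'; last by rewrite gu_pt.
    by move: k'; rewrite /= k gu_pt ltxx.
  split; [split| |] => /=.
  + rewrite fnz//; apply: cv_tail (p1 _ _ _ _ ht ha a0).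
    by apply: ev_mp hz => n [_ k]; rewrite fnz.
  + rewrite e fz ?gu_pt//; apply: cv_eqcst; first exact: val_pt.
    by apply: ev_mp hz => n [k _]; rewrite fz.
  + by right; rewrite /= e fz ?gu_pt.
  + by apply: ev_mp hz => n [k _]; right; rewrite /= fz.
- move=> [a b] t /val_wdg [/= va vb h] _ t0; rewrite /f.
  congr pair; case: eqP => k; first by rewrite (gu_eq0 va k).
  + by rewrite p2// lt_neqAle eq_sym; case/andP: (gu01 a) => -> _; rewrite andbT; apply/eqP.
  + by rewrite (gu_eq0 vb k).
  + by rewrite q2// lt_neqAle eq_sym; case/andP: (gu01 b) => -> _; rewrite andbT; apply/eqP.
- move=> [a b] t /val_wdg [/= va vb h] _ t0; rewrite /f.
  congr pair; case: eqP => k //.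
  + by rewrite p3// lt_neqAle eq_sym; case/andP: (gu01 a) => -> _; rewrite andbT; apply/eqP.
  + by rewrite q3// lt_neqAle eq_sym; case/andP: (gu01 b) => -> _; rewrite andbT; apply/eqP.
Qed.

Lemma rayed_bw Q l : all (fun d => 0 < d)%N l -> is_rayed (bw Q l).
Proof.
elim: l => [|d l IH] /=; first by move=> _; exact: rayed_Pt.
move=> /andP[d0 hl]; apply: rayed_wdg; last exact: IH.
by case: d d0 => // d _; exact: rayed_Sus.
Qed.

(** The splitting of SLX, suspended [k] times: the half-smash product of a sphere of dimension [d]
    in the wedge with its loop space is again a suspension of the loop space, which allows the
    splitting to be repeated. *)
Lemma Sn_loops_split e k : all (fun d => 0 < d)%N e ->
  heq (Sn (loops (bw unit_cs e)) k.+1)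
      (wdg (Sn unit_cs k.+1) (bw (loops (bw unit_cs e)) [seq (k + d)%N | d <- e])).
Proof.
move=> he; have [psi psiP] := wellp_bw unit_cs e.
have [rho rhoP] := rayed_bw unit_cs he.
have h := SusLoops_split psiP rhoP.
rewrite /Sn !iterSr; apply: heq_trans (heq_iter_Sus k h) _.
apply: heq_trans (heq_iter_Sus_wdg _ _ _) _; apply: heq_wdg; first exact: heq_refl.
apply: heq_trans (heq_iter_Sus k (heq_Half_bw _ _)) _.
exact: heq_iter_Sus_bw.
Qed.

(** * Maps of low-dimensional cubes into high suspensions *)

Section BolzanoWeierstrass.
Import numFieldNormedType.Exports.

Lemma cube_cluster (R : realType) (n : nat) (s : nat -> 'rV[R]_n) :
  (forall k i, 0 <= s k ord0 i <= 1) ->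
  exists c : 'rV[R]_n, forall r N, 0 < r ->
    exists k, (N <= k)%N /\ forall i, `|s k ord0 i - c ord0 i| < r.
Proof.
move=> hs.
have hc : compact [set v : 'rV[R]_n | forall i, `[0, 1]%classic (v ord0 i)].
  by apply: (@rV_compact R n (fun _ => `[0, 1]%classic)) => i; exact: segment_compact.
have [|c [_ hcl]] := hc (s @ \oo) _.
  by exists 0%N => // k _ /= i; rewrite in_itv /=; exact: hs.
exists c => r N r0.
have [||x [[k Nk <-] hb]] := hcl [set s k | k in [set k | (N <= k)%N]] (ball c r).
- by exists N => // k /= Nk; exists k.
- exact: nbhsx_ballx.
exists k; split=> // i; have [_ hb'] := hb.
by have := hb' ord0 i; rewrite /ball /= distrC.
Qed.

End BolzanoWeierstrass.

Definition d1 (n : nat) (s t : 'rV[RR]_n) : RR := \sum_i `|s ord0 i - t ord0 i|.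

Lemma d1_ge0 n (s t : 'rV[RR]_n) : 0 <= d1 s t.
Proof. by apply: sumr_ge0. Qed.

Lemma d1C n (s t : 'rV[RR]_n) : d1 s t = d1 t s.
Proof. by apply: eq_bigr => i _; rewrite distrC. Qed.

Lemma d1_tri n (s t r : 'rV[RR]_n) : d1 s r <= d1 s t + d1 t r.
Proof. by rewrite -big_split; apply: ler_sum => i _; exact: ler_distD. Qed.

Lemma le_d1 n (s t : 'rV[RR]_n) i : `|s ord0 i - t ord0 i| <= d1 s t.
Proof.
rewrite /d1 (bigD1 i) //= lerDl; exact: sumr_ge0.
Qed.

Lemma harmonic_small (e : RR) : 0 < e -> exists N : nat, N.+1%:R^-1 < e.
Proof.
move=> e0; exists (Num.bound e^-1); rewrite invf_plt ?posrE//.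
have h : 0 <= e^-1 by rewrite invr_ge0 ltW.
apply: lt_trans (archi_boundP h) _; by rewrite ltr_nat.
Qed.

Lemma harmonic_le (N k : nat) : (N <= k)%N -> (k.+1%:R^-1 : RR) <= N.+1%:R^-1.
Proof. by move=> h; rewrite lef_pV2 ?posrE// ler_nat. Qed.

Lemma cv_d1 n (s : nat -> vec n) (c : vec n) :
  (forall k, d1 (s k) c < k.+1%:R^-1) -> cv s c.
Proof.
move=> h i e e0; have [N hN] := harmonic_small e0; exists N => k Nk.
apply: le_lt_trans (le_d1 _ _ i) _; apply: lt_le_trans (h k) _.
exact: le_trans (harmonic_le Nk) (ltW hN).
Qed.

Lemma cts_d1 n (F : 'rV[RR]_n -> RR) c e : @cts (vec n) Rl F -> 0 < e ->
  exists2 r, 0 < r & forall s, d1 s c < r -> `|F s - F c| < e.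
Proof.
move=> cF e0; apply: contrapT => h.
have /choice [s hs] : forall k : nat, exists s : 'rV[RR]_n,
    d1 s c < k.+1%:R^-1 /\ e <= `|F s - F c|.
  move=> k; apply: contrapT => h2; apply: h.
  exists k.+1%:R^-1; first by rewrite invr_gt0.
  move=> s sr; rewrite ltNge; apply/negP => h3; apply: h2; by exists s.
have /cF/(_ e e0) [N hN] : cv (s : nat -> vec n) c.
  by apply: cv_d1 => k; have [] := hs k.
have := hN N (leqnn N); have [_] := hs N; by rewrite leNgt => /negP.
Qed.

Definition cube_cl n (t : 'rV[RR]_n) : 'rV[RR]_n := \row_i cl (t ord0 i).

Lemma cl_dist x y : `|cl x - cl y| <= `|x - y|.
Proof.
have := ler_norm (x - y); have := ler_norm (y - x); rewrite (distrC y x).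
move: `|x - y| => z h1 h2; rewrite ler_norml /cl; apply/andP.
by split; minmax; lra.
Qed.

Lemma d1_cl n (s t : 'rV[RR]_n) : d1 (cube_cl s) (cube_cl t) <= d1 s t.
Proof. by apply: ler_sum => i _; rewrite !mxE; exact: cl_dist. Qed.

Lemma cl_out (x : RR) : ~~ (0 < x < 1) -> ~~ (0 < cl x < 1).
Proof. by rewrite /cl; minmax; lra. Qed.

Lemma cl_in (x : RR) : 0 < x < 1 -> cl x = x.
Proof. by rewrite /cl; minmax; lra. Qed.

Lemma bd_cl n (t : 'rV[RR]_n) : bd t -> bd (cube_cl t).
Proof. by move=> [i h]; exists i; rewrite mxE; exact: cl_out. Qed.

Lemma nbd_cl n (t : 'rV[RR]_n) : ~ bd t -> cube_cl t = t.
Proof.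
move=> h; apply/rowP => i; rewrite mxE cl_in//; apply: contrapT => h'.
by apply: h; exists i; apply/negP.
Qed.

Lemma unif_d1 n (F : 'rV[RR]_n -> RR) e : @cts (vec n) Rl F ->
  (forall t, bd t -> F t = 0) -> 0 < e ->
  exists2 r, 0 < r & forall s t, d1 s t < r -> `|F s - F t| < e.
Proof.
move=> cF F0 e0; apply: contrapT => h.
have Fcl t : F (cube_cl t) = F t.
  have [b|/nbd_cl ->//] := pselect (bd t).
  by rewrite !F0//; exact: bd_cl.
have /choice [st hs] : forall k : nat, exists st : 'rV[RR]_n * 'rV[RR]_n,
    d1 st.1 st.2 < k.+1%:R^-1 /\ e <= `|F st.1 - F st.2|.
  move=> k; apply: contrapT => h2; apply: h.
  exists k.+1%:R^-1; first by rewrite invr_gt0.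
  move=> s t sr; rewrite ltNge; apply/negP => h3; apply: h2; by exists (s, t).
have [|c hc] := @cube_cluster RR n (fun k => cube_cl (st k).1).
  by move=> k i; rewrite mxE; exact: cl01.
have e2 : 0 < e / 2 by lra.
have [r r0 hr] := cts_d1 c cF e2.
have r2 : 0 < r / 2 by lra.
have [N hN] := harmonic_small r2.
have rn : 0 < r / 2 / n.+1%:R by rewrite divr_gt0.
have [k [Nk hk]] := hc _ N rn.
have h1 : d1 (cube_cl (st k).1) c < r / 2.
  have : d1 (cube_cl (st k).1) c <= \sum_(i < n) (r / 2 / n.+1%:R).
    by apply: ler_sum => i _; exact/ltW/hk.
  move=> /le_lt_trans; apply; rewrite sumr_const card_ord -[X in X < _]mulr_natr.
  by rewrite mulrAC ltr_pdivrMr// ltr_pM2l// ltr_nat.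
have h2 : d1 (cube_cl (st k).2) c < r.
  apply: le_lt_trans (d1_tri _ (cube_cl (st k).1) _) _.
  have := d1_cl (st k).2 (st k).1; rewrite (d1C (st k).2).
  have [h3 _] := hs k; have := harmonic_le Nk.
  move=> h4 h5; rewrite [r]splitr; apply: ltrD => //.
  exact: le_lt_trans h5 (lt_trans (lt_le_trans h3 h4) hN).
have h1' : d1 (cube_cl (st k).1) c < r by lra.
have := hr _ h1'; have := hr _ h2; rewrite !Fcl; have [_] := hs k.
rewrite !ltr_norml => + /andP[h3 h4] /andP[h5 h6].
by rewrite leNgt => /negP; apply; rewrite ltr_norml; lra.
Qed.

Lemma lipschitz_approx n (F : 'rV[RR]_n -> RR) e : @cts (vec n) Rl F ->
  (forall t, bd t -> F t = 0) -> (forall t, 0 <= F t <= 1) -> 0 < e ->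
  exists K0 : nat, forall K : nat, (K0 <= K)%N -> exists G : 'rV[RR]_n -> RR,
    (forall s t, `|G s - G t| <= K%:R * d1 s t) /\ (forall t, `|G t - F t| <= e).
Proof.
move=> cF F0 F01 e0; have [r r0 hr] := unif_d1 cF F0 e0.
have [K0 hK0] := harmonic_small r0; exists K0.+1 => K hK.
pose A (t : 'rV[RR]_n) := [set F s + K%:R * d1 s t | s in [set: 'rV[RR]_n]].
have Alb t : lbound (A t) 0.
  move=> _ [s _ <-]; have /andP[h _] := F01 s.
  by apply: addr_ge0 => //; apply: mulr_ge0 => //; exact: d1_ge0.
have Ainf t s : inf (A t) <= F s + K%:R * d1 s t.
  by apply: ge_inf; [exists 0; exact: Alb|exists s].
have Age t m : (forall s, m <= F s + K%:R * d1 s t) -> m <= inf (A t).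
  move=> h; apply: lb_le_inf; first by exists (F t + K%:R * d1 t t); exists t.
  by move=> _ [s _ <-].
have d0 t : d1 t t = 0.
  by rewrite /d1 big1// => i _; rewrite subrr normr0.
have K0' : (0 : RR) <= K%:R by exact: ler0n.
have lip s t : inf (A s) <= inf (A t) + K%:R * d1 s t.
  rewrite -lerBlDr; apply: Age => q; rewrite lerBlDr.
  apply: le_trans (Ainf s q) _; rewrite -addrA lerD2l -mulrDr.
  by apply: ler_wpM2l => //; rewrite (d1C s t); exact: d1_tri.
exists (fun t => inf (A t)); split.
  move=> s t; rewrite ler_norml; have := lip s t; have := lip t s.
  by rewrite (d1C t s); lra.
move=> t; have := Ainf t t; rewrite d0 mulr0 addr0 => h.
suff : F t - e <= inf (A t) by rewrite ler_norml; lra.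
apply: Age => s; have [h1|h1] := ltP (d1 s t) r.
  have := hr _ _ h1; rewrite ltr_norml => /andP[h2 _].
  have : 0 <= K%:R * d1 s t by apply: mulr_ge0 => //; exact: d1_ge0.
  by lra.
have : 1 <= K%:R * d1 s t.
  have h2 : K0.+1%:R <= K%:R :> RR by rewrite ler_nat.
  have h3 : 1 <= K0.+1%:R * r by rewrite mulrC -ler_pdivrMr// mul1r ltW.
  apply: le_trans h3 _; apply: ler_pM => //; first exact: ltW.
by have := F01 s; have := F01 t; lra.
Qed.

Lemma grid_cell (N : nat) (x : RR) : (0 < N)%N -> 0 <= x <= 1 ->
  exists k : 'I_N, k%:R <= N%:R * x <= k%:R + 1.
Proof.
move=> N0 /andP[x0 x1]; have NR : 0 < N%:R :> RR by rewrite ltr0n.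
have Nx : 0 <= N%:R * x by rewrite mulr_ge0// ltW.
have [x1'|x1'] := ltP x 1.
  have h : (Num.truncn (N%:R * x) < N)%N.
    by rewrite truncn_lt_nat// -[X in _ < X]mulr1 ltr_pM2l.
  exists (Ordinal h) => /=; have /andP[h1 h2] := truncn_itv Nx.
  by rewrite h1 /= -natr1 in h2 *; exact: ltW.
have h : (N.-1 < N)%N by rewrite prednK.
have e : (N.-1)%:R + 1 = N%:R :> RR by rewrite natr1 prednK.
exists (Ordinal h) => /=; have -> : x = 1 by lra.
rewrite mulr1 -e; lra.
Qed.

(** Pigeonhole. If all [M ^ d] candidates on a grid of mesh [h] were approached within [h / 4],
    points of the cube approaching different candidates would lie in different cells, as each [G i]
    varies by at most [h / 2] within a cell. But there are only [N ^ n] cells. *)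
Lemma missed_point n d (G : 'I_d -> 'rV[RR]_n -> RR) (K : nat) : (n < d)%N ->
  (forall i s t, `|G i s - G i t| <= K%:R * d1 s t) ->
  exists (c : 'I_d -> RR) (r : RR), [/\ 0 < r <= 16^-1,
    forall i, 2^-1 <= c i <= 2^-1 + 16^-1 &
    forall t : 'rV[RR]_n, (forall j, 0 <= t ord0 j <= 1) ->
      exists i, r <= `|G i t - c i|].
Proof.
move=> nd hG.
(* [M > A ^ n] gives [N ^ n = A ^ n * M ^ n < M ^ n.+1], and [A] is large enough for
   [K * n / N <= h / 2]. The 16 in [h] keeps the candidates within 1/16 of 1/2. *)
pose A := (32 * (K.+1 * n.+1))%N; pose M := (A ^ n).+1; pose N := (A * M)%N.
have M0 : (0 : RR) < M%:R by rewrite ltr0n.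
have A0 : (0 < A)%N by rewrite /A !muln_gt0.
have N0 : (0 < N)%N by rewrite muln_gt0 A0.
have NR : (0 : RR) < N%:R by rewrite ltr0n.
have NE : N%:R = 32 * (K.+1%:R * n.+1%:R) * M%:R :> RR by rewrite /N /A !natrM.
pose h : RR := (16 * M%:R)^-1; have h0 : 0 < h by rewrite invr_gt0 mulr_gt0.
have hM : h * M%:R = 16^-1.
  by rewrite /h invfM -mulrA mulVf ?mulr1// gt_eqF.
pose c (s : {ffun 'I_d -> 'I_M}) (i : 'I_d) : RR := 2^-1 + (s i)%:R * h.
have M1 : (1 : RR) <= M%:R by rewrite ler1n.
have h16 : h <= 16^-1 by rewrite -hM; have := ler_wpM2l (ltW h0) M1; rewrite mulr1.
apply: contrapT => no.
have bad s : exists t : 'rV[RR]_n, (forall j, 0 <= t ord0 j <= 1) /\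
    forall i, `|G i t - c s i| < h / 4.
  apply: contrapT => h2; apply: no; exists (c s), (h / 4); split.
  - by apply/andP; split; lra.
  - move=> i; have s0 : 0 <= (s i)%:R * h by rewrite mulr_ge0// ltW.
    have s1 : (s i)%:R * h <= 16^-1.
      rewrite -hM mulrC ler_pM2l// ler_nat; exact/ltnW/ltn_ord.
    by rewrite /c; lra.
  - move=> t ht; apply: contrapT => h3; apply: h2; exists t; split=> // i.
    by rewrite ltNge; apply/negP => h4; apply: h3; exists i.
have [tt htt] := choice bad.
have cell s : exists k : {ffun 'I_n -> 'I_N}, forall j,
    (k j)%:R <= N%:R * tt s ord0 j <= (k j)%:R + 1.
  have /choice [f hf] : forall j : 'I_n, exists k : 'I_N,
      k%:R <= N%:R * tt s ord0 j <= k%:R + 1.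
    move=> j; apply: grid_cell => //; by have [] := htt s.
  by exists [ffun j => f j] => j; rewrite ffunE.
have [kk hkk] := choice cell.
have inj : injective kk.
  move=> s s' e; apply/ffunP => i.
  have hD : d1 (tt s) (tt s') <= n%:R / N%:R.
    have : d1 (tt s) (tt s') <= \sum_(j < n) N%:R^-1.
      apply: ler_sum => j _; have := hkk s j; have := hkk s' j; rewrite e => h1 h2.
      rewrite -(ler_pM2l NR) mulfV ?gt_eqF// -{1}(gtr0_norm NR) -normrM mulrBr.
      by rewrite ler_norml; lra.
    by rewrite sumr_const card_ord -[X in _ <= X -> _]mulr_natl.
  have hKD : K%:R * d1 (tt s) (tt s') <= h / 2.
    apply: le_trans (ler_wpM2l (ler0n _ K) hD) _.
    rewrite mulrA ler_pdivrMr// NE.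
    have -> : h / 2 * (32 * (K.+1%:R * n.+1%:R) * M%:R) =
        (h * M%:R) * 16 * (K.+1%:R * n.+1%:R) by field.
    rewrite hM mulVf ?mul1r ?pnatr_eq0//.
    by apply: ler_pM => //; rewrite ler_nat.
  have := hG i (tt s) (tt s').
  have [_ /(_ i)] := htt s; have [_ /(_ i)] := htt s'.
  rewrite !ltr_norml ler_norml /c => /andP[a1 a2] /andP[b1 b2] /andP[c1 c2].
  have h1 : `|((s i)%:R - (s' i)%:R) * h| < h.
    by rewrite ltr_norml mulrBl; lra.
  rewrite normrM (gtr0_norm h0) -[X in _ < X]mul1r ltr_pM2r// in h1.
  apply/val_inj; move: h1; rewrite ltr_norml => /andP[d1' d2'].
  have le (a b : nat) : (a%:R - b%:R : RR) < 1 -> (a <= b)%N.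
    by move=> l; rewrite -ltnS -(ltr_nat RR) -natr1; lra.
  by apply: anti_leq; apply/andP; split; apply: le => //; lra.
have := leq_card kk inj; rewrite !card_ffun !card_ord leqNgt => /negP; apply.
apply: (@leq_trans (M ^ n.+1)).
  by rewrite /N expnMn expnS ltn_mul2r expn_gt0 /=.
by rewrite leq_exp2l// ltnS expn_gt0 A0.
Qed.

(** * Iterated suspensions as cubes with collapsed boundary *)

Definition crd (d : nat) : cs.
Proof.
refine (@Cs ('I_d -> RR) (fun u x => forall i, rcv (fun k => u k i) (x i)) _ _ _ _).
- move=> P u v x a b i.
  by apply: rcv_tail (rcv_mix P (a i) (b i)); apply: evT => k; case: ifP.
- by move=> u v x h a i; apply: rcv_tail (a i); apply: ev_mp h => k ->.
- by move=> *; exact: rcv_cst.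
- by move=> *; apply: evT => k i; exact: rcv_cst.
Defined.

Definition mbump d (y : 'I_d -> RR) : RR := \big[Num.min/1]_(i < d) bump (y i).

Lemma mbump_recl d (y : 'I_d.+1 -> RR) :
  mbump y = Num.min (bump (y ord0)) (mbump (fun i => y (lift ord0 i))).
Proof. by rewrite /mbump big_ord_recl. Qed.

Lemma mbump01 d (y : 'I_d -> RR) : 0 <= mbump y <= 1.
Proof.
elim: d y => [|d IH] y; first by rewrite /mbump big_ord0 ler01 lexx.
rewrite mbump_recl; have := IH (fun i => y (lift ord0 i)).
by have := bump01 (y ord0); minmax; lra.
Qed.

Lemma mbump_le d (y : 'I_d -> RR) i : mbump y <= bump (y i).
Proof.
elim: d y i => [|d IH] y i; first by case: i.
rewrite mbump_recl; case: (unliftP ord0 i) => [j ->|->].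
  by have := IH (fun i => y (lift ord0 i)) j; minmax; lra.
by minmax; lra.
Qed.

Lemma mbump_ge d (y : 'I_d -> RR) c : c <= 1 -> (forall i, c <= bump (y i)) ->
  c <= mbump y.
Proof.
elim: d y => [|d IH] y c1 h; first by rewrite /mbump big_ord0.
by rewrite mbump_recl le_min h IH.
Qed.

Lemma mbump_gt0 d (y : 'I_d -> RR) : (forall i, 0 < bump (y i)) -> 0 < mbump y.
Proof.
elim: d y => [|d IH] y h; first by rewrite /mbump big_ord0 ltr01.
by rewrite mbump_recl lt_min h IH.
Qed.

Lemma mbump_lt d (y : 'I_d -> RR) c : mbump y < c -> c <= 1 ->
  exists i, bump (y i) < c.
Proof.
move=> h c1; apply: contrapT => no; move: h; rewrite ltNge => /negP; apply.
by apply: mbump_ge => // i; rewrite leNgt; apply/negP => h; apply: no; exists i.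
Qed.

Lemma rcv_mbump d (u : nat -> crd d) (y : crd d) : cv u y ->
  rcv (fun k => mbump (u k)) (mbump y).
Proof.
elim: d u y => [|d IH] u y h.
  by apply: rcv_eqcst; apply: evT => k; rewrite /mbump !big_ord0.
rewrite mbump_recl; apply: (@rcv_tail (fun k => Num.min (bump (u k ord0))
    (mbump (fun i => u k (lift ord0 i))))).
  by apply: evT => k; rewrite mbump_recl.
apply: rcv_min; first exact/rcv_bump/h.
by apply: IH => i; exact: h.
Qed.

Section Flat.
Context (Q : cs).

Definition flatv d (p : prod_cs (crd d) Q) : RR := mbump p.1.

Lemma flatv01 d (p : prod_cs (crd d) Q) : 0 <= flatv p <= 1.
Proof. exact: mbump01. Qed.

Lemma flatv_cv d : @cts (prod_cs (crd d) Q) Rl (@flatv d).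
Proof. by move=> u x [h _]; exact: rcv_mbump. Qed.

(** The open [d]-cube times [Q] with its boundary collapsed: the suspension coordinates of [Sn Q d]
    side by side instead of nested. *)
Definition flat d : gsp := CQ (@flatv01 d) (@flatv_cv d).

Lemma val_flat d y q : @val (flat d) (Some (y, q)) <-> val q /\ 0 < mbump y.
Proof.
split=> [/val_CQ [[_ h1] h2]//|[h1 h2]]; apply/val_CQ; split=> //.
by split=> // i; exact: rcv_cst.
Qed.

Definition fcons d (s : RR) (y : 'I_d -> RR) : 'I_d.+1 -> RR :=
  fun i => if unlift ord0 i is Some j then y j else s.

Lemma fcons0 d s (y : 'I_d -> RR) : fcons s y ord0 = s.
Proof. by rewrite /fcons unlift_none. Qed.

Lemma fconsS d s (y : 'I_d -> RR) j : fcons s y (lift ord0 j) = y j.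
Proof. by rewrite /fcons liftK. Qed.

Lemma fcons_eta d (y : 'I_d.+1 -> RR) :
  fcons (y ord0) (fun j => y (lift ord0 j)) = y.
Proof.
by apply/funext => i; rewrite /fcons; case: unliftP => [j ->|->].
Qed.

Lemma mbump_fcons d s (y : 'I_d -> RR) : mbump (fcons s y) = Num.min (bump s) (mbump y).
Proof.
rewrite mbump_recl fcons0; congr Num.min; congr mbump; apply/funext => j.
exact: fconsS.
Qed.

Definition inv_pair (M N : pcs) (f : M -> N) (g : N -> M) : Prop :=
  [/\ pmap f, pmap g, forall x, val x -> g (f x) = x & forall x, val x -> f (g x) = x].

Lemma inv_pair_comp (M N P : pcs) (f : M -> N) (g : N -> M) (f' : N -> P) (g' : P -> N) :
  inv_pair f g -> inv_pair f' g' ->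
  inv_pair (fun x => f' (f x)) (fun x => g (g' x)).
Proof.
move=> [pf pg gf fg] [pf' pg' gf' fg']; split; try exact: pmap_comp.
  by move=> x vx; rewrite gf' ?gf//; case: pf => cf _; exact: cts_val.
by move=> x vx; rewrite fg ?fg'//; case: pg' => cg _; exact: cts_val.
Qed.

Lemma flat_Sus d : exists (f : Sus (flat d) -> flat d.+1) (g : flat d.+1 -> Sus (flat d)),
  inv_pair f g.
Proof.
have vS s (y : crd d) q : @val (Sus (flat d)) (Some (s, Some (y, q))) <->
    val q /\ 0 < Num.min (bump s) (mbump y).
  split=> [/val_Sus [/val_flat [h1 h2] h3]//|[h1 h2]].
  apply/val_Sus; split=> //; apply/val_flat; split=> //.
  by move: h2; rewrite lt_min => /andP[].
exists (fun x => if x is Some (s, Some (y, q)) then Some (fcons s y, q) else None).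
exists (fun x => if x is Some (y, q) then
  Some (y ord0, Some ((fun j => y (lift ord0 j)), q)) else None).
split.
- apply: pmap_gauge => //.
  + move=> [[s [[y q]|]]|]; try by move=> _; exact: (val_pt (flat d.+1)).
    by move=> /vS [h1 h2]; apply/val_flat; rewrite mbump_fcons.
  + move=> [[s [[y q]|]]|] //; first by move=> _; rewrite /= /flatv mbump_fcons.
    by move=> /val_Sus [_]; rewrite /susv /=; have := bump01 s; minmax; lra.
  + move=> u [[s [[y q]|]]|] // [x0 [z [hz1 hz2] hz]] _; last first.
      by move: x0; rewrite /susv /=; have := bump01 s; minmax; lra.
    have [x1 [t [ht1 ht2] ht]] := hz2; split.
      by rewrite /flatv /= mbump_fcons; exact: x0.
    exists (fun n => (fcons (z n).1 (t n).1, (t n).2)).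
      split=> //= i; rewrite /fcons; case: unliftP => [j _|_]; [exact: ht1|exact: hz1].
    apply: ev_mp2 hz ht => n ->; case: (z n) => a b /= ->.
    by case: (t n).
- apply: pmap_gauge => //.
  + move=> [[y q]|]; last by move=> _; exact: (val_pt (Sus (flat d))).
    by move=> /val_flat [h1 h2]; apply/vS; split=> //; rewrite -mbump_recl.
  + by move=> [[y q]|] // _; rewrite /= /susv /= /flatv /= -mbump_recl.
  + move=> u [[y q]|] // [x0 [z [hz1 hz2] hz]] _; have x0' : 0 < mbump y := x0.
    split; first by rewrite /susv /= /flatv /= -mbump_recl.
    exists (fun n => ((z n).1 ord0, Some ((fun j => (z n).1 (lift ord0 j)), (z n).2))).
      split; first exact: hz1.
      split; first by move: x0'; rewrite mbump_recl lt_min => /andP[].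
      exists (fun n => ((fun j => (z n).1 (lift ord0 j)), (z n).2)); last exact: evT.
      by split=> //= j; exact: hz1.
    by apply: ev_mp hz => n ->; case: (z n).
- move=> [[s [[y q]|]]|] //; last first.
    move=> /val_Sus [_ h]; exfalso; move: h; rewrite /susv /=.
    by have := bump01 s; minmax; lra.
  move=> _; rewrite fcons0; congr (Some (_, Some (_, _))); apply/funext => j.
  exact: fconsS.
- by move=> [[y q]|] // _; rewrite fcons_eta.
Qed.

Lemma inv_pair_Sus (M N : gsp) (f : M -> N) (g : N -> M) :
  inv_pair f g -> inv_pair (smap f) (smap g).
Proof.
move=> [pf pg gf fg]; split; try exact: pmap_smap.
- move=> y vy; rewrite smap_comp//; case: y vy => [[s m]|] // vy.
  by have /val_Sus [vm s0] := vy; rewrite /= gf// smk_some.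
- move=> y vy; rewrite smap_comp//; case: y vy => [[s m]|] // vy.
  by have /val_Sus [vm s0] := vy; rewrite /= fg// smk_some.
Qed.

Lemma flat_Sn d : exists (f : Sn Q d -> flat d) (g : flat d -> Sn Q d), inv_pair f g.
Proof.
elim: d => [|d [f [g h]]]; last first.
  have [f' [g' h']] := flat_Sus d.
  by exists (fun x => f' (smap f x)), (fun x => smap g (g' x));
    apply: (inv_pair_comp (inv_pair_Sus h) h').
have y0E (y : 'I_0 -> RR) : y = fun _ => 0 by apply/funext => -[].
have m0 (y : 'I_0 -> RR) : mbump y = 1 by rewrite /mbump big_ord0.
exists (fun x => if x is Some q then Some ((fun _ => 0), q) else None).
exists (fun x => if x is Some (y, q) then Some q else None).
split.
- apply: pmap_gauge => //.
  + move=> [q|]; last by move=> _; exact: (val_pt (flat 0)).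
    by move=> /val_CQ [h1 h2]; apply/val_flat; rewrite m0 ltr01.
  + by move=> [q|] // _; rewrite /= /flatv m0.
  + move=> u [q|] // [x0 [z hz1 hz]] _; split; first by rewrite /flatv /= m0.
    exists (fun n => ((fun _ => 0), z n)); first by split=> // i; exact: rcv_cst.
    by apply: ev_mp hz => n ->.
- apply: pmap_gauge => //.
  + move=> [[y q]|]; last by move=> _; exact: (val_pt (Pls Q)).
    by move=> /val_flat [h1 _]; exact: val_Pls.
  + by move=> [[y q]|] // _; rewrite /= /flatv m0.
  + move=> u [[y q]|] // [x0 [z [_ hz1] hz]] _; split; first exact: ltr01.
    exists (fun n => (z n).2) => //.
    by apply: ev_mp hz => n ->; case: (z n).
- by move=> [q|].
- by move=> [[y q]|] // _; rewrite (y0E y).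
Qed.

End Flat.

Lemma rcv_sum n (f : 'I_n -> nat -> RR) (a : 'I_n -> RR) :
  (forall i, rcv (f i) (a i)) -> rcv (fun k => \sum_i f i k) (\sum_i a i).
Proof.
elim: n f a => [|n IH] f a h.
  by apply: rcv_eqcst; apply: evT => k; rewrite !big_ord0.
rewrite big_ord_recl; apply: (@rcv_tail (fun k => f ord0 k +
    \sum_i f (lift ord0 i) k)).
  by apply: evT => k; rewrite big_ord_recl.
by apply: rcvD => //; apply: IH.
Qed.

Lemma cts_lipschitz n (G : 'rV[RR]_n -> RR) (K : nat) :
  (forall s t, `|G s - G t| <= K%:R * d1 s t) -> @cts (vec n) Rl G.
Proof.
move=> hG u x h.
have hd : rcv (fun k => K%:R * d1 (u k) x) (K%:R * d1 x x).
  apply: rcvM; first exact: rcv_cst.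
  apply: rcv_sum => i; apply: rcv_norm; apply: rcvD; [exact: h|exact: rcv_cst].
have e : d1 x x = 0 by rewrite /d1 big1// => i _; rewrite subrr normr0.
rewrite e mulr0 in hd => r r0; apply: ev_mp (hd r r0) => k.
rewrite subr0; apply: le_lt_trans; apply: le_trans (hG _ _) _; exact: ler_norm.
Qed.

Lemma bump_lt s c : c <= 1 -> bump s < c -> 4 * s < c \/ 4 * (1 - s) < c.
Proof.
move=> c1; rewrite /bump; set z := Num.min _ _ => h.
have : z < c by move: h; rewrite /cl; minmax; lra.
by rewrite gt_min => /orP.
Qed.

Lemma cl_mono x y : x <= y -> cl x <= cl y.
Proof. by rewrite /cl => ?; minmax; lra. Qed.

(** Expansion from a point near the centre moves the outer quarters towards the ends; on the middle,
    [bump] is maximal anyway. *)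
Lemma bump_push (c b y : RR) : 2^-1 <= c <= 2^-1 + 16^-1 -> 1 <= b ->
  bump (c + b * (y - c)) <= bump y.
Proof.
move=> hc b1.
have h1 : y <= c -> b * (y - c) <= y - c by move=> h; nra.
have h2 : c <= y -> y - c <= b * (y - c) by move=> h; nra.
move: (b * (y - c)) h1 h2 => z h1 h2.
have [y1|y1] := lerP y 4^-1.
  have : z <= y - c by apply: h1; lra.
  by move=> h; rewrite /bump; apply: cl_mono; minmax; lra.
have [y2|y2] := lerP (3 / 4) y.
  have : y - c <= z by apply: h2; lra.
  by move=> h; rewrite /bump; apply: cl_mono; minmax; lra.
rewrite [X in _ <= X](_ : _ = 1); first by case/andP: (bump01 (c + z)).
by rewrite /bump cl_ge1//; minmax; lra.
Qed.

Lemma mbump_mono d (y z : 'I_d -> RR) :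
  (forall i, bump (z i) <= bump (y i)) -> mbump z <= mbump y.
Proof.
move=> h; apply: mbump_ge; first by case/andP: (mbump01 z).
by move=> i; apply: le_trans (mbump_le z i) (h i).
Qed.

(* A spheroid of dimension n < d has a uniformly close Lipschitz
   approximation, which misses a point by counting cells; one then pushes
   radially away from that point. *)
Lemma null_flat (Q : cs) (n d : nat) (w : vec n -> flat Q d) : (n < d)%N -> sph w ->
  exists H : RR -> vec n -> flat Q d,
    [/\ @cts (prod_cs Iv (vec n)) (flat Q d) (fun p => H p.1 p.2),
        forall t, H 0 t = w t, forall t, H 1 t = None &
        forall s t, w t = None -> H s t = None].
Proof.
move=> nd [cw w0]; pose v t := gu (w t).
have vc : @cts (vec n) Rl v by apply: cts_comp cw _; exact: gu_cv.
(* The coordinates have no limit at the base point, so they are cut off to 0 below gauge 1/4; from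
   gauge 1/2 on they are exact. *)
pose F (i : 'I_d) (t : 'rV[RR]_n) : RR :=
  if w t is Some (y, _) then cl (4 * v t - 1) * y i else 0.
have wval t : val (w t) by apply: cts_val cw _; exact: val_vec.
have yi t y q i : w t = Some (y, q) -> 0 < y i < 1.
  move=> e; have := wval t; rewrite e => /val_flat [_ h].
  by rewrite -bump_gt0; apply: lt_le_trans h (mbump_le _ _).
have cF i : @cts (vec n) Rl (F i).
  move=> u x ux; have hv := vc _ _ ux; have := cw _ _ ux; rewrite {2}/F /=.
  case e : (w x) => [[y q]|] hw.
    have [_ [z [hz _] h]] := hw.
    apply: (@rcv_tail (fun k => cl (4 * v (u k) - 1) * (z k).1 i)).
      by apply: ev_mp h => k; rewrite /F => ->; case: (z k).
    have := hz i => /= hz'; rcvt; exact: hv.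
  apply: rcv_eqcst; have vx : v x < 4^-1 by rewrite /v e /= invr_gt0.
  apply: ev_mp (ev_lt hv vx) => k hk; rewrite /F; case: (w (u k)) => [[y q]|] //.
  by rewrite cl_le0 ?mul0r//; lra.
have F0 i t : bd t -> F i t = 0 by move=> /w0; rewrite /F => ->.
have F01 i t : 0 <= F i t <= 1.
  rewrite /F; case e : (w t) => [[y q]|]; last by rewrite lexx ler01.
  have /andP[h1 h2] := yi _ _ _ i e; have /andP[h3 h4] := cl01 (4 * v t - 1).
  by apply/andP; split; [apply: mulr_ge0|apply: mulr_ile1] => //; exact: ltW.
have e16 : (0 : RR) < 16^-1 by rewrite invr_gt0.
have /choice [K0 hK0] := fun i => lipschitz_approx (cF i) (F0 i) (F01 i) e16.
pose K := \max_i K0 i.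
have /choice [G hG] := fun i => hK0 i K (leq_bigmax i).
have [c [r [/andP[r0 r1] hc hm]]] := missed_point nd (fun i => (hG i).1).
have cG i := cts_lipschitz (hG i).1.
(* The factor grows from 1 to [1 / r]: a distance [r] from [c] in one coordinate then suffices to
   leave the cube. *)
pose b (s : RR) : RR := (1 - s) + s * r^-1.
have r16 : 1 <= r^-1 by rewrite -[X in X <= _]invr1 lef_pV2 ?posrE//; lra.
have b1 s : 0 <= s <= 1 -> 1 <= b s by rewrite /b => hs; nra.
(* [G] replaces [y] gradually between gauge 1/2 and 3/4. Closer to the base point there is only the
   expansion, which does not increase the gauge; this gives continuity there. *)
pose Y s t (y : 'I_d -> RR) i : RR :=
  c i + b s * (y i + s * cl (4 * v t - 2) * (G i t - y i) - c i).
pose H s t : flat Q d := if w t is Some (y, q) then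
  @mkq (prod_cs (crd d) Q) (@flatv Q d) (Y s t y, q) else None.
have Y0 t y : Y 0 t y = y.
  by apply/funext => i; rewrite /Y /b; ring.
exists H; split.
- move=> u [s t] [/= [hs s01 us01] ht]; have hv := vc _ _ ht.
  have := cw _ _ ht; rewrite {2}/H; case e : (w t) => [[y q]|] hw.
    have [_ [z [hz1 hz2] h]] := hw.
    have cY : @cv (crd d) (fun k => Y (u k).1 (u k).2 (z k).1) (Y s t y).
      move=> i; have hzi := hz1 i; have hGi := cG i _ _ ht; rewrite /= in hzi.
      by rewrite /Y /b; rcvt.
    apply: (@cv_tail (flat Q d) (fun k => @mkq (prod_cs (crd d) Q) (@flatv Q d)
        (Y (u k).1 (u k).2 (z k).1, (z k).2))).
      by apply: ev_mp h => k; rewrite /H => ->; case: (z k).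
    apply: cv_mkq.
    + exact: rcv_mbump.
    + by move=> _; split.
    + by apply: ev_mp2 (cv_mem cY) (cv_mem hz2) => k a a' _; split.
  have vx : v t < 2^-1 by rewrite /v e /= invr_gt0.
  have hv0 : rcv (fun k => v (u k).2) 0 by move: hv; rewrite {2}/v e.
  split.
    apply: evT => k; rewrite /H; have := wval (u k).2.
    case: (w (u k).2) => [[y q]|] // /val_flat [vq _].
    rewrite /mkq; case: ifP => // h0; split=> //; split=> // i; exact: rcv_cst.
  apply: rcv_le0 hv0; apply: ev_mp2 us01 (ev_lt hv vx) => k hk hvk.
  apply/andP; split; first by case/andP: (ou01 (@flatv01 Q d) (H (u k).1 (u k).2)).
  rewrite /H /v; have := hvk; rewrite {1}/v.
  case: (w (u k).2) => [[y q]|] // hvk'.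
  have le : mbump (Y (u k).1 (u k).2 y) <= mbump y.
    apply: mbump_mono => i; rewrite /Y cl_le0; last by lra.
    by rewrite mulr0 mul0r addr0; apply: bump_push => //; apply: b1.
  rewrite /mkq; case: ifP => // _ /=; exact: (andP (mbump01 y)).1.
- move=> t; rewrite /H; case e : (w t) => [[y q]|] //; rewrite Y0 mkq_some//.
  by have := wval t; rewrite e => /val_flat [].
- move=> t; rewrite /H; case e : (w t) => [[y q]|] //; apply: mkq_none.
  have tc j : 0 <= t ord0 j <= 1.
    apply: contrapT => h; have : bd t.
      by exists j; apply/negP => /andP[/ltW h1 /ltW h2]; apply: h; rewrite h1.
    by move=> /w0; rewrite e.
  have vE : v t = mbump y by rewrite /v e.
  suff [i hi] : exists i, r <= `|y i + cl (4 * v t - 2) * (G i t - y i) - c i|.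
    apply: le_trans (mbump_le _ i) _; apply: bump_le0.
    suff : ~~ (0 < Y 1 t y i < 1) by [].
    rewrite /Y /b subrr add0r !mul1r.
    have : 1 <= `|r^-1 * (y i + cl (4 * v t - 2) * (G i t - y i) - c i)|.
      by rewrite normrM gtr0_norm ?invr_gt0// mulrC ler_pdivlMr// mul1r.
    have := hc i; move: (r^-1 * _) => z /andP[c1 c2].
    by rewrite ler_normr => /orP[] h; apply/negP => /andP[]; lra.
  (* From gauge 3/4 on the point is that of [G], which misses [c]. Below, some coordinate is less
     than 3/16 or greater than 13/16; it is moved by at most 1/16, while [c] lies between 8/16 and
     9/16, so the distance is still at least [r]. *)
  have [hv|hv] := leP (3 / 4) (v t).
    have [i hi] := hm t tc; exists i; rewrite cl_ge1; last by lra.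
    by rewrite mul1r (addrC (y i)) subrK.
  have [i hi] : exists i, bump (y i) < 3 / 4.
    by apply: mbump_lt; [rewrite -vE|lra].
  exists i.
  have hy : y i < 3 / 16 \/ 13 / 16 < y i.
    have c1 : (3 / 4 : RR) <= 1 by lra.
    by case: (bump_lt c1 hi) => h; [left|right]; lra.
  have : `|cl (4 * v t - 2) * (G i t - y i)| <= 16^-1.
    have [hv2|hv2] := leP (v t) 2^-1.
      by rewrite cl_le0 ?mul0r ?normr0; [exact: ltW|lra].
    have FE : F i t = y i by rewrite /F e cl_ge1 ?mul1r//; lra.
    have := (hG i).2 t; rewrite FE; apply: le_trans.
    rewrite normrM; have /andP[l0 l1] := cl01 (4 * v t - 2).
    by rewrite (ger0_norm l0); apply: ler_piMl.
  rewrite ler_norml; move: (cl _ * _) => z hz.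
  by have := hc i; rewrite ler_normr; case: hy => hy /andP[c1 c2]; apply/orP;
    [right|left]; lra.
- by move=> s t e; rewrite /H e.
Qed.

(** [null_flat] contracts the second coordinate of a spheroid. Where this coordinate is trivial it
    stays so, hence the homotopy remains in the wedge. *)
Lemma drop_high (Z : gsp) (Q : cs) (n d : nat) : (n.+2 < d)%N ->
  giso (piG n (wdg Z (Sn Q d))) (piG n Z).
Proof.
move=> nd; have [f [g [pf pg gf fg]]] := flat_Sn Q d.
have p1 := pmap_wdg1 Z (Sn Q d); have p2 := pmap_wdg2 Z (Sn Q d).
have i1 := pmap_win1 Z (Sn Q d).
exists (pif (fun p : wdg Z (Sn Q d) => p.1)); split.
  by move=> x y; exact: pif_add.
exists (pif (@win1 Z (Sn Q d))) => A; last by rewrite pif_comp// pif_id.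
rewrite pif_comp// -(cls_rep A) -/(clsG _); have sA := sph_rep A.
move: (rep A) sA => w sw; have pc := pmap_comp p1 i1.
rewrite pif_cls//; apply/cls_eqP => //; first exact: (sph_map pc sw).
have sf : sph (fun t => f (w t).2) by exact: (sph_map (pmap_comp p2 pf) sw).
have [H [cH H0 H1 HN]] := null_flat nd sf.
have wv t : val (w t) by case: sw => cw _; apply: cts_val cw _; exact: val_vec.
apply: rhom_sym; exists (fun s t => ((w t).1, g (H s t)) : wdg Z (Sn Q d)); split.
- move=> u [s t] h; have [h1 h2] := h; case: sw => cw _.
  have P s' t' : wdg_pred (((w t').1, g (H s' t')) : wdg Z (Sn Q d)).
    have /val_wdg [_ _ [->|e]] := wv t'; first by left.
    by right; rewrite HN ?e//=; [case: pg|case: pf].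
  split; [split|exact: P|by apply: evT => k; exact: P].
    by case: p1 => cp _; apply: (cp _ _ (cw _ _ h2)).
  by case: pg => cg _; apply: cg; exact: (cH _ _ h).
- by move=> s t hs bt; case: sw => _ /(_ _ bt) e; rewrite HN e /=; [case: pg => _ ->|case: pf].
- move=> t _; rewrite H0 gf; first by case: (w t).
  by have /val_wdg [] := wv t.
- by move=> t _; rewrite H1; case: pg => _ ->.
Qed.

Lemma drop_high_bw (Z : gsp) (Q : cs) (n : nat) (l : seq nat) :
  all (fun d => n.+2 < d)%N l -> giso (piG n (wdg Z (bw Q l))) (piG n Z).
Proof.
elim: l => [_|d l IH /= /andP[dn /IH h]].
  apply: giso_heq; exact: heq_trans (heq_wdgC _ _) (heq_wdg_Pt _).
apply: giso_trans h; apply: giso_trans (drop_high (wdg Z (bw Q l)) Q dn).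
apply: giso_heq.
exact: heq_trans (heq_wdg (heq_refl Z) (heq_wdgC _ _)) (heq_wdgA _ _ _).
Qed.

(** * Hilton decomposition *)

(** The spheres split off in [r] rounds: a round releases the spheres of [l] and leaves suspended
    loop spaces of dimensions [k.-1 + d]. *)
Fixpoint word_dims (e : seq nat) (r : nat) (l : seq nat) : seq nat :=
  if r is r.+1 then l ++ word_dims e r [seq (k.-1 + d)%N | k <- l, d <- e] else [::].

Lemma all_word_dims (P : pred nat) e r l :
  (forall k d, P k -> d \in e -> P (k.-1 + d)%N) -> all P l -> all P (word_dims e r l).
Proof.
move=> h; elim: r l => [|r IH] l //= Pl; rewrite all_cat Pl IH//.
by apply/allP => _ /allpairsP [[k d] [/= kl de ->]]; apply: h => //; apply: (allP Pl).
Qed.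

Lemma word_dims_sub e r l x : x \in l -> x \in word_dims e r.+1 l.
Proof. by move=> h; rewrite /= mem_cat h. Qed.

Lemma mem_word_dims e d r l x i : d \in e -> (0 < d)%N -> x \in l -> (0 < x)%N -> (i < r)%N ->
  (x + i * d.-1)%N \in word_dims e r l.
Proof.
move=> de d0; elim: i r l x => [|i IH] [|r] l x //= xl x0 ir; rewrite mem_cat.
  by rewrite mul0n addn0 xl.
apply/orP; right; have -> : (x + i.+1 * d.-1 = (x.-1 + d) + i * d.-1)%N by lia.
by apply: IH => //; [apply/allpairsP; exists (x, d)|lia].
Qed.

Lemma bw_loops_split e l : all (fun d => 0 < d)%N e -> all (fun d => 0 < d)%N l ->
  heq (bw (loops (bw unit_cs e)) l) (wdg (bw unit_cs l)
    (bw (loops (bw unit_cs e)) [seq (k.-1 + d)%N | k <- l, d <- e])).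
Proof.
move=> e0; elim: l => [|k l IH] /= l0.
  exact: heq_sym (heq_wdg_Pt Pt).
have /andP[k0 /IH {}IH] := l0; set X := bw unit_cs e in IH *.
have := Sn_loops_split k.-1 e0; rewrite prednK// => h.
apply: heq_trans (heq_wdg h IH) _.
apply: heq_trans (heq_sym (heq_wdgA _ _ _)) _.
apply: heq_trans (heq_wdgA _ _ _).
apply: heq_wdg; first exact: heq_refl.
apply: heq_trans (heq_wdgA _ _ _) _.
apply: heq_trans (heq_wdg (heq_wdgC _ _) (heq_refl _)) _.
apply: heq_trans (heq_sym (heq_wdgA _ _ _)) _.
apply: heq_wdg; first exact: heq_refl.
exact: heq_sym (heq_bw_cat _ _ _).
Qed.

(** As all spheres of [e] have dimension at least 2, each round raises the dimensions that remain.
    After [r] rounds they exceed [n.+2], and the remainder is dropped; so finite wedges suffice for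
    fixed [n]. *)
Lemma giso_bw_loops (n : nat) (Z : gsp) e r l :
  all (fun d => 1 < d)%N e -> all (fun d => 0 < d)%N l ->
  all (fun d => n.+2 < d + r)%N l ->
  giso (piG n (wdg Z (bw (loops (bw unit_cs e)) l)))
       (piG n (wdg Z (bw unit_cs (word_dims e r l)))).
Proof.
move=> e1; have e0 : all (fun d => 0 < d)%N e.
  by apply: sub_all e1 => d; exact: ltnW.
elim: r Z l => [|r IH] Z l l0 lr /=.
  apply: giso_trans (giso_sym (giso_heq n (heq_trans (heq_wdgC _ _) (heq_wdg_Pt Z)))).
  by apply: drop_high_bw; apply: sub_all lr => d; rewrite addn0.
have h := heq_wdg (heq_refl Z) (bw_loops_split e0 l0).
apply: giso_trans (giso_heq n (heq_trans h (heq_wdgA _ _ _))) _.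
apply: giso_trans (IH _ _ _ _) _.
- apply/allP => _ /allpairsP [[k d] [/= kl /(allP e1) de ->]]; lia.
- apply/allP => _ /allpairsP [[k d] [/= kl /(allP e1) /= de ->]].
  by have := allP l0 _ kl; have := allP lr _ kl; rewrite /=; lia.
apply: giso_heq; apply: heq_trans (heq_sym (heq_wdgA _ _ _)) _.
apply: heq_wdg; first exact: heq_refl.
exact: heq_sym (heq_bw_cat _ _ _).
Qed.

Lemma giso_prod (G G' H H' : zmodType) :
  giso G G' -> giso H H' -> giso (G * H)%type (G' * H')%type.
Proof.
move=> [f [fD [f' fK f'K]]] [g [gD [g' gK g'K]]].
exists (fun x => (f x.1, g x.2)); split; first by move=> x y; rewrite /= fD gD.
by exists (fun x => (f' x.1, g' x.2)) => -[a b] /=; rewrite ?fK ?gK ?f'K ?g'K.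
Qed.

(** A product of groups of spheres given by coordinates. They are indexed by all numbers, of which
    those below [size l] count, so that the coordinates of all kernels can later be enumerated
    together. *)
Definition sph_prod (n : nat) (G : zmodType) (l : seq nat) : Prop :=
  exists f : forall i, G -> piG n (Sn unit_cs (nth 0%N l i)),
    [/\ forall i x y, f i (x + y) = f i x + f i y,
        forall x y, (forall i, (i < size l)%N -> f i x = f i y) -> x = y &
        forall y : (forall i, piG n (Sn unit_cs (nth 0%N l i))),
          exists x, forall i, (i < size l)%N -> f i x = y i].

Lemma sph_prod_giso n (G H : zmodType) l : giso G H -> sph_prod n H l -> sph_prod n G l.
Proof.
move=> [g [gD [g1 gK g1K]]] [f [fD fI fS]]; exists (fun i x => f i (g x)); split.
- by move=> i x y; rewrite gD fD.
- by move=> x y h; apply: (can_inj gK); exact: fI.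
- by move=> y; have [x hx] := fS y; exists (g1 x) => i /hx; rewrite g1K.
Qed.

Lemma sph_prod_nil n (G : zmodType) : (forall x : G, x = 0) -> sph_prod n G [::].
Proof.
move=> h; exists (fun _ _ => 0); split=> //.
- by move=> *; rewrite addr0.
- by move=> x y _; rewrite (h x) (h y).
- by exists 0.
Qed.

Lemma sph_prod_cons n (G : zmodType) d l :
  sph_prod n G l -> sph_prod n (piG n (Sn unit_cs d) * G)%type (d :: l).
Proof.
move=> [f [fD fI fS]].
exists (fun i => if i is j.+1 return
    (piG n (Sn unit_cs d) * G)%type -> piG n (Sn unit_cs (nth 0%N (d :: l) i))
  then fun x => f j x.2 else fun x => x.1); split.
- by move=> [|i] x y //; exact: fD.
- move=> [x1 x2] [y1 y2] h; congr (_, _); first exact: (h 0%N).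
  by apply: fI => i il; exact: (h i.+1).
- move=> y; have [x hx] := fS (fun i => y i.+1).
  by exists (y 0%N, x) => -[|i] // il; exact: hx.
Qed.

(** For [m >= 2], the numbers [j * (m - 1) + 1] with [j >= 1]. *)
Definition hdim (m : nat) : pred nat := fun x => ((m.-1 %| x.-1) && (m <= x))%N.

Lemma hdim_id m : hdim m m.
Proof. by rewrite /hdim dvdnn leqnn. Qed.

Lemma hdim_add m k d : hdim m k -> hdim m d -> (0 < m)%N -> hdim m (k.-1 + d).
Proof.
move=> /andP[h1 h2] /andP[h3 h4] m0; apply/andP; split; last by lia.
by have -> : ((k.-1 + d).-1 = k.-1 + d.-1)%N by [lia]; exact: dvdn_add.
Qed.

Lemma piG_bw_high n l : all (fun d => n.+2 < d)%N l ->
  forall x : piG n (bw unit_cs l), x = 0.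
Proof.
move=> hl; have := giso_trans (giso_sym (giso_heq n (heq_wdg_Pt (bw unit_cs l))))
  (drop_high_bw Pt unit_cs hl).
move=> [f [_ bf]] x; apply: (bij_inj bf); move: (f x) (f 0) => A B.
have E (C : piG n Pt) : C = 0.
  by rewrite -(cls_rep C); congr cls; apply/funext => t; case: (rep C t).
by rewrite (E A) (E B).
Qed.

(* Induction on the number of copies of a smallest sphere S^c: splitting one
   of them off replaces the other spheres by smashes with the loop space of
   S^c, all of whose new summands have dimension greater than c. *)
Lemma hilton n m l : (1 < m)%N -> all (hdim m) l -> exists l',
  [/\ sph_prod n (piG n (bw unit_cs l)) l',
      all (fun x => hdim m x && (x <= n.+2)%N) l' &
      forall x, x \in l -> (x <= n.+2)%N -> x \in l'].
Proof.
move=> m1; pose N0 := n.+3.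
have : all (fun x => n.+3 <= x + N0)%N l by apply/allP => x _; lia.
(* All dimensions are at least [n.+3 - N], and at [N = 0] the group vanishes. The inner induction
   counts the spheres of the least admissible dimension [c]. *)
move: N0 => N; elim: N l => [|N IHN] l hN hl.
  exists [::]; split=> // [|x /(allP hN)]; last by lia.
  apply: sph_prod_nil; apply: piG_bw_high; apply: sub_all hN => x; lia.
pose c := (n.+2 - N)%N.
move: {2}(count_mem c l) (erefl (count_mem c l)) => q.
elim: q l hN hl => [|q IHq] l hN hl cq.
  apply: IHN => //; apply/allP => x xl; have := allP hN _ xl.
  have : x != c.
    apply/eqP => e; move/eqP: cq; rewrite -leqn0 leqNgt -has_count => /negP; apply.
    by apply/hasP; exists x => //=; apply/eqP.
  by have /andP[_] := allP hl _ xl; rewrite /c; lia.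
have cl : c \in l by rewrite -has_pred1 has_count cq.
have [l1 [l2 El]] : exists l1 l2, l = l1 ++ c :: l2.
  by case/splitPr: cl => l1 l2; exists l1, l2.
pose R := l1 ++ l2.
have cR : count_mem c R = q.
  by move: cq; rewrite El /R !count_cat /= eqxx; lia.
have hc : hdim m c by exact: (allP hl).
have sR x : x \in R -> x \in l.
  by rewrite El /R !mem_cat inE => /orP[->|->]; rewrite ?orbT.
have hR : all (hdim m) R by apply/allP => x /sR; exact: (allP hl).
have RN : all (fun x => n.+3 <= x + N.+1)%N R by apply/allP => x /sR; exact: (allP hN).
have mc : (m <= c)%N by case/andP: hc.
have Rc : all (fun x => c <= x)%N R by apply: sub_all RN => x; rewrite /c; lia.
pose D := word_dims [:: c] n.+3 R.
have [|||l' [h1 h2 h4]] := IHq D.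
- by apply: all_word_dims RN => k d hk; rewrite inE => /eqP ->; lia.
- apply: all_word_dims hR => k d hk; rewrite inE => /eqP ->.
  by apply: hdim_add => //; lia.
(* Every new dimension exceeds [c], so the copies of [c] in [D] are those in [R]: one fewer than in
   [l]. *)
- have -> : D = R ++ word_dims [:: c] n.+2 [seq (k.-1 + d)%N | k <- R, d <- [:: c]] by [].
  rewrite count_cat cR; apply/eqP; rewrite -[X in _ == X]addn0 eqn_add2l.
  rewrite -leqn0 leqNgt -has_count -all_predC.
  have hD : all (fun x => c < x)%N [seq (k.-1 + d)%N | k <- R, d <- [:: c]].
    apply/allP => _ /allpairsP [[k d] [/= kR + ->]]; rewrite inE => /eqP ->.
    by have := allP Rc _ kR; rewrite /=; lia.
  apply: (@sub_all _ (fun x => c < x)%N) => [x /= cx|]; first by apply/eqP; lia.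
  by apply: all_word_dims hD => k d hk; rewrite inE => /eqP ->; lia.
exists (c :: l'); split.
- have [psi psiP] := wellp_bw unit_cs R.
  have c1 : all (fun d => 1 < d)%N [:: c] by rewrite /= andbT; lia.
  have R0 : all (fun d => 0 < d)%N R by apply: sub_all Rc => x; lia.
  have Rn : all (fun d => n.+2 < d + n.+3)%N R by apply: sub_all Rc => x; lia.
  apply: sph_prod_giso (sph_prod_cons c h1).
  rewrite El; apply: giso_trans (giso_heq n (heq_bw_pull _ _ _ _)) _.
  apply: giso_trans (giso_heq n (heq_bw_cat _ [:: c] R)) _.
  apply: giso_trans (@pi_wedge (bw unit_cs [:: c]) _ _ psiP n) _.
  apply: giso_prod.
    apply: giso_heq; exact: heq_trans (heq_wdgC _ _) (heq_wdg_Pt _).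
  apply: giso_trans (giso_heq n (heq_Half_bw _ R)) _.
  apply: giso_trans (giso_heq n (heq_sym (heq_wdg_Pt _))) _.
  apply: giso_trans (giso_bw_loops Pt c1 R0 Rn) _.
  exact: giso_heq (heq_wdg_Pt _).
- by rewrite /= hc h2 andbT /c; lia.
- move=> x; rewrite El mem_cat inE in_cons => + xn.
  have [->//|_] := eqVneq x c; rewrite /= -mem_cat => xR.
  by apply: h4 => //; apply: word_dims_sub.
Qed.

Definition wproj (M N : gsp) (w : wdg M N) : N := w.2.
Definition wswap (M N : gsp) (w : wdg M N) : wdg N M := (w.2, w.1).

(** The loops are taken on the smaller wedge, and its spheres feed the rounds that start from [S^m].
    As this wedge is not a point, each round adds [m - 1] to the dimension, and every admissible
    dimension up to [n.+2] is reached. *)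
Lemma last_sphere_kernel n m k : (1 < m)%N ->
  exists (G : zmodType)
    (j : G -> piG n (wdg (Sn unit_cs m) (bw unit_cs (nseq k.+1 m)))) (l : seq nat),
  [/\ forall x y, j (x + y) = j x + j y, forall x, j x = 0 -> x = 0,
      forall x, pif (@wproj _ _) (j x) = 0 &
      forall g, pif (@wproj _ _) g = 0 -> exists x, j x = g] /\
  [/\ sph_prod n G l, all (fun x => hdim m x && (x <= n.+2)%N) l &
      forall x, hdim m x -> (x <= n.+2)%N -> x \in l].
Proof.
move=> m1; pose e := nseq k.+1 m; pose D := word_dims e n.+3 [:: m].
pose X := bw unit_cs e.
have eE x : x \in e -> x = m by rewrite mem_nseq => /andP[_ /eqP].
have [|l [l1 l2 l3]] := @hilton n m D m1.
  apply: all_word_dims => [a d ha /eE ->|]; last by rewrite /= hdim_id.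
  by apply: hdim_add => //; [exact: hdim_id|lia].
have Dfull x : hdim m x -> (x <= n.+2)%N -> x \in D.
  move=> /andP[/dvdnP [i hi] mx] xn.
  have i0 : (0 < i)%N by case: i hi => //; lia.
  have -> : x = (m + i.-1 * m.-1)%N by nia.
  by apply: mem_word_dims; rewrite ?mem_nseq ?mem_head ?eqxx//; nia.
have [phi phiP] : is_wellp (Sn unit_cs m).
  by elim: (m) => [|p IH] /=; [exact: wellp_Pls|exact: wellp_Sus].
have [j [jD j0 pj jk]] := @wedge_kernel X _ _ phiP n.
have psw (A B : gsp) : pmap (@wswap A B).
  by split=> // u x [[h1 h2] h3 h4]; split; [split|case: h3; [right|left]|
    apply: ev_mp h4 => i []; [right|left]].
pose S := Sn unit_cs m.
have sw := psw X S; have sw' := psw S X.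
have p1 := pmap_wdg1 X S; have p2 : pmap (@wproj S X) := pmap_wdg2 S X.
pose s : piG n (wdg X S) -> piG n (wdg S X) := pif (@wswap X S).
pose s' : piG n (wdg S X) -> piG n (wdg X S) := pif (@wswap S X).
have sK A : s' (s A) = A.
  rewrite /s /s' pif_comp// -[RHS]pif_id; congr pif; apply/funext; by case.
have s'K A : s (s' A) = A.
  rewrite /s /s' pif_comp// -[RHS]pif_id; congr pif; apply/funext; by case.
have sD x y : s (x + y) = s x + s y by exact: pif_add.
have s'0 : s' 0 = 0 by exact: pif0.
exists (piG n (Half S (loops X))), (fun x => s (j x)), l; split; split=> //.
- by move=> x y; rewrite jD sD.
- by move=> x h; apply: j0; rewrite -(sK (j x)) h s'0.
- by move=> x; rewrite /s pif_comp//; exact: pj.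
- move=> g hg; have [|x hx] := jk (s' g); first by rewrite /s' pif_comp.
  by exists x; rewrite hx s'K.
- apply: sph_prod_giso l1.
  have e1 : all (fun d => 1 < d)%N e by apply/allP => x /eE ->.
  have h0 : all (fun d => 0 < d)%N [:: m] by rewrite /= andbT ltnW.
  have hn : all (fun d => n.+2 < d + n.+3)%N [:: m] by rewrite /= andbT; lia.
  apply: giso_trans (giso_heq n (heq_Half_Sn _ m)) _.
  apply: giso_trans (giso_heq n (heq_sym (heq_trans (heq_wdgC _ _) (heq_wdg_Pt _)))) _.
  apply: giso_trans (giso_heq n (heq_sym (heq_wdg_Pt _))) _.
  apply: giso_trans (giso_bw_loops Pt e1 h0 hn) _.
  exact: giso_heq (heq_wdg_Pt _).
- by move=> x hx xn; apply: l3 => //; exact: Dfull.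
Qed.

(** * Topological spaces as convergence spaces *)

Section Top.
Context (X : topologicalType).

Definition top_cv (u : nat -> X) (x : X) : Prop :=
  forall U, nbhs x U -> ev (fun k => U (u k)).

Definition top_cs : cs.
Proof.
refine (@Cs X top_cv _ _ _ _).
- by move=> P u v x hu hv U xU; apply: ev_mp2 (hu U xU) (hv U xU) => k; case: (P k).
- by move=> u v x h hu U xU; apply: ev_mp2 h (hu U xU) => k <-.
- by move=> u x _ U xU; apply: evT => _; exact: nbhs_singleton.
- by move=> u x _; apply: evT => k U xU; apply: evT => _; exact: nbhs_singleton.
Defined.

Lemma val_top (x : top_cs) : val x.
Proof. by move=> U xU; apply: evT => _; exact: nbhs_singleton. Qed.

Definition Top (x0 : X) : pcs := @Pcs top_cs x0 (@val_top x0).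

End Top.

Lemma cts_Top (X Y : topologicalType) (h : X -> Y) : continuous h ->
  @cts (top_cs X) (top_cs Y) h.
Proof. move=> ch u x hu U xU; exact: (hu (h @^-1` U) (ch x U xU)). Qed.

(** Sequences suffice since the domain is pseudometric; nothing is asked of the target. This is the
    bridge between the two notions of continuity. *)
Lemma seq_withinP (T : pseudoMetricType RR) (X : topologicalType) (A : set T) (g : T -> X) :
  {within A, continuous g} <->
  (forall x u, A x -> (forall k, A (u k)) ->
     (forall e, 0 < e -> ev (fun k => ball x e (u k))) ->
     @top_cv X (fun k => g (u k)) (g x)).
Proof.
rewrite subspace_continuousP; split.
  move=> h x u Ax Au hu U xU; have /nbhs_ballP [e /= e0 he] := h x Ax U xU.
  by apply: ev_mp (hu e e0) => k /he; apply.
move=> h x Ax U xU; apply: contrapT => no.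
have /choice [u hu] : forall k : nat, exists y,
    [/\ A y, ball x k.+1%:R^-1 y & ~ U (g y)].
  move=> k; apply: contrapT => h2; apply: no; apply/nbhs_ballP.
  exists k.+1%:R^-1; first by rewrite /= invr_gt0.
  by move=> y xy Ay; apply: contrapT => nU; apply: h2; exists y.
have [||N hN] := h x u Ax _ _ U xU.
- by move=> k; have [] := hu k.
- move=> e e0; have [N hN] := harmonic_small e0; exists N => k Nk.
  have [_ hk _] := hu k; apply: le_ball hk.
  exact: le_trans (harmonic_le Nk) (ltW hN).
by have [_ _] := hu N; apply; exact: hN.
Qed.

Lemma ev_ord n (P : 'I_n -> nat -> Prop) : (forall i, ev (P i)) ->
  ev (fun k => forall i, P i k).
Proof.
move=> /choice [N hN]; exists (\max_i N i) => k hk i; apply: hN.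
exact: leq_trans (leq_bigmax i) hk.
Qed.

Lemma cv_vecP n (u : nat -> vec n) (x : vec n) :
  cv u x <-> forall e, 0 < e -> ev (fun k => ball (x : 'rV[RR]_n) e (u k : 'rV[RR]_n)).
Proof.
split=> [h e e0|h i e e0].
  apply: ev_mp (ev_ord (fun i => h i e e0)) => k hk; split=> // i j.
  by rewrite ord1 /ball /= distrC.
by apply: ev_mp (h e e0) => k [_ /(_ ord0 i)]; rewrite /ball /= distrC.
Qed.

Section Link.
Context (n : nat) (X : topologicalType) (x0 : X).
Implicit Types f g : 'rV[RR]_n -> X.

Lemma bd_cube (t : 'rV[RR]_n) : cube n t -> bd t -> cube_bdry n t.
Proof.
move=> ct [i hi]; exists i; have := ct i; move: hi; rewrite negb_and -!leNgt.
by move=> /orP[] h /andP[h1 h2]; [left|right]; apply/eqP; rewrite eq_le ?h ?h1 ?h2.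
Qed.

Lemma cube_bdry_bd (t : 'rV[RR]_n) : cube_bdry n t -> bd t.
Proof. by move=> [i [] e]; exists i; rewrite e ltxx ?andbF. Qed.


Lemma cube_cl_cube (t : 'rV[RR]_n) : cube n (cube_cl t).
Proof. by move=> i; rewrite mxE; exact: cl01. Qed.

Lemma cube_cl_id (t : 'rV[RR]_n) : cube n t -> cube_cl t = t.
Proof. by move=> ct; apply/rowP => i; rewrite mxE cl_id//; exact: ct. Qed.

Lemma cv_cube_cl (u : nat -> vec n) (x : vec n) : cv u x ->
  cv (fun k => cube_cl (u k) : vec n) (cube_cl x).
Proof.
move=> h i; rewrite mxE.
by apply: rcv_tail (rcv_cl (h i)); apply: evT => k; rewrite mxE.
Qed.

(** Clamping extends a map from the cube to the whole space and sends everything off the open cube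
    to the boundary, so a [sphmap] becomes a spheroid. *)
Definition ext0 f : vec n -> Top x0 := fun t => f (cube_cl t).

Lemma ext0_cube f t : cube n t -> ext0 f t = f t.
Proof. by move=> ct; rewrite /ext0 cube_cl_id. Qed.

Lemma sph_ext0P f : sphmap n x0 f <-> sph (ext0 f).
Proof.
split=> [[/seq_withinP cf f0]|[cf f0]].
  split=> [u x h|t bt]; last first.
    apply: f0; first exact: cube_cl_cube.
    by apply: bd_cube; [exact: cube_cl_cube|exact: bd_cl].
  apply: (cf (cube_cl x) (fun k => cube_cl (u k))) => [|k|]; try exact: cube_cl_cube.
  by apply/cv_vecP; exact: cv_cube_cl.
split=> [|t ct bt]; last by rewrite -ext0_cube// f0//; exact: cube_bdry_bd.
apply/seq_withinP => x u cx cu /cv_vecP h; rewrite -ext0_cube//.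
apply: (@cv_tail (Top x0) (fun k => ext0 f (u k))); last exact: cf.
by apply: evT => k; rewrite ext0_cube.
Qed.

Lemma shom_ext0P f g : homot n x0 f g <-> shom (ext0 f) (ext0 g).
Proof.
split=> [[H [/seq_withinP cH [H0 [H1 Hb]]]]|[H [cH Hb H0 H1]]].
  exists (fun s t => H (cl s, cube_cl t)); split.
  - move=> u [s t] [[h1 _ _] h2].
    apply: (cH (cl s, cube_cl t) (fun k => (cl (u k).1, cube_cl (u k).2))) => [|k|e e0].
    + by split; [exact: cl01|exact: cube_cl_cube].
    + by split; [exact: cl01|exact: cube_cl_cube].
    + have /cv_vecP /(_ e e0) := cv_cube_cl h2.
      apply: ev_mp2 (rcv_cl h1 e0) => k a b; split=> //.
      by rewrite /ball /= distrC.
  - move=> s t hs bt; apply: Hb; [exact: cl01|exact: cube_cl_cube|].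
    by apply: bd_cube; [exact: cube_cl_cube|exact: bd_cl].
  - by move=> t _; rewrite cl_le0// H0//; exact: cube_cl_cube.
  - by move=> t _; rewrite cl_ge1// H1//; exact: cube_cl_cube.
exists (fun p => H p.1 p.2); split; last split; last split.
- apply/seq_withinP => -[s t] u [/= hs ct] hu h.
  apply: (cH (fun k => ((u k).1, (u k).2)) (s, t)); split.
    split=> //; last by apply: evT => k; have [] := hu k.
    by move=> e e0; apply: ev_mp (h e e0) => k [a _]; rewrite distrC.
  by apply/cv_vecP => e e0; apply: ev_mp (h e e0) => k [].
- by move=> t ct; rewrite H0 ?ext0_cube//; exact: val_vec.
- by move=> t ct; rewrite H1 ?ext0_cube//; exact: val_vec.
- by move=> s t hs ct bt; apply: Hb => //; exact: cube_bdry_bd.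
Qed.

Lemma hclass_eqP f g : sphmap n x0 f -> sphmap n x0 g ->
  (hclass n x0 f = hclass n x0 g <-> shom (ext0 f) (ext0 g)).
Proof.
move=> sf sg; split=> [e|h].
  apply/shom_ext0P; suff : hclass n x0 f g by case.
  by rewrite e; split=> //; apply/shom_ext0P/shom_refl/sph_ext0P.
apply/seteqP; split=> k [sk /shom_ext0P hk]; split=> //; apply/shom_ext0P.
  by apply: rhom_trans hk; exact: rhom_sym.
exact: rhom_trans hk.
Qed.

Lemma pin_eq (A B : pin n x0) : sval A = sval B -> A = B.
Proof. by move: A B => [A pA] [B pB] /= e; subst B; congr exist; exact: Prop_irrelevance. Qed.

Lemma pin_repP (A : pin n x0) : sphmap n x0 (pin_rep n x0 A) /\
  sval A = hclass n x0 (pin_rep n x0 A).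
Proof. by rewrite /pin_rep; case: cid. Qed.

Lemma sval_pin_of f : sphmap n x0 f -> sval (pin_of n x0 f) = hclass n x0 f.
Proof. by rewrite /pin_of; case: pselect. Qed.

Definition pin_pi (A : pin n x0) : pi n (Top x0) := cls (ext0 (pin_rep n x0 A)).

Lemma pin_pi_of f : sphmap n x0 f -> pin_pi (pin_of n x0 f) = cls (ext0 f).
Proof.
move=> sf; have [sr er] := pin_repP (pin_of n x0 f).
apply/cls_eqP; [exact/sph_ext0P|exact/sph_ext0P|].
by apply/hclass_eqP => //; rewrite -er sval_pin_of.
Qed.

Lemma pin_pi_inj : injective pin_pi.
Proof.
move=> A B; have [sA eA] := pin_repP A; have [sB eB] := pin_repP B.
move=> /cls_eqP h; apply: pin_eq; rewrite eA eB; apply/hclass_eqP => //.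
by apply: h; exact/sph_ext0P.
Qed.

Lemma ext0_sph (g : vec n -> Top x0) : sph g -> ext0 g = g.
Proof.
move=> [_ g0]; apply/funext => t; rewrite /ext0.
have [b|/nbd_cl ->//] := pselect (bd t).
by rewrite !g0//; exact: bd_cl.
Qed.

Lemma pin_pi_surj (C : pi n (Top x0)) : exists A, pin_pi A = C.
Proof.
have sr := sph_rep C; exists (pin_of n x0 (rep C)).
have e := ext0_sph sr; rewrite pin_pi_of ?e ?cls_rep//.
by apply/sph_ext0P; rewrite e.
Qed.

End Link.

Lemma pin_pi_map n (X Y : topologicalType) (x0 : X) (y0 : Y) (h : X -> Y)
    (A : pin n.+2 x0) : continuous h -> h x0 = y0 ->
  pin_pi (pin_map n.+2 h A : pin n.+2 y0) = pif (h : Top x0 -> Top y0) (pin_pi A).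
Proof.
move=> ch h0; have [sA _] := pin_repP A; have /sph_ext0P sA' := sA.
have ph : @pmap (Top x0) (Top y0) h by split=> //; exact: cts_Top.
rewrite /pin_map pin_pi_of; last by apply/sph_ext0P; exact: (sph_map ph sA').
by rewrite -/(clsG _) -/(clsG _) pif_cls.
Qed.

Lemma pin_pi_mul n (X : topologicalType) (x0 : X) (A B : pin n.+2 x0) :
  pin_pi (pin_mul n.+2 x0 A B) = (pin_pi A : piG n (Top x0)) + pin_pi B.
Proof.
have [/sph_ext0P sA _] := pin_repP A; have [/sph_ext0P sB _] := pin_repP B.
have e : ext0 x0 (concat n.+2 (pin_rep n.+2 x0 A) (pin_rep n.+2 x0 B)) =
    cat ord0 (ext0 x0 (pin_rep n.+2 x0 A)) (ext0 x0 (pin_rep n.+2 x0 B)).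
  apply/funext => t; rewrite /ext0 /concat /cat.
  have -> : [exists i : 'I_n.+2, ((i : nat) == 0%N) && (cube_cl t ord0 i <= 2^-1)] =
      (t ord0 ord0 <= 2^-1).
    apply/existsP/idP => [[i /andP[/eqP i0]]|h].
      have -> : i = ord0 by apply: val_inj.
      by rewrite mxE /cl; minmax; lra.
    by exists ord0; rewrite eqxx mxE /=; move: h; rewrite /cl; minmax; lra.
  case: ifPn => h; congr (pin_rep n.+2 x0 _); apply/rowP => i;
    rewrite !mxE -[(i : nat) == 0%N]/(i == ord0); case: eqVneq => // -> ;
    by move: h; rewrite -?ltNge /cl; minmax; lra.
rewrite /pin_mul pin_pi_of ?e; first exact: esym (clsG_add sA sB).
by apply/sph_ext0P; rewrite e; exact: cat_sph.
Qed.

(** * Stereographic projection *)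

Definition crush (p : RR) : RR := 2^-1 + p / (2 * (1 + `|p|)).
Definition uncrush (s : RR) : RR := (2 * s - 1) / (1 - `|2 * s - 1|).

Lemma crushE p : 2 * crush p - 1 = p / (1 + `|p|).
Proof.
have : 1 + `|p| != 0 by rewrite gt_eqF// ltr_pwDl.
by rewrite /crush => h; field.
Qed.

Lemma crush01 p : 0 < crush p < 1.
Proof.
have h : 0 < 1 + `|p| by rewrite ltr_pwDl.
have := crushE p; have : `|p / (1 + `|p|)| < 1.
  by rewrite normrM normfV (gtr0_norm h) ltr_pdivrMr// mul1r ltrDr.
by rewrite ltr_norml; lra.
Qed.

Lemma crushK p : uncrush (crush p) = p.
Proof.
have h : 0 < 1 + `|p| by rewrite ltr_pwDl.
rewrite /uncrush crushE normrM normfV (gtr0_norm h).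
by field; rewrite gt_eqF//= addrK oner_eq0.
Qed.

Lemma uncrushK s : 0 < s < 1 -> crush (uncrush s) = s.
Proof.
move=> hs; have h : `|2 * s - 1| < 1 by rewrite ltr_norml; lra.
have h0 : 0 < 1 - `|2 * s - 1| by lra.
suff : 2 * crush (uncrush s) - 1 = 2 * s - 1 by lra.
rewrite crushE /uncrush normrM normfV (gtr0_norm h0).
by field; rewrite gt_eqF//= subrK oner_eq0.
Qed.

Lemma rcv_crush u a : rcv u a -> rcv (fun k => crush (u k)) (crush a).
Proof.
move=> h; apply: rcvD; first exact: rcv_cst.
apply: rcvM => //; apply: rcvV; last by rcvt; exact: rcv_norm.
by rewrite mulf_neq0 ?pnatr_eq0// gt_eqF// ltr_pwDl.
Qed.

Lemma rcv_uncrush u a : 0 < a < 1 -> rcv u a -> rcv (fun k => uncrush (u k)) (uncrush a).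
Proof.
move=> a01 h; have h' : rcv (fun k => 2 * u k - 1) (2 * a - 1) by rcvt.
apply: rcvM => //; apply: rcvV; last by rcvt; exact: rcv_norm.
have : `|2 * a - 1| < 1 by rewrite ltr_norml; lra.
by move=> ?; rewrite gt_eqF//; lra.
Qed.

(** A gauge of at least [e] bounds the stereographic coordinates by [2 / e]; this controls the pole
    in one direction. *)
Lemma bump_crush p : bump (crush p) * (1 + `|p|) <= 2.
Proof.
have h : 0 < 1 + `|p| by rewrite ltr_pwDl.
have E : (2 * crush p - 1) * (1 + `|p|) = p by rewrite crushE divfK ?gt_eqF.
have b : bump (crush p) <= 4 * crush p by have := crush01 p; rewrite /bump /cl; minmax; lra.
have b' : bump (crush p) <= 4 * (1 - crush p).
  by have := crush01 p; rewrite /bump /cl; minmax; lra.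
move: (crush p) (bump _) b b' E => s c b b' E; have [p0|p0] := lerP 0 p.
  have := ler_wpM2r (ltW h) b'; move: E h; rewrite ger0_norm// => E h; nra.
have := ler_wpM2r (ltW h) b; move: E h; rewrite ltr0_norm// => E h; nra.
Qed.

(** The opposite control at the pole: a small gauge forces a large stereographic coordinate. *)
Lemma uncrush_big s c : 0 < c <= 1 -> 0 < s < 1 -> bump s < c -> c^-1 <= uncrush s ^+ 2.
Proof.
move=> c01 s01 sc; have [c0 c1] := andP c01.
have ab : `|2 * s - 1| < 1 /\ 1 - `|2 * s - 1| < c / 2.
  have := ler_norm (2 * s - 1); have := ler_norm (- (2 * s - 1)).
  rewrite normrN => h1 h2; split; first by rewrite ltr_norml; lra.
  by case: (bump_lt c1 sc) => h; lra.
have -> : uncrush s ^+ 2 = (`|2 * s - 1| / (1 - `|2 * s - 1|)) ^+ 2.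
  by rewrite /uncrush !expr_div_n real_normK// num_real.
move: `|2 * s - 1| ab => z [z1 z2].
have cz : c^-1 <= z / (1 - z).
  rewrite ler_pdivlMr; last by lra.
  by rewrite mulrC ler_pdivrMr//; nra.
have ci : 1 <= c^-1 by rewrite -[X in X <= _]invr1 lef_pV2 ?posrE.
by apply: (le_trans cz); rewrite expr2 ler_peMl//; lra.
Qed.

Lemma cv_SphP d (u : nat -> Top (sph_pt d)) (x : Top (sph_pt d)) :
  cv u x <-> cv (fun k => set_val (u k : Sph d) : vec d.+1) (set_val (x : Sph d)).
Proof.
split=> [h|/cv_vecP h U].
  apply/cv_vecP => e e0; apply: (h (fun y : Sph d => ball (set_val x) e (set_val y))).
  have /(_ x) := @initial_continuous _ _ (set_val : Sph d -> 'rV[RR]_d.+1).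
  by apply; exact: nbhsx_ballx.
rewrite nbhsE => -[B [[A oA <-] Ax] BU].
have /nbhs_ballP [e /= e0 he] : nbhs (set_val x) A by exact: open_nbhs_nbhs.
by apply: ev_mp (h e e0) => k /he/BU.
Qed.

Section Stereo.
Context (d : nat).
Local Notation T := (Top (sph_pt d)).

Definition scoord (x : Sph d) (i : 'I_d.+1) : RR := set_val x ord0 i.

Lemma scoord_sum x : scoord x ord0 ^+ 2 + \sum_i scoord x (lift ord0 i) ^+ 2 = 1.
Proof. by have := set_valP x; rewrite /sphere_set /= big_ord_recl. Qed.

Lemma scoord_le x i : scoord x (lift ord0 i) ^+ 2 <= 1 - scoord x ord0 ^+ 2.
Proof.
have := scoord_sum x; rewrite (bigD1 i)//=.
have : 0 <= \sum_(j < d | j != i) scoord x (lift ord0 j) ^+ 2.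
  by apply: sumr_ge0 => j _; exact: sqr_ge0.
lra.
Qed.

Lemma scoord_inj x y : scoord x =1 scoord y -> x = y.
Proof. by move=> h; apply: val_inj; apply/rowP => i; exact: h. Qed.

Lemma scoord_pt i : scoord (sph_pt d) i = (i == ord0)%:R.
Proof. by rewrite /scoord /= mxE. Qed.

Lemma scoord_pt0 : scoord (sph_pt d) ord0 = 1.
Proof. by rewrite scoord_pt eqxx. Qed.

Lemma scoord_eq1 x : scoord x ord0 = 1 -> x = sph_pt d.
Proof.
move=> h; apply: scoord_inj => i; rewrite scoord_pt.
case: (unliftP ord0 i) => [j ->|->]; last by rewrite eqxx.
have := scoord_le x j; rewrite h expr1n subrr => h2.
rewrite eq_sym (negbTE (neq_lift _ _)).
by apply/eqP; rewrite -sqrf_eq0 eq_le h2 sqr_ge0.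
Qed.

Definition psum (p : 'I_d -> RR) : RR := \sum_i p i ^+ 2.

Lemma psum_ge0 p : 0 <= psum p.
Proof. by apply: sumr_ge0 => i _; exact: sqr_ge0. Qed.

Lemma psum_neq0 p : psum p + 1 != 0.
Proof. by rewrite gt_eqF// ltr_wpDl// psum_ge0. Qed.

Definition unproj_row (p : 'I_d -> RR) : 'rV[RR]_d.+1 := \row_i
  if unlift ord0 i is Some j then 2 * p j / (psum p + 1)
  else (psum p - 1) / (psum p + 1).

Lemma unproj_in p : unproj_row p \in sphere_set d.
Proof.
apply/mem_set; rewrite /sphere_set /= big_ord_recl mxE unlift_none.
have -> : \sum_(i < d) unproj_row p ord0 (lift ord0 i) ^+ 2 =
    4 * psum p / (psum p + 1) ^+ 2.
  rewrite {1}/psum mulr_sumr mulr_suml; apply: eq_bigr => i _.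
  by rewrite mxE liftK; field; exact: psum_neq0.
by field; exact: psum_neq0.
Qed.

Definition unproj p : Sph d := exist _ (unproj_row p) (unproj_in p).

Lemma unproj0 p : scoord (unproj p) ord0 = (psum p - 1) / (psum p + 1).
Proof. by rewrite /scoord /= mxE unlift_none. Qed.

Lemma unprojS p i : scoord (unproj p) (lift ord0 i) = 2 * p i / (psum p + 1).
Proof. by rewrite /scoord /= mxE liftK. Qed.

Definition proj (x : Sph d) (i : 'I_d) : RR :=
  scoord x (lift ord0 i) / (1 - scoord x ord0).

Lemma psum_proj x : scoord x ord0 != 1 ->
  psum (proj x) * (1 - scoord x ord0) = 1 + scoord x ord0.
Proof.
move=> x1; have x1' : 1 - scoord x ord0 != 0 by rewrite subr_eq0 eq_sym.
have -> : psum (proj x) = (1 - scoord x ord0 ^+ 2) / (1 - scoord x ord0) ^+ 2.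
  rewrite -{1}(scoord_sum x) addrAC subrr add0r mulr_suml; apply: eq_bigr => i _.
  by rewrite /proj expr_div_n.
by field.
Qed.

Lemma projK x : scoord x ord0 != 1 -> unproj (proj x) = x.
Proof.
move=> x1; have x1' : 1 - scoord x ord0 != 0 by rewrite subr_eq0 eq_sym.
have N : psum (proj x) = (1 + scoord x ord0) / (1 - scoord x ord0).
  by rewrite -psum_proj// mulfK.
apply: scoord_inj => i; case: (unliftP ord0 i) => [j ->|->].
  by rewrite unprojS N /proj; field; rewrite x1' ?andbT /=; apply/eqP => h; lra.
by rewrite unproj0 N; field; rewrite x1' ?andbT /=; apply/eqP => h; lra.
Qed.

Lemma unproj0_neq1 p : scoord (unproj p) ord0 != 1.
Proof.
rewrite unproj0 -subr_eq0 (_ : _ - 1 = - 2 / (psum p + 1)).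
  by rewrite mulf_neq0 ?invr_eq0 ?psum_neq0// oppr_eq0 pnatr_eq0.
by field; exact: psum_neq0.
Qed.

Lemma unprojK p i : proj (unproj p) i = p i.
Proof.
rewrite /proj unprojS unproj0; field; rewrite psum_neq0 /=.
by apply/eqP => h; lra.
Qed.

Definition to_flat (x : T) : flat unit_cs d :=
  if scoord x ord0 == 1 then None else Some (fun i => crush (proj x i), tt).

Definition of_flat (y : flat unit_cs d) : T :=
  if y is Some (y, _) then unproj (fun i => uncrush (y i)) else sph_pt d.

Lemma cv_scoord (u : nat -> T) (x : T) i : cv u x ->
  rcv (fun k => scoord (u k) i) (scoord x i).
Proof. by move=> /cv_SphP h; exact: h. Qed.

Lemma val_to_flat (x : T) : val (to_flat x).
Proof.
rewrite /to_flat; case: ifP => _; first exact: (val_pt (flat unit_cs d)).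
by apply/val_flat; split=> //; apply: mbump_gt0 => i; rewrite bump_gt0 crush01.
Qed.

Lemma pmap_to_flat : pmap to_flat.
Proof.
split; last by rewrite /to_flat [scoord _ _]scoord_pt0 eqxx.
move=> u x h; have h0 := cv_scoord ord0 h; rewrite {2}/to_flat.
case: ifPn => [/eqP x1|x1].
  split; first by apply: evT => k; apply/val_CQ; exact: val_to_flat.
  (* At gauge [e] or more, [psum] would be at most [C]; but it is the quotient of [1 + x_0] by
     [1 - x_0], which exceeds [C] near the pole. *)
  move=> e e0; pose C := d%:R * (2 / e) ^+ 2.
  have hC : rcv (fun k => (1 + scoord (u k) ord0) - C * (1 - scoord (u k) ord0)) 2.
    have -> : (2 : RR) = (1 + scoord x ord0) - C * (1 - scoord x ord0).
      by rewrite x1 subrr mulr0 subr0.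
    by rcvt.
  have p2 : (0 : RR) < 2 by [].
  apply: ev_mp (ev_gt hC p2) => k hk.
  rewrite subr0 ger0_norm; last by case/andP: (ou01 (@flatv01 unit_cs d) (to_flat (u k))).
  rewrite /to_flat; case: ifPn => uk //=; rewrite ltNge; apply/negP => he.
  suff : psum (proj (u k)) <= C.
    have u1 : 0 <= 1 - scoord (u k) ord0.
      have := scoord_sum (u k); have := psum_ge0 (fun i => scoord (u k) (lift ord0 i)).
      by rewrite /psum => h1 h2; nra.
    by move=> /(ler_wpM2r u1); rewrite psum_proj//; lra.
  have -> : C = \sum_(i < d) (2 / e) ^+ 2 by rewrite sumr_const card_ord -[RHS]mulr_natl.
  apply: ler_sum => i _; have := bump_crush (proj (u k) i).
  have h1 := le_trans he (mbump_le _ i); rewrite /= in h1.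
  move=> h2; rewrite -(real_normK (num_real (proj (u k) i))).
  apply: lerXn2r; rewrite ?nnegrE// ?divr_ge0//; first exact: ltW.
  rewrite ler_pdivlMr//; have := normr_ge0 (proj (u k) i).
  move: `|_| h2 => z h2 z0; nra.
have vx := val_to_flat x; rewrite /to_flat (negbTE x1) in vx.
have /val_flat [_ m0] := vx; split; first exact: m0.
exists (fun k => ((fun i => crush (proj (u k) i)), tt)).
  split=> // i; apply: rcv_crush; apply: rcvM; first exact: cv_scoord.
  by apply: rcvV; [rewrite subr_eq0 eq_sym|rcvt].
have : ev (fun k => scoord (u k) ord0 != 1).
  have n0 : 0 < `|scoord x ord0 - 1| by rewrite normr_gt0 subr_eq0.
  have h1 : rcv (fun k => `|scoord (u k) ord0 - 1|) `|scoord x ord0 - 1|.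
    by apply: rcv_norm; rcvt.
  by apply: ev_mp (ev_gt h1 n0) => k; rewrite normr_gt0 subr_eq0.
by apply: ev_mp => k hk; rewrite /to_flat (negbTE hk).
Qed.

Lemma cv_sph_pt (u : nat -> T) : rcv (fun k => scoord (u k) ord0) 1 -> cv u (sph_pt d).
Proof.
move=> h; apply/cv_SphP => i; rewrite -/(scoord _ _) scoord_pt.
case: (unliftP ord0 i) => [j ->|->]; last by rewrite eqxx.
rewrite eq_sym (negbTE (neq_lift _ _)).
move=> e e0; have e2 : 0 < e ^+ 2 by rewrite exprn_gt0.
have h1 : rcv (fun k => 1 - scoord (u k) ord0 ^+ 2) 0.
  have -> : (0 : RR) = 1 - 1 * 1 by rewrite mulr1 subrr.
  by rcvt.
apply: ev_mp (ev_lt h1 e2) => k hk; rewrite subr0.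
have := le_lt_trans (scoord_le (u k) j) hk.
rewrite -(real_normK (num_real (scoord (u k) (lift ord0 j)))) => h2.
by rewrite ltNge; apply/negP => h3; move: h2; rewrite ltNge => /negP; apply;
  apply: lerXn2r; rewrite ?nnegrE// ltW.
Qed.

Lemma pmap_of_flat : pmap of_flat.
Proof.
split=> // w [[y []]|] h.
  have [m0 [z [hz _] hw]] := h.
  have y01 i : 0 < y i < 1.
    by rewrite -bump_gt0; apply: lt_le_trans m0 (mbump_le _ _).
  apply: (@cv_tail T (fun k => unproj (fun i => uncrush ((z k).1 i)))).
    by apply: ev_mp hw => k ->; case: (z k).
  have hp i : rcv (fun k => uncrush ((z k).1 i)) (uncrush (y i)).
    by apply: rcv_uncrush => //; exact: hz.
  have hN : rcv (fun k => psum (fun i => uncrush ((z k).1 i))) (psum (fun i => uncrush (y i))).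
    by apply: rcv_sum => i; apply: rcvM.
  apply/cv_SphP => i; rewrite -/(scoord _ _).
  case: (unliftP ord0 i) => [j ->|->].
    rewrite unprojS; apply: (@rcv_tail (fun k => 2 * uncrush ((z k).1 j) /
        (psum (fun i => uncrush ((z k).1 i)) + 1))).
      by apply: evT => k; rewrite -/(scoord _ _) unprojS.
    apply: rcvM; first by apply: rcvM; [exact: rcv_cst|exact: hp].
    by apply: rcvV; [exact: psum_neq0|rcvt].
  rewrite unproj0; apply: (@rcv_tail (fun k => (psum (fun i => uncrush ((z k).1 i)) - 1) /
      (psum (fun i => uncrush ((z k).1 i)) + 1))).
    by apply: evT => k; rewrite -/(scoord _ _) unproj0.
  apply: rcvM; first by rcvt.
  by apply: rcvV; [exact: psum_neq0|rcvt].
have [ho hu] := h; apply: cv_sph_pt => e e0.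
(* Gauge below [c] gives [psum >= 1 / c], so the zeroth coordinate differs from 1 by
   [2 / (psum + 1)], which is less than [2 * c] and hence than [e]. *)
pose c := Num.min 1 (e / 3).
have c01 : 0 < c <= 1 by rewrite /c; minmax; lra.
have c0 : 0 < c by case/andP: c01.
have ce : c <= e / 3 by rewrite /c; minmax; lra.
apply: ev_mp2 ho (ev_lt hu c0) => k; case: (w k) => [[y []]|] /=; last first.
  by move=> _ _; rewrite scoord_pt0 subrr normr0.
move=> [_ m0] mc; have [|i hi] := mbump_lt mc; first by case/andP: c01.
have y01 : 0 < y i < 1.
  by rewrite -bump_gt0; apply: lt_le_trans m0 (mbump_le _ _).
have := uncrush_big c01 y01 hi.
have : uncrush (y i) ^+ 2 <= psum (fun i => uncrush (y i)).
  rewrite /psum (bigD1 i)//= lerDl; apply: sumr_ge0 => j _; exact: sqr_ge0.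
have N0 := psum_neq0 (fun i => uncrush (y i)).
rewrite unproj0; move: (psum _) N0 => N N0 h1 h2.
have h3 := le_trans h2 h1.
have ci : 0 < c^-1 by rewrite invr_gt0.
have N1 : 0 < N + 1 by lra.
have -> : (N - 1) / (N + 1) - 1 = - (2 / (N + 1)) by field.
rewrite normrN gtr0_norm ?divr_gt0// ltr_pdivrMr//.
have : 1 <= N * c by rewrite -ler_pdivrMr// mul1r.
have := ce; nra.
Qed.

Lemma sphere_flat : inv_pair to_flat of_flat.
Proof.
split; [exact: pmap_to_flat|exact: pmap_of_flat| |].
- move=> x _; rewrite /to_flat; case: ifPn => [/eqP/scoord_eq1 ->//|x1].
  rewrite /of_flat -[RHS]projK//; congr unproj; apply/funext => i; exact: crushK.
- move=> [[y []]|]; last by move=> _; rewrite /to_flat [scoord _ _]scoord_pt0 eqxx.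
  move=> /val_flat [_ m0]; rewrite /to_flat /of_flat (negbTE (unproj0_neq1 _)).
  congr (Some (_, _)); apply/funext => i; rewrite unprojK uncrushK//.
  by rewrite -bump_gt0; apply: lt_le_trans m0 (mbump_le _ _).
Qed.

End Stereo.

Lemma sphere_Sn d : exists (f : Top (sph_pt d) -> Sn unit_cs d)
  (g : Sn unit_cs d -> Top (sph_pt d)), inv_pair f g.
Proof.
have [f [g [pf pg gf fg]]] := flat_Sn unit_cs d.
have h : inv_pair g f by split.
by have := inv_pair_comp (sphere_flat d) h; exists (fun x => g (to_flat x)), (fun y => of_flat (f y)).
Qed.

(** * Finite wedges of spheres *)

Section SphereWedge.
Context (m : nat).
Local Notation wl k i x := (@wedge_lift 'I_k.+1 (fun _ => Sph m) (fun _ => sph_pt m) i x).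

Lemma wl_pt k i : wl k i (sph_pt m) = wedge_pt m k.
Proof. exact: (@wedge_liftE _ _ _ ord0 (sph_pt m) i (sph_pt m)). Qed.

Lemma wl_surj k (w : Wedge m k) : exists i x, w = wl k i x.
Proof.
have : [set: Wedge m k] w by [].
by rewrite -[X in X w]wedgeTE => -[i _ [x _ <-]]; exists i, x.
Qed.

Definition wlast k : Wedge m k -> Sph m :=
  wedge_fun (fun (i : 'I_k.+1) (x : Sph m) => if i == ord_max then x else sph_pt m).

Definition winj k : Wedge m k -> Wedge m k.+1 :=
  wedge_fun (fun (i : 'I_k.+1) (x : Sph m) => wl k.+1 (lift ord_max i) x).

Lemma wlastE k i x : wlast (wl k i x) = if i == ord_max then x else sph_pt m.
Proof. by rewrite /wlast wedge_lift_funE// => a b; do 2 case: ifP. Qed.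

Lemma winjE k i x : winj (wl k i x) = wl k.+1 (lift ord_max i) x.
Proof. by rewrite /winj wedge_lift_funE// => a b; rewrite !wl_pt. Qed.

Lemma bondE k i x : bond m k (wl k.+1 i x) =
  if unlift ord_max i is Some j then wl k j x else wedge_pt m k.
Proof.
rewrite /bond wedge_lift_funE// => a b.
by case: unlift => [?|]; case: unlift => [?|]; rewrite ?wl_pt.
Qed.

Lemma wl_continuous k (i : 'I_k.+1) : continuous (fun x : Sph m => wl k i x).
Proof. by move=> x; apply: (@wedge_lift_continuous _ (fun _ => Sph m) (fun _ => sph_pt m)). Qed.

Lemma wlast_continuous k : continuous (@wlast k).
Proof.
apply: wedge_fun_continuous => [i|a b]; last by do 2 case: ifP.
by case: (i == ord_max) => x; [exact: cvg_id|exact: cst_continuous].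
Qed.

Lemma winj_continuous k : continuous (@winj k).
Proof.
apply: wedge_fun_continuous => [i|a b]; last by rewrite !wl_pt.
exact: wl_continuous.
Qed.

Lemma bond_continuous k : continuous (bond m k).
Proof.
apply: wedge_fun_continuous => [i|a b].
  case: unlift => [j|]; first exact: wl_continuous.
  by move=> x; exact: cst_continuous.
by case: unlift => [?|]; case: unlift => [?|]; rewrite ?wl_pt.
Qed.

Lemma wlast_pt k : wlast (wedge_pt m k) = sph_pt m.
Proof. by rewrite -(wl_pt ord_max) wlastE eqxx. Qed.

Lemma bond_pt k : bond m k (wedge_pt m k.+1) = wedge_pt m k.
Proof. by rewrite -(wl_pt ord_max) bondE unlift_none. Qed.

Lemma winj_pt k : winj (wedge_pt m k) = wedge_pt m k.+1.
Proof. by rewrite -(wl_pt ord0) winjE wl_pt. Qed.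

Lemma lift_maxF k (i : 'I_k.+1) : (lift ord_max i == ord_max :> 'I_k.+2) = false.
Proof. by rewrite eq_sym (negbTE (neq_lift _ _)). Qed.

Lemma wlast_winj k w : wlast (winj w : Wedge m k.+1) = sph_pt m.
Proof. by have [i [x ->]] := wl_surj w; rewrite winjE wlastE lift_maxF. Qed.

Lemma bond_winj k (w : Wedge m k) : bond m k (winj w) = w.
Proof. by have [i [x ->]] := wl_surj w; rewrite winjE bondE liftK. Qed.

Lemma pmap_Top (X Y : topologicalType) (x0 : X) (y0 : Y) (h : X -> Y) :
  continuous h -> h x0 = y0 -> @pmap (Top x0) (Top y0) h.
Proof. by move=> ch h0; split=> //; exact: cts_Top. Qed.

Lemma pmap_pair (P : pcs) (M N : gsp) (a : P -> M) (b : P -> N) :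
  pmap a -> pmap b -> (forall p, a p = pt M \/ b p = pt N) ->
  @pmap P (wdg M N) (fun p => (a p, b p)).
Proof.
move=> [ca a0] [cb b0] ab; split; last by rewrite a0 b0.
have ab' p : wdg_pred ((a p, b p) : wdg M N) by case: (ab p); [left|right].
move=> u x ux; split; [by split; [exact: ca|exact: cb]|exact: ab'|].
by apply: evT => k; exact: ab'.
Qed.

Section Step.
Context (S : gsp) (f : Top (sph_pt m) -> S) (g : S -> Top (sph_pt m)) (fg : inv_pair f g).

Lemma pmap_last k : @pmap (Top (wedge_pt m k)) S (fun w => f (wlast w)).
Proof.
have [pf _ _ _] := fg.
by apply: pmap_comp pf; apply: pmap_Top; [exact: wlast_continuous|exact: wlast_pt].
Qed.

Lemma pmap_wl k : @pmap S (Top (wedge_pt m k)) (fun a => wl k ord_max (g a)).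
Proof.
have [_ pg _ _] := fg.
by apply: (pmap_comp pg); apply: pmap_Top; [exact: wl_continuous|exact: wl_pt].
Qed.

Lemma wedge0_inv_pair : inv_pair
  ((fun w => (f (wlast w), pt Pt)) : Top (wedge_pt m 0) -> wdg S Pt)
  ((fun p => wl 0 ord_max (g p.1)) : wdg S Pt -> Top (wedge_pt m 0)).
Proof.
have [_ _ gf fg'] := fg; split.
- by apply: (pmap_pair (pmap_last 0%N) (pmap_cst _ _)) => w; right.
- exact: (pmap_comp (pmap_wdg1 S Pt) (pmap_wl 0%N)).
- move=> w _; have [i [x ->]] := wl_surj w; rewrite wlastE (ord1 i).
  have e0 : ord_max = ord0 :> 'I_1 by exact: ord1.
  by rewrite e0 eqxx gf//; exact: val_top.
- move=> [a []] /val_wdg [va _ _]; by rewrite wlastE eqxx fg'.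
Qed.

Lemma wedgeS_inv_pair k (N : gsp) (h : Top (wedge_pt m k) -> N)
    (h' : N -> Top (wedge_pt m k)) : inv_pair h h' ->
  inv_pair ((fun w => (f (wlast w), h (bond m k w))) : Top (wedge_pt m k.+1) -> wdg S N)
    (wfold (fun a => wl k.+1 ord_max (g a) : Top (wedge_pt m k.+1)) (fun b => winj (h' b))).
Proof.
have [[_ f0] [_ g0] gf fg'] := fg; move=> [ph ph' h'h hh'].
have h0 : h (wedge_pt m k) = pt N by case: ph.
have h'0 : h' (pt N) = wedge_pt m k by case: ph'.
have {}f0 : f (sph_pt m) = pt S by [].
have {}g0 : g (pt S) = sph_pt m by [].
have W0 : wl k.+1 ord_max (g (pt S)) = winj (h' (pt N)) by rewrite g0 h'0 wl_pt winj_pt.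
split.
- apply: (pmap_pair (pmap_last k.+1)).
    have pb : @pmap (Top (wedge_pt m k.+1)) (Top (wedge_pt m k)) (bond m k).
      by apply: pmap_Top; [exact: bond_continuous|exact: bond_pt].
    exact: (pmap_comp pb ph).
  move=> w; have [i [x ->]] := wl_surj w; rewrite wlastE bondE.
  case: (unliftP ord_max i) => [j ->|_]; last by right.
  by left; rewrite lift_maxF.
- apply: (pmap_wfold (pmap_wl k.+1)); apply: (pmap_comp ph').
  by apply: pmap_Top; [exact: winj_continuous|exact: winj_pt].
- move=> w _; have [i [x ->]] := wl_surj w; rewrite wlastE bondE.
  case: (unliftP ord_max i) => [j ->|->].
    rewrite lift_maxF f0 wfold2//; last by apply: cts_val ph.1 _; exact: val_top.
    by rewrite h'h ?winjE//; exact: val_top.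
  by rewrite eqxx h0 wfold1 gf//; exact: val_top.
- move=> [a b] /val_wdg [/= va vb [/= e|/= e]]; rewrite e.
    by rewrite wfold2// wlast_winj bond_winj f0 hh'.
  by rewrite wfold1 wlastE eqxx fg'// bondE unlift_none h0.
Qed.

End Step.

Context (f : Top (sph_pt m) -> Sn unit_cs m) (g : Sn unit_cs m -> Top (sph_pt m)).
Hypothesis fg : inv_pair f g.

(** The last sphere becomes the first summand and [bond] acts on the rest, so that dropping the
    first summand corresponds to [bond] by computation. *)
Fixpoint to_bw k : Top (wedge_pt m k) -> bw unit_cs (nseq k.+1 m) :=
  match k return Top (wedge_pt m k) -> bw unit_cs (nseq k.+1 m) with
  | 0 => fun w => (f (wlast w), pt Pt)
  | k.+1 => fun w => (f (wlast w), to_bw (bond m k w))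
  end.

Lemma wedge_bw k : exists h, inv_pair (@to_bw k) h.
Proof.
elim: k => [|k [h hh]]; first by exists (fun p => wl 0 ord_max (g p.1)); exact: wedge0_inv_pair fg.
have H := wedgeS_inv_pair fg hh; by eexists; exact: H.
Qed.

End SphereWedge.

(** * Coordinates of the Cech group *)

Lemma dep_choice (I : Type) (T : I -> Type) (P : forall i, T i -> Prop) :
  (forall i, exists x, P i x) -> exists f, forall i, P i (f i).
Proof. by move=> h; exists (fun i => sval (cid (h i))) => i; exact: svalP. Qed.

Lemma pif_inv_pair n (M N : pcs) (f : M -> N) (g : N -> M) : inv_pair f g ->
  cancel (@pif n M N f) (@pif n N M g) /\ cancel (@pif n N M g) (@pif n M N f).
Proof.
move=> [pf pg gf fg]; split=> A; rewrite pif_comp//.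
  rewrite (pif_hom (k := id)) ?pif_id//; [exact: pmap_comp|exact: pmap_id|].
  by apply: hom_refl => //; exact: pmap_comp.
rewrite (pif_hom (k := id)) ?pif_id//; [exact: pmap_comp|exact: pmap_id|].
by apply: hom_refl => //; exact: pmap_comp.
Qed.

Lemma pin_coords n (X : topologicalType) (x0 : X) (M : pcs) (f : Top x0 -> M) g :
  inv_pair f g -> exists h : piG n M -> pin n.+2 x0,
  [/\ cancel (fun A => pif f (pin_pi A : piG n (Top x0))) h,
      cancel h (fun A => pif f (pin_pi A : piG n (Top x0))) &
      forall A B : pin n.+2 x0, pif f (pin_pi (pin_mul n.+2 x0 A B) : piG n (Top x0)) =
        pif f (pin_pi A : piG n (Top x0)) + pif f (pin_pi B : piG n (Top x0))].
Proof.
move=> fg; have [k1 k2] := pif_inv_pair n fg; have [pf _ _ _] := fg.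
have /choice [h hh] := @pin_pi_surj n.+2 X x0.
exists (fun C => h (pif g C)); split=> [A|C|A B].
- by apply: pin_pi_inj; rewrite hh k1.
- by rewrite hh k2.
- by rewrite pin_pi_mul pif_add.
Qed.

Lemma sphere_coords n d : exists z : (pin n.+2 (sph_pt d) -> piG n (Sn unit_cs d)) *
    (piG n (Sn unit_cs d) -> pin n.+2 (sph_pt d)),
  [/\ cancel z.1 z.2, cancel z.2 z.1 &
      forall A B, z.1 (pin_mul n.+2 (sph_pt d) A B) = z.1 A + z.1 B].
Proof.
have [f [g fg]] := sphere_Sn d; have [h [h1 h2 h3]] := pin_coords n fg.
by exists (fun A => pif f (pin_pi A : piG n (Top (sph_pt d))), h).
Qed.

(** The section of [p] extends coordinates from the kernel to the whole group; together with [p]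
    they determine an element and can be prescribed freely. At [k = 0] the kernel is the group of
    [S^m] alone, which is why the last clause requires [0 < k]. *)
Lemma fiber_coords n m k : (1 < m)%N ->
  exists z : {l : seq nat & forall i, piG n (bw unit_cs (nseq k.+1 m)) ->
    piG n (Sn unit_cs (nth 0%N l i))},
  let l := projT1 z in let q := projT2 z in
  let p := pif (@wproj (Sn unit_cs m) (bw unit_cs (nseq k m))) in
  [/\ forall i x y, q i (x + y) = q i x + q i y,
      forall x y, p x = p y -> (forall i, (i < size l)%N -> q i x = q i y) -> x = y,
      forall b (y : forall i, piG n (Sn unit_cs (nth 0%N l i))), exists x,
        p x = b /\ forall i, (i < size l)%N -> q i x = y i,
      all (fun x => hdim m x && (x <= n.+2)%N) l &
      (0 < k)%N -> forall x, hdim m x -> (x <= n.+2)%N -> x \in l].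
Proof.
move=> m1; case: k => [|k].
  have hm : all (hdim m) [:: m] by rewrite /= hdim_id.
  have [l [[q [qD qI qS]] l2 _]] := hilton n m1 hm.
  exists (existT _ l q) => /=; split=> //.
    by move=> x y _; exact: qI.
  move=> b y; have [x hx] := qS y; exists x; split=> //.
  have h (c : piG n (bw unit_cs [::])) : c = 0 by exact: piG_bw_high.
  by rewrite [b]h; exact: h.
have [G [j [l [[jD j0 pj jk] [[q [qD qI qS]] l2 l3]]]]] := last_sphere_kernel n k m1.
pose S := Sn unit_cs m; pose X := bw unit_cs (nseq k.+1 m).
pose p := pif (n := n) (@wproj S X).
have pp : pmap (@wproj S X) := pmap_wdg2 S X.
have ps := pmap_win2 S X; pose s := pif (n := n) (@win2 S X).
have sK b : p (s b) = b by rewrite /p /s pif_comp// -[RHS]pif_id.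
have pD x y : p (x + y) = p x + p y by exact: pif_add.
have sD x y : s (x + y) = s x + s y by exact: pif_add.
have pB : forall x y, p (x - y) = p x - p y := additiveB pD.
have jB : forall x y, j (x - y) = j x - j y := additiveB jD.
have jI : injective j.
  by move=> x y e; apply/eqP; rewrite -subr_eq0; apply/eqP/j0; rewrite jB e subrr.
(* [r] is the projection onto the kernel along the section [s]. *)
have /choice [r hr] : forall g, exists x, j x = g - s (p g).
  by move=> g; apply: jk; rewrite -/p pB sK subrr.
have rD x y : r (x + y) = r x + r y.
  by apply: jI; rewrite jD !hr pD sD opprD addrACA.
exists (existT _ l (fun i g => q i (r g))) => /=; split=> //.
- by move=> i x y; rewrite rD qD.
- move=> x y e h; have e2 := qI _ _ h.
  have := hr x; rewrite e2 hr -/p [p x]e => /(congr1 (fun z => z + s (p y))).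
  by rewrite !subrK.
- move=> b y; have [x hx] := qS y; exists (j x + s b).
  have pb : p (j x + s b) = b by rewrite pD sK [p _]pj add0r.
  split=> // i il; rewrite -hx//; congr (q i _); apply: jI.
  by rewrite hr pb addrK.
Qed.

(** A thread is built stage by stage, since over a given element of the previous group the kernel
    coordinates are free. The wedge of no spheres has trivial group, which starts the recursion. *)
Lemma thread_coords n m : (1 < m)%N ->
  exists (L : nat -> seq nat)
    (F : forall k i, piG n (bw unit_cs (nseq k.+1 m)) -> piG n (Sn unit_cs (nth 0%N (L k) i))),
  let thread (g : forall k, piG n (bw unit_cs (nseq k.+1 m))) := forall k,
    pif (@wproj (Sn unit_cs m) (bw unit_cs (nseq k.+1 m))) (g k.+1) = g k in
  [/\ forall k i x y, F k i (x + y) = F k i x + F k i y,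
      forall g g', thread g -> thread g' ->
        (forall k i, (i < size (L k))%N -> F k i (g k) = F k i (g' k)) -> g = g',
      forall y : (forall k i, piG n (Sn unit_cs (nth 0%N (L k) i))), exists g, thread g /\
        forall k i, (i < size (L k))%N -> F k i (g k) = y k i,
      forall k, all (fun x => hdim m x && (x <= n.+2)%N) (L k) &
      forall k x, hdim m x -> (x <= n.+2)%N -> x \in L k.+1].
Proof.
move=> m1; have [Z hZ] := dep_choice (fun k => fiber_coords n k m1).
exists (fun k => projT1 (Z k)), (fun k => projT2 (Z k)) => thread; split.
- by move=> k; have [h _ _ _ _] := hZ k.
- move=> g g' tg tg' h; apply: functional_extensionality_dep; elim=> [|k IH].
    have [_ inj _ _ _] := hZ 0%N; apply: inj; last exact: h.
    have t0 (c : piG n (bw unit_cs [::])) : c = 0 by exact: piG_bw_high.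
    by rewrite [LHS]t0 [RHS]t0.
  by have [_ inj _ _ _] := hZ k.+1; apply: inj; [rewrite tg tg'|exact: h].
- move=> y.
  (* [nx k b] is a lift of [b] with the prescribed coordinates [y k]. *)
  have [nx hnx] := dep_choice (fun k => let: And5 _ _ h _ _ := hZ k in
    let: existT nx hnx := choice (fun b => h b (y k)) in ex_intro _ nx hnx).
  pose g := fix g k : piG n (bw unit_cs (nseq k.+1 m)) :=
    match k return piG n (bw unit_cs (nseq k.+1 m)) with
    | 0 => nx 0%N 0 | k.+1 => nx k.+1 (g k) end.
  exists g; split; first by move=> k; have [] := hnx k.+1 (g k).
  by case=> [|k] i il; [have [_ h] := hnx 0%N 0|have [_ h] := hnx k.+1 (g k)]; exact: h.
- by move=> k; have [_ _ _ h _] := hZ k.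
- by move=> k; have [_ _ _ _ h] := hZ k.+1; exact: h.
Qed.

(** Transport between equal dimensions, made total by the value 0 so that no equality proofs occur
    in the formulas. *)
Definition cast_piG n d d' (x : piG n (Sn unit_cs d)) : piG n (Sn unit_cs d') :=
  if pselect (d = d') is left e then eq_rect d (fun d => piG n (Sn unit_cs d)) x d' e
  else 0.

Lemma cast_piG_id n d (x : piG n (Sn unit_cs d)) : cast_piG d x = x.
Proof. by rewrite /cast_piG; case: pselect => // e; rewrite (eq_axiomK e). Qed.

Lemma cast_piG_add n d d' (x y : piG n (Sn unit_cs d)) :
  cast_piG d' (x + y) = cast_piG d' x + cast_piG d' y.
Proof.
have [e|e] := pselect (d = d'); first by subst d'; rewrite !cast_piG_id.
by rewrite /cast_piG; case: pselect => // _; rewrite addr0.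
Qed.

Lemma cast_piGK n d d' (x : piG n (Sn unit_cs d)) : d = d' ->
  cast_piG d (cast_piG d' x) = x.
Proof. by move=> e; subst d'; rewrite !cast_piG_id. Qed.

Lemma rdimE m j : (1 < m)%N -> rdim m j = (j.+1 * m.-1).+1.
Proof. by case: m => // m _; rewrite /rdim /= mulSn addKn addn1 mulnC. Qed.

Lemma rdim_hdim m j n : (1 < m)%N -> (j < n.+1 %/ m.-1)%N ->
  hdim m (rdim m j) && (rdim m j <= n.+2)%N.
Proof.
move=> m1 hj; rewrite rdimE// /hdim /= dvdn_mull//= ltnS.
rewrite -leq_divRL ?hj; last by lia.
by rewrite andbT mulSn; lia.
Qed.

Lemma hdim_rdim m x n : (1 < m)%N -> hdim m x -> (x <= n.+2)%N ->
  exists2 j, (j < n.+1 %/ m.-1)%N & x = rdim m j.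
Proof.
move=> m1 /andP[/dvdnP [i hi] mx] xn.
have i0 : (0 < i)%N by case: i hi => //; lia.
exists i.-1; last by rewrite rdimE// prednK// -hi; lia.
rewrite prednK// leq_divRL; last by lia.
by rewrite -hi; lia.
Qed.

Lemma rdim_inj m j j' : (1 < m)%N -> rdim m j = rdim m j' -> j = j'.
Proof. by move=> m1; rewrite !rdimE//; nia. Qed.

(** The multiplicity of [x] at a single stage is irrelevant: over all stages the occurrences form a
    countable set, infinite since each [L k.+1] contributes. *)
Lemma positions_enum (L : nat -> seq nat) x : (forall k, x \in L k.+1) ->
  exists e : nat -> nat * nat, set_bij [set: nat]
    [set z | (z.2 < size (L z.1))%N /\ nth 0%N (L z.1) z.2 = x] e.
Proof.
move=> hL; apply/card_set_bijP; rewrite card_eq_le; apply/andP; split; last exact: countableP.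
have h : [set (k.+1, index x (L k.+1)) | k in [set: nat]] `<=`
    [set z | (z.2 < size (L z.1))%N /\ nth 0%N (L z.1) z.2 = x].
  by move=> _ [k _ <-] /=; rewrite index_mem hL nth_index.
apply: card_le_trans (subset_card_le h).
have : ([set (k.+1, index x (L k.+1)) | k in [set: nat]] #= [set: nat])%card.
  by apply: inj_card_eq => a b _ _ [].
by rewrite card_eq_le => /andP[].
Qed.

(* Cech pi_n(E_m) = threads c (c k in pi_n(X_{<=k+1})) compatible under the
   bonding maps, with componentwise product; RHS = finite product over
   1 <= j <= (n-1)/(m-1) of countable products of pi_n(S^{mj-j+1}).
   "isomorphism" = bijection from the threads onto RHS preserving products. *)
Theorem theorem1p1 (m n : nat) (hm : (2 <= m)%N) (hn : (2 <= n)%N) :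
  exists phi : (forall k, pin n (wedge_pt m k)) -> rhs m n,
    (forall a b, cech_thread m n a -> cech_thread m n b -> phi a = phi b -> a = b) /\
    (forall y, exists a, cech_thread m n a /\ phi a = y) /\
    (forall a b, cech_thread m n a -> cech_thread m n b ->
       phi (cech_mul m n a b) = rhs_mul m n (phi a) (phi b)).
Proof.
case: n hn => [|[|n]] // _.
have [f [g fg]] := sphere_Sn m; have [pf _ _ _] := fg.
pose al k (c : pin n.+2 (wedge_pt m k)) : piG n (bw unit_cs (nseq k.+1 m)) :=
  pif (to_bw f (k := k)) (pin_pi c : piG n (Top (wedge_pt m k))).
have /dep_choice [al' hal] : forall k,
    exists h : piG n (bw unit_cs (nseq k.+1 m)) -> pin n.+2 (wedge_pt m k),
    [/\ cancel (al k) h, cancel h (al k) &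
        forall A B, al k (pin_mul n.+2 _ A B) = al k A + al k B].
  by move=> k; have [h hh] := wedge_bw fg k; exact: (pin_coords n hh).
have [B hB] := dep_choice (sphere_coords n).
have [L [F [FD FI FS Ll Lfull]]] := thread_coords n hm.
pose thread (x : forall k, piG n (bw unit_cs (nseq k.+1 m))) := forall k,
    pif (@wproj (Sn unit_cs m) (bw unit_cs (nseq k.+1 m))) (x k.+1) = x k.
have bondal k (c : pin n.+2 (wedge_pt m k.+1)) :
    al k (pin_map n.+2 (bond m k) c) =
    pif (@wproj (Sn unit_cs m) (bw unit_cs (nseq k.+1 m))) (al k.+1 c).
  have pb : @pmap (Top (wedge_pt m k.+1)) (Top (wedge_pt m k)) (bond m k).
    by apply: pmap_Top; [exact: bond_continuous|exact: bond_pt].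
  have [h [ph _ _ _]] := wedge_bw fg k; have [h1 [ph1 _ _ _]] := wedge_bw fg k.+1.
  rewrite /al (pin_pi_map c (@bond_continuous m k) (bond_pt m k)).
  rewrite pif_comp//; symmetry; exact: (pif_comp _ ph1 (pmap_wdg2 _ _)).
have thrP c : cech_thread m n.+2 c <-> thread (fun k => al k (c k)).
  split=> h k; first by rewrite -bondal h.
  by have [al1 _ _] := hal k; apply: (can_inj al1); rewrite bondal; exact: h.
have /choice [e he] : forall j : 'I_(n.+1 %/ m.-1), exists e : nat -> nat * nat,
    set_bij [set: nat]
      [set z | (z.2 < size (L z.1))%N /\ nth 0%N (L z.1) z.2 = rdim m j] e.
  move=> j; apply: positions_enum => k.
  by have /andP[h1 h2] := rdim_hdim hm (ltn_ord j); exact: Lfull.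
have eP j l : ((e j l).2 < size (L (e j l).1))%N /\
    nth 0%N (L (e j l).1) (e j l).2 = rdim m j.
  by have [h _ _] := he j; exact: (h l).
(* Each kernel coordinate has a dimension of the form [rdim m j], hence is enumerated; by [eI] it is
   enumerated once. *)
have eS k i : (i < size (L k))%N -> exists j l, e j l = (k, i).
  move=> il; have /andP[h1 h2] := allP (Ll k) _ (mem_nth 0%N il).
  have [j jJ hj] := hdim_rdim hm h1 h2.
  by have [_ _ /(_ (k, i))] := he (Ordinal jJ); case=> // l _ el; exists (Ordinal jJ), l.
have eI j l j' l' : e j l = e j' l' -> j = j' /\ l = l'.
  move=> h; have [_ h1] := eP j l; have [_ h2] := eP j' l'.
  have ej : j = j' by apply: val_inj; apply: (rdim_inj hm); rewrite -h1 -h2 h.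
  by subst j'; split=> //; have [_ inj _] := he j; apply: inj; rewrite ?inE.
(* The position [e j l] carries dimension [rdim m j] only up to a provable equality, hence the
   cast. *)
pose phi (c : forall k, pin n.+2 (wedge_pt m k)) : rhs m n.+2 := fun j l =>
  (B (rdim m j)).2 (cast_piG (rdim m j) (F (e j l).1 (e j l).2 (al _ (c (e j l).1)))).
exists phi; split; last split.
- move=> a b /thrP ta /thrP tb h.
  have h1 := FI _ _ ta tb.
  suff E : (fun k => al k (a k)) = (fun k => al k (b k)).
    apply: functional_extensionality_dep => k; have [al1 _ _] := hal k.
    by apply: (can_inj al1); exact: (congr1 (fun z => z k) E).
  apply: h1 => k i il; have [j [l E]] := eS k i il.
  have := congr1 (fun z => z j l) h; rewrite /phi.
  have [_ B2 _] := hB (rdim m j); move=> /(can_inj B2) /(congr1 (cast_piG _)).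
  have [_ ed] := eP j l; move: ed; rewrite E /= => ed.
  by move=> /(_ (nth 0%N (L k) i)); rewrite !cast_piGK.
- move=> y.
  (* Position [(k, i)] receives [y j l] for the only pair with [e j l = (k, i)]; positions that are
     not enumerated receive 0. *)
  have /dep_choice [Y hY] : forall k, exists Yk : forall i, piG n (Sn unit_cs (nth 0%N (L k) i)),
      forall i j l, e j l = (k, i) -> cast_piG (rdim m j) (Yk i) = (B (rdim m j)).1 (y j l).
    move=> k; suff /dep_choice [Yk hYk] : forall i,
        exists v : piG n (Sn unit_cs (nth 0%N (L k) i)),
        forall j l, e j l = (k, i) -> cast_piG (rdim m j) v = (B (rdim m j)).1 (y j l).
      by exists Yk.
    move=> i.
    have [[j [l E]]|no] := pselect (exists j l, e j l = (k, i)); last first.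
      by exists 0 => j l E; case: no; exists j, l.
    exists (cast_piG _ ((B (rdim m j)).1 (y j l))) => j' l' E'.
    have [ej el] := eI j' l' j l (etrans E' (esym E)); subst j' l'.
    by have [_ ed] := eP j l; rewrite E /= in ed; rewrite cast_piGK.
  have [x [tx hx]] := FS Y.
  have alE k : al k (al' k (x k)) = x k by have [_ h _] := hal k; exact: h.
  exists (fun k => al' k (x k)); split.
    apply/thrP => k; rewrite !alE; exact: tx.
  apply: functional_extensionality_dep => j; apply/funext => l; rewrite /phi alE.
  have [il _] := eP j l; rewrite hx//.
  have [B1 _ _] := hB (rdim m j); rewrite -[RHS]B1; congr ((B _).2 _).
  by apply: hY; rewrite -surjective_pairing.
- move=> a b _ _; apply: functional_extensionality_dep => j; apply/funext => l.
  have [B1 B2 BD] := hB (rdim m j); apply: (can_inj B1).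
  rewrite /rhs_mul BD !B2 /cech_mul.
  by have [_ _ ->] := hal (e j l).1; rewrite FD cast_piG_add.
Qed.
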